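(* The $\mathcal Z$-module $\dot D$ is a $\mathcal Z$-subalgebra of $\dot{\mathbf D}$ (i.e. it is closed under multiplication). Thus $\dot D$ is an integral form of $\dot{\mathbf D}$ (i.e. a $\mathcal Z$-subalgebra, free over $\mathcal Z$, with $\dot{\mathbf D}=\dot D\otimes_{\mathcal Z}\mathbb Q(\upsilon)$).
   Context: NOTATION. Fix an integer $n\ge 2$; $\mathbb N=\{0,1,2,\dots\}$; $\upsilon$ is an indeterminate; $\mathcal Z=\mathbb Z[\upsilon,\upsilon^{-1}]$. $\mathbb Z_\triangle^n$ is the set of integer sequences $\lambda=(\lambda_i)_{i\in\mathbb Z}$ with $\lambda_i=\lambda_{i-n}$ (identified with $\mathbb Z^n$ via $(\lambda_1,\dots,\lambda_n)$); $\mathbb N_\triangle^n$ is the subset with all entries $\ge 0$; addition and $\ge$ are componentwise; $e_i$ ($i$ mod $n$) is the $i$-th standard basis vector. Put $\lambda\cdot\mu=\sum_{i=1}^n\lambda_i\mu_i$ and $\langle\lambda,\mu\rangle=\sum_{i=1}^n\lambda_i\mu_i-\sum_{i=1}^n\lambda_i\mu_{i+1}$. $\Theta_\triangle(n)$ is the set of matrices $A=(a_{i,j})_{i,j\in\mathbb Z}$ with $a_{i,j}\in\mathbb N$, $a_{i,j}=a_{i+n,j+n}$, and finitely many nonzero entries in each row and column. $\Theta^+_\triangle(n)=\{A\in\Theta_\triangle(n): a_{i,j}=0\text{ for }i\ge j\}$. $E^\triangle_{i,j}\in\Theta_\triangle(n)$ has entries $1$ at positions $(i+sn,j+sn)$,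 $s\in\mathbb Z$, and $0$ elsewhere. For $\lambda\in\mathbb N^n_\triangle$ put $A_\lambda=\sum_{i=1}^n\lambda_iE^\triangle_{i,i+1}$. REPRESENTATIONS. Consider the cyclic quiver with vertex set $\mathbb Z/n\mathbb Z$ and arrows $i\to i+1$. Over a field $\mathbb F$, $S_i$ is the simple representation with $\mathbb F$ at vertex $i$ and $0$ elsewhere, $M^{i,j}$ ($i<j$) is the unique indecomposable representation of length $j-i$ with top $S_i$, and for $A\in\Theta_\triangle^+(n)$, $M_{\mathbb F}(A)=\bigoplus_{1\le i\le n,\,i<j}a_{i,j}M^{i,j}$. Its dimension vector is $\mathbf d(A)=(\sum_{s\le i<t}a_{s,t})_{i\in\mathbb Z}\in\mathbb N^n_\triangle$. For $A,B,C\in\Theta^+_\triangle(n)$ the Hall polynomial $\varphi^C_{A,B}\in\mathbb Z[\upsilon^2]$ satisfies: for every finite field $\mathbb F_q$, $\varphi^C_{A,B}|_{\upsilon^2=q}$ is the number of submodules $N\subseteq M_{\mathbb F_q}(C)$ with $N\cong M_{\mathbb F_q}(B)$ and $M_{\mathbb F_q}(C)/N\cong M_{\mathbb F_q}(A)$. THE DOUBLE RINGEL–HALL ALGEBRA $\mathbf D$ is the $\mathbb Q(\upsilon)$-algebra generated by $u_A^+,u_A^-$ ($A\in\Theta^+_\triangle(n)$) and $K_i^{\pm1}$ ($i\in\mathbb Z$) with relations (where $K^{\mathbf j}=K_1^{j_1}\cdots K_n^{j_n}$, $\tilde K_i=K_iK_{i+1}^{-1}$, $\tilde K^\nu=\tilde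 K_1^{\nu_1}\cdots\tilde K_n^{\nu_n}$): (1) $K_i=K_{i+n}$, $K_iK_j=K_jK_i$, $K_iK_i^{-1}=1$, $u_0^\pm=1$; (2) $K^{\mathbf j}u_A^+=\upsilon^{\langle\mathbf d(A),\mathbf j\rangle}u_A^+K^{\mathbf j}$, $u_A^-K^{\mathbf j}=\upsilon^{\langle\mathbf d(A),\mathbf j\rangle}K^{\mathbf j}u_A^-$; (3) $u_A^+u_B^+=\sum_C\upsilon^{\langle\mathbf d(A),\mathbf d(B)\rangle}\varphi^C_{A,B}u_C^+$; (4) $u_A^-u_B^-=\sum_C\upsilon^{\langle\mathbf d(B),\mathbf d(A)\rangle}\varphi^C_{B,A}u_C^-$; (5) for $\lambda,\mu\in\mathbb N^n_\triangle$, with both sums over $\alpha,\beta\in\mathbb N^n_\triangle$ such that $\lambda-\alpha=\mu-\beta\ge0$: $$\upsilon^{\langle\mu,\mu\rangle}\sum\kappa_{\lambda,\mu}^{\alpha,\beta}\upsilon^{\langle\beta,\lambda+\mu-\beta\rangle}\tilde K^{\mu-\beta}u^-_{A_\beta}u^+_{A_\alpha}=\upsilon^{\langle\mu,\lambda\rangle}\sum\kappa_{\lambda,\mu}^{\alpha,\beta}\upsilon^{\langle\mu-\beta,\alpha\rangle+\langle\mu,\beta\rangle}\tilde K^{\beta-\mu}u^+_{A_\alpha}u^-_{A_\beta},$$ $\kappa_{\lambda,\mu}^{\alpha,\beta}=\upsilon^{2\sum_{i=1}^n(\lambda_i-\alpha_i)(1-\alpha_i-\beta_i)}\prod_{1\le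 i\le n,\;0\le s\le\lambda_i-\alpha_i-1}(\upsilon^{2(\lambda_i-\alpha_i)}-\upsilon^{2s})^{-1}$. It is known that $\{u_A^+K^{\mathbf j}u_B^-\}$ ($A,B\in\Theta_\triangle^+(n)$, $\mathbf j\in\mathbb Z^n_\triangle$) is a $\mathbb Q(\upsilon)$-basis of $\mathbf D$. Put $\tilde u_A^\pm=\upsilon^{\dim\operatorname{End}(M(A))-\dim M(A)}u_A^\pm$. GRADING. Let $\alpha_i=e_i-e_{i+1}$ ($1\le i\le n$) and $\mathbb Z\Pi=\sum_i\mathbb Z\alpha_i\subseteq\mathbb Z^n_\triangle$. $\mathbf D=\bigoplus_{\nu\in\mathbb Z\Pi}\mathbf D_\nu$ is graded by $\deg u_A^+=\sum_{i=1}^nd_i\alpha_i$, $\deg u_A^-=-\sum_{i=1}^nd_i\alpha_i$ (where $\mathbf d(A)=(d_i)$), $\deg K_i^{\pm1}=0$. MODIFIED ALGEBRA. For $\lambda,\mu\in\mathbb Z^n_\triangle$ let ${}_\lambda\mathbf D_\mu=\mathbf D/\big(\sum_{\mathbf j}(K^{\mathbf j}-\upsilon^{\lambda\cdot\mathbf j})\mathbf D+\sum_{\mathbf j}\mathbf D(K^{\mathbf j}-\upsilon^{\mu\cdot\mathbf j})\big)$ with canonical projection $\pi_{\lambda,\mu}$, and $\dot{\mathbf D}=\bigoplus_{\lambda,\mu}{}_\lambda\mathbf D_\mu$. One has $\pi_{\lambda,\mu}(\mathbf D_\nu)=0$ if $\nu\ne\lambda-\mu$. Product on $\dot{\mathbf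 D}$: for $t\in\mathbf D_{\lambda'-\mu'}$, $s\in\mathbf D_{\lambda''-\mu''}$, $\pi_{\lambda',\mu'}(t)\pi_{\lambda'',\mu''}(s)=\pi_{\lambda',\mu''}(ts)$ if $\mu'=\lambda''$ and $0$ otherwise; this makes $\dot{\mathbf D}$ an associative $\mathbb Q(\upsilon)$-algebra (without unit). $\dot{\mathbf D}$ is a $\mathbf D$-bimodule via $t'\pi_{\lambda',\lambda''}(s)t''=\pi_{\lambda'+\nu',\lambda''-\nu''}(t'st'')$ for $t'\in\mathbf D_{\nu'}$, $t''\in\mathbf D_{\nu''}$, $s\in\mathbf D$. Put $1_\lambda=\pi_{\lambda,\lambda}(1)$. INTEGRAL VERSION. $\dot D$ is the $\mathcal Z$-span in $\dot{\mathbf D}$ of $\{\tilde u_A^+1_\lambda\tilde u_B^-: A,B\in\Theta^+_\triangle(n),\lambda\in\mathbb Z^n_\triangle\}$; this set is a $\mathcal Z$-basis of $\dot D$ and a $\mathbb Q(\upsilon)$-basis of $\dot{\mathbf D}$. *)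

(* Defs.v *)
From HB Require Import structures.
From mathcomp Require Import all_boot all_order all_algebra finmap.
From mathcomp Require Import generic_quotient ring_quotient fraction.
From mathcomp Require Import boolp classical_sets fsbigop.

Set Implicit Arguments.
Unset Strict Implicit.
Unset Printing Implicit Defensive.

Import GRing.Theory.
Local Open Scope ring_scope.
Local Open Scope quotient_scope.

(* Index vectors. Residue classes mod n are the elements of 'I_n, with cyclic *)
(* successor ordS (the class of n being 0), and a periodic sequence is the    *)
(* function that it induces on residue classes.                               *)

Notation Zn n := {ffun 'I_n -> int}.
Notation Nn n := {ffun 'I_n -> nat}.

Section IndexVectors.
Variable n : nat.
Implicit Types (l m nu : Zn n) (i : 'I_n).

Definition zv (a : Nn n) : Zn n := [ffun i => (a i)%:Z].
Definition evec i : Zn n := [ffun k => (k == i)%:R].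
Definition alpha i : Zn n := evec i - evec (ordS i).
Definition rootv nu : Zn n := \sum_i alpha i *~ nu i.
Definition dot l m : int := \sum_i l i * m i.
Definition eul l m : int := \sum_i l i * m i - \sum_i l i * m (ordS i).

Lemma dotDl l l' m : dot (l + l') m = dot l m + dot l' m.
Proof.
by rewrite /dot -big_split; apply: eq_bigr => i _; rewrite ffunE mulrDl.
Qed.

Lemma dot0l m : dot 0 m = 0.
Proof. by rewrite /dot big1 // => i _; rewrite ffunE mul0r. Qed.

Lemma dotNl l m : dot (- l) m = - dot l m.
Proof. by apply/eqP; rewrite -subr_eq0 opprK -dotDl addNr dot0l. Qed.

Lemma dot_evec i m : dot (evec i) m = m i.
Proof.
rewrite /dot (bigD1 i) //= ffunE eqxx mul1r big1 ?addr0 // => k /negbTE ki.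
by rewrite ffunE ki mul0r.
Qed.

Lemma dot_rootv nu m : dot (rootv nu) m = eul nu m.
Proof.
have dotM (k : int) l : dot (l *~ k) m = k * dot l m.
  rewrite /dot mulr_sumr; apply: eq_bigr => i _.
  have -> : (l *~ k) i = l i *~ k.
    case: k => k; first by rewrite -!pmulrn ffunMnE.
    by rewrite !NegzE !mulrNz -!pmulrn ffunE ffunMnE.
  by rewrite -mulrzl intz mulrA.
rewrite /rootv /eul -sumrB.
have -> : dot (\sum_i alpha i *~ nu i) m = \sum_i dot (alpha i *~ nu i) m.
  by apply: (big_morph (fun l => dot l m)) => [l l'|];
    [exact: dotDl | exact: dot0l].
apply: eq_bigr => i _; rewrite dotM /alpha dotDl dotNl !dot_evec.
by rewrite mulrBr.
Qed.

End IndexVectors.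

(* A matrix A of Theta^+ is stored by its rows 1..n above the diagonal:       *)
(* A (i, l) is the entry a_{i,i+l+1}, i.e. the multiplicity in M(A) of the    *)
(* indecomposable M^{i,i+l+1}, which has top S_i and length l+1. All other    *)
(* entries of A are zero or are given by periodicity.                         *)
Notation Theta n := {fsfun ('I_n * nat)%type -> nat with 0%N}.

Definition Theta0 n : Theta n := [fsfun].

(* A_lambda = sum_i lambda_i E_{i,i+1} *)
Definition Adiag n (a : Nn n) : Theta n :=
  [fsfun p in [fset (i, 0%N) | i in 'I_n]%fset => a p.1 | 0%N].

(* Representations of the cyclic quiver; vectors are rows, acted on from the  *)
(* right.                                                                     *)

Record rep (F : fieldType) (n : nat) := Rep {
  rdim : 'I_n -> nat;
  rarr : forall i, 'M[F]_(rdim i, rdim (ordS i)) }.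

Section Representations.
Variable n : nat.
Implicit Types (A B C : Theta n) (v : 'I_n).

(* The standard basis of M(A): ((i, l), c, k) with c < A (i, l) and k <= l is *)
(* the k-th vector, at vertex i + k, of the c-th copy of M^{i,i+l+1}; the     *)
(* arrow sends it to the (k+1)-st vector of that copy, or to 0 when k = l.    *)
Definition cell := (('I_n * nat) * nat * nat)%type.
Definition cells A : seq cell :=
  [seq (q.1, q.2, k) | q <- [seq (p, c) | p <- finsupp A, c <- iota 0 (A p)],
                       k <- iota 0 q.1.2.+1].
Definition cell_vertex (b : cell) : 'I_n := iter b.2 (@ordS n) b.1.1.1.
Definition cell_next (b : cell) : cell := (b.1, b.2.+1).
Definition cells_at A v : seq cell := [seq b <- cells A | cell_vertex b == v].

Definition Mrep (F : fieldType) A : rep F n :=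
  @Rep F n (fun v => size (cells_at A v))
    (fun v => \matrix_(r, s)
      (tnth (in_tuple (cells_at A (ordS v))) s
         == cell_next (tnth (in_tuple (cells_at A v)) r))%:R).

Definition dimvec A : Zn n := [ffun v => (size (cells_at A v))%:Z].
Definition dimM A : nat := size (cells A).

Section FiniteField.
Variable F : finFieldType.
Implicit Types V W : rep F n.

Notation linmaps V W := {dffun forall v : 'I_n, 'M[F]_(rdim V v, rdim W v)}.
Notation subspaces V := {dffun forall v : 'I_n, 'M[F]_(rdim V v)}.

Definition is_hom V W (f : linmaps V W) : bool :=
  [forall v, f v *m rarr W v == rarr V v *m f (ordS v)].

(* A subspace of V_v is represented by the canonical square matrix <<_>> of   *)
(* which it is the row space.                                                 *)
Definition is_subrep V (N : subspaces V) : bool :=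
  [forall v, (<<N v>>%MS == N v) && (N v *m rarr V v <= N (ordS v))%MS].

(* N is isomorphic to W: some monomorphism W -> V has image N *)
Definition sub_iso V W (N : subspaces V) : bool :=
  [exists f : linmaps W V,
     is_hom f && [forall v, row_free (f v) && (f v == N v)%MS]].

(* V / N is isomorphic to W: some epimorphism V -> W has kernel N *)
Definition quo_iso V W (N : subspaces V) : bool :=
  [exists g : linmaps V W,
     is_hom g && [forall v, row_full (g v) && (kermx (g v) == N v)%MS]].

Definition hall_count A B C : nat :=
  #|[pred N : subspaces (Mrep F C) |
       [&& is_subrep N, sub_iso (Mrep F B) N & quo_iso (Mrep F A) N]]|.

Definition card_end A : nat :=
  #|[pred f : linmaps (Mrep F A) (Mrep F A) | is_hom f]|.

End FiniteField.

(* dim End(M(A)) does not depend on the field; over the field with two        *)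
(* elements End(M(A)) has 2 ^ dim elements.                                   *)
Definition dim_end A : nat := logn 2 (card_end 'F_2 A).

(* phi A B C is the Hall polynomial as a polynomial in q = v^2 *)
Definition is_hall_polynomials (phi : Theta n -> Theta n -> Theta n -> {poly int})
  : Prop :=
  forall A B C (F : finFieldType),
    (phi A B C).[#|F|%:R] = (hall_count F A B C)%:R.

End Representations.

Notation Qv := {fraction {poly rat}}.
Definition vv : Qv := tofrac 'X.

(* c is in Z[v, v^-1] *)
Definition laurent (c : Qv) : Prop :=
  exists (p : {poly int}) (k : nat), c = tofrac (map_poly intr p) / vv ^+ k.

Lemma vv_unit : vv \is a GRing.unit.
Proof. by rewrite unitfE /vv tofrac_eq0 polyX_eq0. Qed.

(* Terms modulo the smallest congruence that contains R and the axioms of     *)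
(* K-algebras: the K-algebra with generators G and relations R.               *)

Section Presentation.
Variables (K : fieldType) (G : Type).

Inductive term :=
  | TZero | TOne | TGen of G
  | TAdd of term & term | TMul of term & term | TScale of K & term.

Variable R : term -> term -> Prop.

Inductive pcong : term -> term -> Prop :=
  | pc_rel x y : R x y -> pcong x y
  | pc_refl x : pcong x x
  | pc_sym x y : pcong x y -> pcong y x
  | pc_trans x y z : pcong x y -> pcong y z -> pcong x z
  | pc_add x x' y y' :
      pcong x x' -> pcong y y' -> pcong (TAdd x y) (TAdd x' y')
  | pc_mul x x' y y' :
      pcong x x' -> pcong y y' -> pcong (TMul x y) (TMul x' y')
  | pc_scale c x x' : pcong x x' -> pcong (TScale c x) (TScale c x')
  | pc_addA x y z : pcong (TAdd x (TAdd y z)) (TAdd (TAdd x y) z)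
  | pc_addC x y : pcong (TAdd x y) (TAdd y x)
  | pc_add0 x : pcong (TAdd TZero x) x
  | pc_addN x : pcong (TAdd (TScale (- 1) x) x) TZero
  | pc_mulA x y z : pcong (TMul x (TMul y z)) (TMul (TMul x y) z)
  | pc_1mul x : pcong (TMul TOne x) x
  | pc_mul1 x : pcong (TMul x TOne) x
  | pc_mulDl x y z : pcong (TMul (TAdd x y) z) (TAdd (TMul x z) (TMul y z))
  | pc_mulDr x y z : pcong (TMul x (TAdd y z)) (TAdd (TMul x y) (TMul x z))
  | pc_scaleA a b x : pcong (TScale a (TScale b x)) (TScale (a * b) x)
  | pc_scale1 x : pcong (TScale 1 x) x
  | pc_scaleDr a x y :
      pcong (TScale a (TAdd x y)) (TAdd (TScale a x) (TScale a y))
  | pc_scaleDl a b x :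
      pcong (TScale (a + b) x) (TAdd (TScale a x) (TScale b x))
  | pc_scaleAl a x y : pcong (TScale a (TMul x y)) (TMul (TScale a x) y)
  | pc_scaleAr a x y : pcong (TScale a (TMul x y)) (TMul x (TScale a y)).

HB.instance Definition _ := gen_eqMixin term.
HB.instance Definition _ := gen_choiceMixin term.

Definition pcongb (x y : term) : bool := `[< pcong x y >].

Lemma pcongb_refl : reflexive pcongb.
Proof. by move=> x; apply/asboolP/pc_refl. Qed.
Lemma pcongb_sym : symmetric pcongb.
Proof. by move=> x y; apply/asboolP/asboolP; apply: pc_sym. Qed.
Lemma pcongb_trans : transitive pcongb.
Proof.
by move=> y x z /asboolP xy /asboolP yz; apply/asboolP; apply: pc_trans xy yz.
Qed.

Canonical pcong_equiv := EquivRel pcongb pcongb_refl pcongb_sym pcongb_trans.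

Definition presented := {eq_quot pcong_equiv}.
HB.instance Definition _ := Choice.on presented.

Definition pclass (x : term) : presented := \pi_({eq_quot pcong_equiv}) x.
Definition prepr (q : presented) : term := repr (q : {eq_quot pcong_equiv}).

Lemma preprK q : pclass (prepr q) = q.
Proof. exact: reprK. Qed.
Lemma pclassP x y : pclass x = pclass y <-> pcong x y.
Proof. by split=> [/eqmodP /asboolP|xy]; last by apply/eqmodP/asboolP. Qed.
Lemma prepr_class x : pcong (prepr (pclass x)) x.
Proof. by apply/pclassP; rewrite preprK. Qed.

Definition padd (p q : presented) := pclass (TAdd (prepr p) (prepr q)).
Definition pmul (p q : presented) := pclass (TMul (prepr p) (prepr q)).
Definition pscale (a : K) (p : presented) := pclass (TScale a (prepr p)).

Lemma paddE x y : padd (pclass x) (pclass y) = pclass (TAdd x y).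
Proof. by apply/pclassP/pc_add; apply: prepr_class. Qed.
Lemma pmulE x y : pmul (pclass x) (pclass y) = pclass (TMul x y).
Proof. by apply/pclassP/pc_mul; apply: prepr_class. Qed.
Lemma pscaleE a x : pscale a (pclass x) = pclass (TScale a x).
Proof. by apply/pclassP/pc_scale; apply: prepr_class. Qed.

Lemma pelim (P : presented -> Prop) : (forall x, P (pclass x)) -> forall q, P q.
Proof. by move=> H q; rewrite -(preprK q). Qed.

Local Ltac pq := repeat (elim/pelim; let x := fresh "x" in intro x);
  rewrite ?(paddE, pmulE, pscaleE); apply/pclassP.

Lemma paddA : associative padd. Proof. pq; exact: pc_addA. Qed.
Lemma paddC : commutative padd. Proof. pq; exact: pc_addC. Qed.
Lemma padd0 : left_id (pclass TZero) padd. Proof. pq; exact: pc_add0. Qed.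
Lemma paddN : left_inverse (pclass TZero) (pscale (- 1)) padd.
Proof. pq; exact: pc_addN. Qed.
HB.instance Definition _ :=
  GRing.isZmodule.Build presented paddA paddC padd0 paddN.

Lemma pmulA : associative pmul. Proof. pq; exact: pc_mulA. Qed.
Lemma p1mul : left_id (pclass TOne) pmul. Proof. pq; exact: pc_1mul. Qed.
Lemma pmul1 : right_id (pclass TOne) pmul. Proof. pq; exact: pc_mul1. Qed.
Lemma pmulDl : left_distributive pmul padd. Proof. pq; exact: pc_mulDl. Qed.
Lemma pmulDr : right_distributive pmul padd. Proof. pq; exact: pc_mulDr. Qed.
HB.instance Definition _ :=
  GRing.Zmodule_isPzRing.Build presented pmulA p1mul pmul1 pmulDl pmulDr.

Lemma pscaleA a b q : pscale a (pscale b q) = pscale (a * b) q.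
Proof. elim/pelim: q => x; rewrite !pscaleE; apply/pclassP; exact: pc_scaleA. Qed.
Lemma pscale1 : left_id 1 pscale. Proof. pq; exact: pc_scale1. Qed.
Lemma pscaleDr : right_distributive pscale padd.
Proof. move=> a; pq; exact: pc_scaleDr. Qed.
Lemma pscaleDl q : {morph pscale^~ q : a b / a + b >-> padd a b}.
Proof.
move=> a b; elim/pelim: q => x; rewrite !pscaleE paddE; apply/pclassP.
exact: pc_scaleDl.
Qed.
HB.instance Definition _ := GRing.Zmodule_isLmodule.Build K presented
  pscaleA pscale1 pscaleDr pscaleDl.

(* presented is not declared as an algType, since that would require 1 != 0 *)
Lemma presented_scaleAl a (p q : presented) : a *: (p * q) = (a *: p) * q.
Proof.
change (pscale a (pmul p q) = pmul (pscale a p) q).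
move: p q; pq; exact: pc_scaleAl.
Qed.
Lemma presented_scaleAr a (p q : presented) : a *: (p * q) = p * (a *: q).
Proof.
change (pscale a (pmul p q) = pmul p (pscale a q)).
move: p q; pq; exact: pc_scaleAr.
Qed.

Lemma pclassD x y : pclass (TAdd x y) = pclass x + pclass y.
Proof. by rewrite -paddE. Qed.
Lemma pclassM x y : pclass (TMul x y) = pclass x * pclass y.
Proof. by rewrite -pmulE. Qed.
Lemma pclassZ a x : pclass (TScale a x) = a *: pclass x.
Proof. by rewrite -pscaleE. Qed.

End Presentation.

Arguments TZero {K G}.
Arguments TOne {K G}.
Arguments TGen {K G} _.

Section DirectSum.
Variables (R : pzRingType) (I : choiceType) (V : I -> lmodType R).

Record dsum := DSum {
  dcomp :> forall i, V i;
  dcomp_fin : exists s : seq I, forall i, i \notin s -> dcomp i = 0 }.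

Lemma dsum_eqP (x y : dsum) : (forall i, x i = y i) -> x = y.
Proof.
case: x y => [x xf] [y yf] /= xy.
have exy : x = y by apply: functional_extensionality_dep.
by subst y; congr DSum; apply: Prop_irrelevance.
Qed.

HB.instance Definition _ := gen_eqMixin dsum.
HB.instance Definition _ := gen_choiceMixin dsum.

Lemma dzero_fin : exists s : seq I, forall i, i \notin s -> (0 : V i) = 0.
Proof. by exists [::]. Qed.
Lemma dadd_fin (x y : dsum) :
  exists s : seq I, forall i, i \notin s -> x i + y i = 0.
Proof.
case: (dcomp_fin x) (dcomp_fin y) => [s xs] [s' ys]; exists (s ++ s') => i.
by rewrite mem_cat negb_or => /andP[/xs -> /ys ->]; rewrite addr0.
Qed.
Lemma dopp_fin (x : dsum) : exists s : seq I, forall i, i \notin s -> - x i = 0.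
Proof.
by case: (dcomp_fin x) => s xs; exists s => i /xs ->; rewrite oppr0.
Qed.
Lemma dscale_fin (a : R) (x : dsum) :
  exists s : seq I, forall i, i \notin s -> a *: x i = 0.
Proof.
by case: (dcomp_fin x) => s xs; exists s => i /xs ->; rewrite scaler0.
Qed.

Definition dzero := DSum dzero_fin.
Definition dadd x y := DSum (dadd_fin x y).
Definition dopp x := DSum (dopp_fin x).
Definition dscale a x := DSum (dscale_fin a x).

Lemma daddA : associative dadd.
Proof. by move=> x y z; apply: dsum_eqP => i /=; rewrite addrA. Qed.
Lemma daddC : commutative dadd.
Proof. by move=> x y; apply: dsum_eqP => i /=; rewrite addrC. Qed.
Lemma dadd0 : left_id dzero dadd.
Proof. by move=> x; apply: dsum_eqP => i /=; rewrite add0r. Qed.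
Lemma daddN : left_inverse dzero dopp dadd.
Proof. by move=> x; apply: dsum_eqP => i /=; rewrite addNr. Qed.
HB.instance Definition _ := GRing.isZmodule.Build dsum daddA daddC dadd0 daddN.

Lemma dscaleA a b x : dscale a (dscale b x) = dscale (a * b) x.
Proof. by apply: dsum_eqP => i /=; rewrite scalerA. Qed.
Lemma dscale1 : left_id 1 dscale.
Proof. by move=> x; apply: dsum_eqP => i /=; rewrite scale1r. Qed.
Lemma dscaleDr : right_distributive dscale +%R.
Proof. by move=> a x y; apply: dsum_eqP => i /=; rewrite scalerDr. Qed.
Lemma dscaleDl x : {morph dscale^~ x : a b / a + b}.
Proof. by move=> a b; apply: dsum_eqP => i /=; rewrite scalerDl. Qed.
HB.instance Definition _ := GRing.Zmodule_isLmodule.Build R dsum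
  dscaleA dscale1 dscaleDr dscaleDl.

Definition dinj_comp i (v : V i) k : V k :=
  if i =P k is ReflectT e then ecast k (V k) e v else 0.

Lemma dinj_fin i (v : V i) :
  exists s : seq I, forall k, k \notin s -> dinj_comp v k = 0.
Proof.
exists [:: i] => k; rewrite inE eq_sym /dinj_comp.
by case: eqP => // e; case: k / e => /eqP.
Qed.

Definition dinj i (v : V i) : dsum := DSum (dinj_fin v).

Lemma dinj_id i (v : V i) : dinj v i = v.
Proof. by rewrite /= /dinj_comp; case: eqP => // e; rewrite eq_axiomK. Qed.

Lemma dinj_neq i k (v : V i) : i != k -> dinj v k = 0.
Proof. by rewrite /= /dinj_comp; case: eqP. Qed.

End DirectSum.

(* The residue class of i indexes K_i, so that K_i = K_{i+n} is built in.     *)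
Inductive gen (n : nat) :=
  | Up of Theta n | Um of Theta n | Kp of 'I_n | Km of 'I_n.
Arguments Up {n} _.
Arguments Um {n} _.
Arguments Kp {n} _.
Arguments Km {n} _.

Section DoubleHallAlgebra.
Variables (n : nat) (phi : Theta n -> Theta n -> Theta n -> {poly int}).

Notation gterm := (term Qv (gen n)).
Implicit Types (A B C : Theta n) (lam mu : Nn n) (j nu : Zn n).

Definition tup A : gterm := TGen (Up A).
Definition tum A : gterm := TGen (Um A).
Definition tkpow (i : 'I_n) (z : int) : gterm :=
  match z with
  | Posz k => iter k (TMul (TGen (Kp i))) TOne
  | Negz k => iter k.+1 (TMul (TGen (Km i))) TOne
  end.
Definition tK j : gterm := \big[@TMul _ _/TOne]_i tkpow i (j i).
(* prod_i (K_i K_{i+1}^-1)^nu_i is K^(sum_i nu_i alpha_i) *)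
Definition tKt nu : gterm := tK (rootv nu).

Definition hall_at_v2 A B C : Qv := (map_poly intr (phi A B C)).[vv ^+ 2].

Definition kappa lam (a b : Nn n) : Qv :=
  vv ^ (2 * \sum_i (zv lam i - zv a i) * (1 - zv a i - zv b i))
  * \prod_i \prod_(0 <= s < (lam i - a i)%N)
      (vv ^+ (2 * (lam i - a i)) - vv ^+ (2 * s))^-1.

(* the vectors a in N^n with a <= lam *)
Notation below lam := {dffun forall i : 'I_n, 'I_(lam i).+1}.
Definition below_vec lam (a : below lam) : Nn n := [ffun i => nat_of_ord (a i)].
(* the pairs (a, b) in N^n x N^n with lam - a = mu - b >= 0 *)
Definition same_gap lam mu (ab : below lam * below mu) : bool :=
  [forall i, (lam i - ab.1 i)%N == (mu i - ab.2 i)%N].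

Definition comm_lhs lam mu : gterm :=
  TScale (vv ^ eul (zv mu) (zv mu))
    (\big[@TAdd _ _/TZero]_(ab : below lam * below mu | same_gap ab)
      let a := below_vec ab.1 in let b := below_vec ab.2 in
      TScale (kappa lam a b * vv ^ eul (zv b) (zv lam + zv mu - zv b))
        (TMul (tKt (zv mu - zv b)) (TMul (tum (Adiag b)) (tup (Adiag a))))).

Definition comm_rhs lam mu : gterm :=
  TScale (vv ^ eul (zv mu) (zv lam))
    (\big[@TAdd _ _/TZero]_(ab : below lam * below mu | same_gap ab)
      let a := below_vec ab.1 in let b := below_vec ab.2 in
      TScale (kappa lam a b
                * vv ^ (eul (zv mu - zv b) (zv a) + eul (zv mu) (zv b)))
        (TMul (tKt (zv b - zv mu)) (TMul (tup (Adiag a)) (tum (Adiag b))))).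

(* In drel_up and drel_um the sum is over all C with nonzero Hall polynomial, *)
(* listed by s.                                                               *)
Inductive drel : gterm -> gterm -> Prop :=
  | drel_KC i k : drel (TMul (TGen (Kp i)) (TGen (Kp k)))
                       (TMul (TGen (Kp k)) (TGen (Kp i)))
  | drel_KV i : drel (TMul (TGen (Kp i)) (TGen (Km i))) TOne
  | drel_VK i : drel (TMul (TGen (Km i)) (TGen (Kp i))) TOne
  | drel_up0 : drel (tup (Theta0 n)) TOne
  | drel_um0 : drel (tum (Theta0 n)) TOne
  | drel_Kup A j : drel (TMul (tK j) (tup A))
                        (TScale (vv ^ eul (dimvec A) j) (TMul (tup A) (tK j)))
  | drel_umK A j : drel (TMul (tum A) (tK j))
                        (TScale (vv ^ eul (dimvec A) j) (TMul (tK j) (tum A)))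
  | drel_up A B (s : seq (Theta n)) :
      uniq s -> (forall C, (C \in s) = (phi A B C != 0)) ->
      drel (TMul (tup A) (tup B))
           (\big[@TAdd _ _/TZero]_(C <- s)
              TScale (vv ^ eul (dimvec A) (dimvec B) * hall_at_v2 A B C) (tup C))
  | drel_um A B (s : seq (Theta n)) :
      uniq s -> (forall C, (C \in s) = (phi B A C != 0)) ->
      drel (TMul (tum A) (tum B))
           (\big[@TAdd _ _/TZero]_(C <- s)
              TScale (vv ^ eul (dimvec B) (dimvec A) * hall_at_v2 B A C) (tum C))
  | drel_comm lam mu : drel (comm_lhs lam mu) (comm_rhs lam mu).

Definition DD := presented drel.
HB.instance Definition _ := GRing.PzRing.on DD.
HB.instance Definition _ := GRing.Lmodule.on DD.
Definition dclass (x : gterm) : DD := pclass drel x.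

Definition up A : DD := dclass (tup A).
Definition um A : DD := dclass (tum A).
Definition kk j : DD := dclass (tK j).

Definition norm_exp A : int := (dim_end A)%:Z - (dimM A)%:Z.
Definition upt A : DD := vv ^ norm_exp A *: up A.
Definition umt A : DD := vv ^ norm_exp A *: um A.

Definition degv A : Zn n := rootv (dimvec A).

(* homog nu is the homogeneous component D_nu: the span of the products of    *)
(* generators of total degree nu                                              *)
Inductive homog : Zn n -> DD -> Prop :=
  | homog_up A : homog (degv A) (up A)
  | homog_um A : homog (- degv A) (um A)
  | homog_Kp i : homog 0 (dclass (TGen (Kp i)))
  | homog_Km i : homog 0 (dclass (TGen (Km i)))
  | homog_1 : homog 0 1
  | homog_M nu nu' t t' : homog nu t -> homog nu' t' -> homog (nu + nu') (t * t')
  | homog_0 nu : homog nu 0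
  | homog_D nu t t' : homog nu t -> homog nu t' -> homog nu (t + t')
  | homog_Z nu c t : homog nu t -> homog nu (c *: t).

(* The spaces _lam D _mu: the quotients of D by                               *)
(*   sum_j (K^j - v^(lam.j)) D + sum_j D (K^j - v^(mu.j))                     *)

Definition kshift (l j : Zn n) : DD := kk j - vv ^ dot l j *: (1 : DD).

Definition in_wideal (l m : Zn n) (x : DD) : Prop :=
  exists s s' : seq (Zn n * DD),
    x = \sum_(p <- s) kshift l p.1 * p.2 + \sum_(p <- s') p.2 * kshift m p.1.

Definition wideal (l m : Zn n) : {pred DD} := fun x => `[< in_wideal l m x >].

Lemma widealP l m x : reflect (in_wideal l m x) (x \in wideal l m).
Proof. exact: asboolP. Qed.

Lemma wideal_closed l m : zmod_closed (wideal l m).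
Proof.
split=> [|x y /widealP[s1 [s1' ->]] /widealP[s2 [s2' ->]]]; apply/widealP.
  by exists [::], [::]; rewrite !big_nil addr0.
exists (s1 ++ [seq (p.1, - p.2) | p <- s2]), (s1' ++ [seq (p.1, - p.2) | p <- s2']).
rewrite !big_cat !big_map /= opprD addrACA -!sumrN.
by congr (_ + _ + (_ + _)); apply: eq_bigr => p _; rewrite (mulrN, mulNr).
Qed.
HB.instance Definition _ l m := GRing.isZmodClosed.Build DD (wideal l m)
  (wideal_closed l m).

Lemma widealD l m x y : x \in wideal l m -> y \in wideal l m -> x + y \in wideal l m.
Proof. by move=> xI yI; rewrite rpredD. Qed.

Lemma wideal_l l m j y : kshift l j * y \in wideal l m.
Proof.
by apply/widealP; exists [:: (j, y)], [::]; rewrite big_seq1 big_nil addr0.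
Qed.

Lemma wideal_r l m j y : y * kshift m j \in wideal l m.
Proof.
by apply/widealP; exists [::], [:: (j, y)]; rewrite big_seq1 big_nil add0r.
Qed.

Lemma widealZ l m c x : x \in wideal l m -> c *: x \in wideal l m.
Proof.
move=> /widealP[s [s' ->]]; rewrite scalerDr !scaler_sumr; apply: rpredD;
  apply: rpred_sum => p _.
  by rewrite presented_scaleAr wideal_l.
by rewrite presented_scaleAl wideal_r.
Qed.

Definition wD (l m : Zn n) := (Quotient.quot (wideal l m)).
HB.instance Definition _ l m := GRing.Zmodule.on (wD l m).

Definition wpi (l m : Zn n) (t : DD) : wD l m := \pi_(Quotient.quot (wideal l m)) t.
Definition wrepr (l m : Zn n) (x : wD l m) : DD := repr (x : (Quotient.quot (wideal l m))).

Lemma wreprK l m (x : wD l m) : wpi l m (wrepr x) = x.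
Proof. exact: reprK. Qed.

Lemma wpiP l m t t' : (wpi l m t = wpi l m t') <-> (t - t' \in wideal l m).
Proof.
split; first by move=> /eqP; rewrite /wpi -Quotient.idealrBE.
by move=> H; apply/eqP; rewrite /wpi -Quotient.idealrBE.
Qed.

Lemma wpiD l m : {morph wpi l m : t t' / t + t'}.
Proof. by move=> t t'; rewrite /wpi raddfD. Qed.
Lemma wpi0 l m : wpi l m 0 = 0.
Proof. by rewrite /wpi raddf0. Qed.

Definition wscale l m (c : Qv) (x : wD l m) : wD l m := wpi l m (c *: wrepr x).

Lemma wscaleE l m c t : wscale c (wpi l m t) = wpi l m (c *: t).
Proof.
by apply/wpiP; rewrite -scalerBr; apply/widealZ/wpiP; rewrite wreprK.
Qed.

Lemma wpi_elim l m (P : wD l m -> Prop) : (forall t, P (wpi l m t)) -> forall x, P x.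
Proof. by move=> H x; rewrite -(wreprK x). Qed.

Lemma wscaleA l m a b (x : wD l m) : wscale a (wscale b x) = wscale (a * b) x.
Proof. by elim/wpi_elim: x => t; rewrite !wscaleE scalerA. Qed.
Lemma wscale1 l m : left_id 1 (@wscale l m).
Proof. by elim/wpi_elim => t; rewrite wscaleE scale1r. Qed.
Lemma wscaleDr l m : right_distributive (@wscale l m) +%R.
Proof.
move=> a; elim/wpi_elim => t; elim/wpi_elim => u.
by rewrite -wpiD !wscaleE scalerDr wpiD.
Qed.
Lemma wscaleDl l m x : {morph (@wscale l m)^~ x : a b / a + b}.
Proof. by move=> a b; elim/wpi_elim: x => t; rewrite !wscaleE scalerDl wpiD. Qed.
HB.instance Definition _ l m := GRing.Zmodule_isLmodule.Build Qv (wD l m)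
  (@wscaleA l m) (@wscale1 l m) (@wscaleDr l m) (@wscaleDl l m).

Lemma wpiZ l m c t : wpi l m (c *: t) = c *: wpi l m t.
Proof. by rewrite -wscaleE. Qed.

Lemma drelP x y : drel x y -> dclass x = dclass y.
Proof. by move=> xy; apply/pclassP/pc_rel. Qed.

Lemma dclass_M x y : dclass (TMul x y) = dclass x * dclass y.
Proof. exact: pclassM. Qed.

Lemma dclass_Z a x : dclass (TScale a x) = a *: dclass x.
Proof. exact: pclassZ. Qed.

Lemma commK_gens i k : GRing.comm (dclass (TGen (Kp i))) (dclass (TGen (Kp k))).
Proof. by rewrite /GRing.comm -!dclass_M; apply/drelP/drel_KC. Qed.

Lemma comm_inv (x y z : DD) : x * y = 1 -> y * x = 1 -> GRing.comm z x ->
  GRing.comm z y.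
Proof.
move=> xy yx zx; rewrite /GRing.comm.
by rewrite -[LHS]mul1r -yx -!mulrA [x * (z * y)]mulrA -zx -mulrA xy mulr1.
Qed.

Lemma KpKm i : dclass (TGen (Kp i)) * dclass (TGen (Km i)) = 1.
Proof. by rewrite -dclass_M; apply/drelP/drel_KV. Qed.
Lemma KmKp i : dclass (TGen (Km i)) * dclass (TGen (Kp i)) = 1.
Proof. by rewrite -dclass_M; apply/drelP/drel_VK. Qed.

Lemma comm_kk z j : (forall i, GRing.comm z (dclass (TGen (Kp i)))) ->
  GRing.comm z (kk j).
Proof.
move=> zK; rewrite /kk /tK.
have -> : dclass (\big[@TMul _ _/TOne]_i tkpow i (j i))
          = \prod_i dclass (tkpow i (j i)).
  by apply: (big_morph dclass) => // x y; rewrite dclass_M.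
apply: big_ind => [|x y zx zy|i _]; [exact: commr1|exact: commrM|].
case: (j i) => k /=.
  elim: k => [|k IH] /=; first exact: commr1.
  by rewrite dclass_M; apply: commrM.
rewrite dclass_M.
have zm : GRing.comm z (dclass (TGen (Km i))).
  exact: comm_inv (KpKm i) (KmKp i) (zK i).
apply: commrM => //; elim: k => [|k IH] /=; first exact: commr1.
by rewrite dclass_M; apply: commrM.
Qed.

Lemma vvD a b : vv ^ (a + b) = vv ^ a * vv ^ b.
Proof. by apply: expfzDr; rewrite -unitfE vv_unit. Qed.

Lemma kk_homog nu t j : homog nu t -> kk j * t = vv ^ dot nu j *: (t * kk j).
Proof.
have scale_comm z : GRing.comm z (kk j) -> kk j * z = vv ^ dot 0 j *: (z * kk j).
  by rewrite dot0l expr0z scale1r => ->.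
elim=> {nu t}.
- move=> A; rewrite /degv dot_rootv -!dclass_M -dclass_Z.
  exact/drelP/drel_Kup.
- move=> A; rewrite /degv dotNl dot_rootv.
  have -> : um A * kk j = vv ^ eul (dimvec A) j *: (kk j * um A).
    by rewrite -!dclass_M -dclass_Z; apply/drelP/drel_umK.
  by rewrite scalerA -vvD addNr expr0z scale1r.
- by move=> i; apply/scale_comm/comm_kk => k; apply: commK_gens.
- move=> i; apply/scale_comm/comm_kk => k; apply: commr_sym.
  exact: comm_inv (KpKm i) (KmKp i) (commK_gens k i).
- by apply/scale_comm/commr_sym/commr1.
- move=> nu nu' t t' _ IH _ IH'; rewrite mulrA IH -presented_scaleAl.
  rewrite -[t * kk j * t']mulrA IH' -presented_scaleAr scalerA mulrA dotDl.
  by rewrite vvD.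
- by move=> nu; rewrite mulr0 mul0r scaler0.
- by move=> nu t t' _ IH _ IH'; rewrite mulrDr mulrDl scalerDr IH IH'.
- move=> nu c t _ IH.
  by rewrite -presented_scaleAr IH -presented_scaleAl !scalerA mulrC.
Qed.

Lemma kshift_homog l m nu j t : homog nu t -> l = nu + m ->
  kshift l j * t = vv ^ dot nu j *: (t * kshift m j).
Proof.
move=> ht ->; rewrite /kshift mulrBl mulrBr scalerBr (kk_homog _ ht).
by rewrite -presented_scaleAl mul1r -presented_scaleAr mulr1 scalerA -vvD -dotDl.
Qed.

Lemma wideal_mulr l m k x s :
  x \in wideal l m -> homog (m - k) s -> x * s \in wideal l k.
Proof.
move=> /widealP[s1 [s2 ->]] hs; rewrite mulrDl !mulr_suml.
apply: rpredD; apply: rpred_sum => p _; first by rewrite -mulrA wideal_l.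
rewrite -mulrA (kshift_homog _ hs (esym (subrK _ _))) -presented_scaleAr mulrA.
exact/widealZ/wideal_r.
Qed.

Lemma wideal_mull l m k x t :
  homog (l - m) t -> x \in wideal m k -> t * x \in wideal l k.
Proof.
move=> ht /widealP[s1 [s2 ->]]; rewrite mulrDr !mulr_sumr.
apply: rpredD; apply: rpred_sum => p _; last by rewrite mulrA wideal_r.
have -> : t * (kshift m p.1 * p.2)
          = vv ^ (- dot (l - m) p.1) *: (kshift l p.1 * (t * p.2)).
  rewrite !mulrA (kshift_homog _ ht (esym (subrK _ _))) -presented_scaleAl.
  by rewrite scalerA -vvD addNr expr0z scale1r.
exact/widealZ/wideal_l.
Qed.

Lemma vv_exp_inj a b : vv ^ a = vv ^ b -> a = b.
Proof.
have vvX (k : nat) : vv ^ k%:Z = 1 -> k = 0%N.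
  rewrite -exprnP -tofracXn -tofrac1 => /eqP; rewrite tofrac_eq => /eqP e.
  by have := congr1 (fun p : {poly rat} => size p) e; rewrite size_polyXn size_poly1 => -[].
move=> e; have {e} : vv ^ (a - b) = 1.
  by rewrite vvD e -vvD subrr expr0z.
case E : (a - b) => [k|k].
  by move/vvX => k0; apply/eqP; rewrite -subr_eq0 E k0.
by rewrite NegzE -invr_expz => /(congr1 GRing.inv); rewrite invrK invr1 => /vvX.
Qed.

Lemma wpi_homog0 l m nu t : homog nu t -> nu != l - m -> wpi l m t = 0.
Proof.
move=> ht nu_neq; have [i nui] : exists i, nu i != (l - m) i.
  apply/existsP; apply: contra_neqT nu_neq => /existsPn H.
  by apply/ffunP => i; apply/eqP; have := H i; rewrite negbK.
pose j : Zn n := evec i.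
have dotj k : dot k j = k i.
  rewrite /dot (bigD1 i) //= ffunE eqxx mulr1 big1 ?addr0 // => r /negbTE ri.
  by rewrite ffunE ri mulr0.
have Kt : wpi l m (kshift l j * t) = 0.
  by rewrite -(wpi0 l m); apply/wpiP; rewrite subr0 wideal_l.
have tK0 : wpi l m (t * kshift m j) = 0.
  by rewrite -(wpi0 l m); apply/wpiP; rewrite subr0 wideal_r.
have {Kt} : wpi l m (kshift (nu + m) j * t - kshift l j * t) = 0.
  rewrite wpiD (kshift_homog _ ht erefl) wpiZ tK0 scaler0 add0r.
  by rewrite -scaleN1r wpiZ Kt scaler0.
rewrite -mulrBl /kshift opprB addrC addrA subrK -scalerBl -presented_scaleAl.
rewrite mul1r wpiZ => /eqP; rewrite scaler_eq0 subr_eq0 => /orP[/eqP|/eqP //].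
move/vv_exp_inj; rewrite !dotj ffunE => e.
by case/eqP: nui; rewrite !ffunE e addrK.
Qed.

Lemma homog_span (t : DD) : exists s : seq (Zn n * DD),
  (forall p, p \in s -> homog p.1 p.2) /\ t = \sum_(p <- s) p.2.
Proof.
elim/pelim: t; elim => [||[A|A|i|i]|x [s [hs xs]] y [s' [hs' ys]]
    |x [s [hs xs]] y [s' [hs' ys]]|c x [s [hs xs]]].
- by exists [::]; rewrite big_nil.
- exists [:: (0, 1)]; rewrite big_seq1; split=> // p; rewrite inE => /eqP ->.
  exact: homog_1.
- exists [:: (degv A, up A)]; rewrite big_seq1; split=> // p.
  by rewrite inE => /eqP ->; apply: homog_up.
- exists [:: (- degv A, um A)]; rewrite big_seq1; split=> // p.
  by rewrite inE => /eqP ->; apply: homog_um.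
- exists [:: (0, dclass (TGen (Kp i)))]; rewrite big_seq1; split=> // p.
  by rewrite inE => /eqP ->; apply: homog_Kp.
- exists [:: (0, dclass (TGen (Km i)))]; rewrite big_seq1; split=> // p.
  by rewrite inE => /eqP ->; apply: homog_Km.
- exists (s ++ s'); rewrite pclassD xs ys big_cat; split=> // p.
  by rewrite mem_cat => /orP[/hs|/hs'].
- exists [seq (a.1 + b.1, a.2 * b.2) | a <- s, b <- s']; split=> [p|].
    by move=> /allpairsP[[a b] [/hs ha /hs' hb ->]]; apply: homog_M.
  rewrite pclassM xs ys big_allpairs_dep mulr_suml; apply: eq_bigr => a _.
  by rewrite mulr_sumr.
- exists [seq (a.1, c *: a.2) | a <- s]; rewrite pclassZ xs scaler_sumr big_map.
  by split=> // p /mapP[a /hs ha ->]; apply: homog_Z.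
Qed.

Lemma wD_homog l m (x : wD l m) : exists2 t, homog (l - m) t & wpi l m t = x.
Proof.
elim/wpi_elim: x => t; have [s [hs ->]] := homog_span t.
elim: s hs => [|p s IH] hs; first by exists 0; [exact: homog_0|rewrite big_nil].
have {IH}[q sq|u hu us] := IH; first by apply: hs; rewrite inE sq orbT.
have hp : homog p.1 p.2 by apply: hs; rewrite mem_head.
rewrite big_cons wpiD -us; have [e|ne] := eqVneq p.1 (l - m).
  by exists (p.2 + u); [apply: homog_D => //; rewrite -e|rewrite wpiD].
by exists u => //; rewrite (wpi_homog0 hp ne) add0r.
Qed.

(* a representative of x in D_{l-m}, which exists by wD_homog *)
Definition hrep l m (x : wD l m) : DD :=
  xget 0 [set t | homog (l - m) t /\ wpi l m t = x]%classic.

Lemma homog_hrep l m (x : wD l m) : homog (l - m) (hrep x).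
Proof. by rewrite /hrep; case: xgetP => [t _ []|_] //; exact: homog_0. Qed.

Lemma hrepK l m t : homog (l - m) t -> wpi l m (hrep (wpi l m t)) = wpi l m t.
Proof. by move=> ht; rewrite /hrep; case: xgetP => [u _ []|/(_ t)[]]. Qed.

Lemma wpi_hrep l m (x : wD l m) : wpi l m (hrep x) = x.
Proof. by have [t ht <-] := wD_homog x; rewrite hrepK. Qed.

Definition wmul l m k (x : wD l m) (y : wD m k) : wD l k :=
  wpi l k (hrep x * hrep y).

Lemma wmulE l m k t s : homog (l - m) t -> homog (m - k) s ->
  wmul (wpi l m t) (wpi m k s) = wpi l k (t * s).
Proof.
move=> ht hs; apply/wpiP.
have -> (a b : DD) : a * b - t * s = (a - t) * b + t * (b - s).
  by rewrite mulrBl mulrBr addrA subrK.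
apply: widealD.
  by apply: wideal_mulr (homog_hrep _); apply/wpiP/hrepK.
by apply: wideal_mull ht _; apply/wpiP/hrepK.
Qed.

Lemma wmul0l l m k (y : wD m k) : wmul (0 : wD l m) y = 0.
Proof.
rewrite -(wpi0 l m) -(wpi0 l k); apply/wpiP; rewrite subr0.
apply: wideal_mulr (homog_hrep _); rewrite -[hrep _]subr0.
exact/wpiP/hrepK/homog_0.
Qed.

Lemma wmul0r l m k (x : wD l m) : wmul x (0 : wD m k) = 0.
Proof.
rewrite -(wpi0 m k) -(wpi0 l k); apply/wpiP; rewrite subr0.
apply: wideal_mull (homog_hrep _) _; rewrite -[hrep _]subr0.
exact/wpiP/hrepK/homog_0.
Qed.

Definition Ddot :=
  dsum (fun p : Zn n * Zn n => (wD p.1 p.2 : lmodType Qv)).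
HB.instance Definition _ := GRing.Lmodule.on Ddot.

Definition dpi (l m : Zn n) (t : DD) : Ddot :=
  @dinj _ _ (fun p : Zn n * Zn n => (wD p.1 p.2 : lmodType Qv)) (l, m) (wpi l m t).

Definition ddmul_comp (x y : Ddot) (p : Zn n * Zn n) : wD p.1 p.2 :=
  \sum_(m \in [set: Zn n]%classic) (wmul (x (p.1, m)) (y (m, p.2)) : wD p.1 p.2).

Lemma ddmul_fin (x y : Ddot) : exists s : seq (Zn n * Zn n),
  forall p, p \notin s -> ddmul_comp x y p = 0.
Proof.
case: (dcomp_fin x) (dcomp_fin y) => [s xs] [s' ys].
exists [seq (a.1, b.2) | a <- s, b <- s'] => -[l k] H.
rewrite /ddmul_comp fsbig1 // => m _ /=.
have [xm|/xs ->] := boolP ((l, m) \in s); last exact: wmul0l.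
have [ym|/ys ->] := boolP ((m, k) \in s'); last exact: wmul0r.
by case/negP: H; apply/allpairsP; exists ((l, m), (m, k)).
Qed.

Definition ddmul (x y : Ddot) : Ddot := DSum (ddmul_fin x y).

Lemma ddmulP x y l k : ddmul x y (l, k) =
  \sum_(m \in [set: Zn n]%classic) (wmul (x (l, m)) (y (m, k)) : wD l k).
Proof. by []. Qed.

Lemma dpi_id l m t : dpi l m t (l, m) = wpi l m t.
Proof. exact: (@dinj_id _ _ (fun p => wD p.1 p.2 : lmodType Qv) (l, m)). Qed.

Lemma dpi_neq l m l' m' t : (l, m) != (l', m') -> dpi l m t (l', m') = 0.
Proof. by move=> /dinj_neq H; apply: H. Qed.

Lemma ddmulE l m m' k t s : homog (l - m) t -> homog (m' - k) s ->
  ddmul (dpi l m t) (dpi m' k s) = if m == m' then dpi l k (t * s) else 0.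
Proof.
move=> ht hs; apply: dsum_eqP => -[l' k']; rewrite ddmulP.
have [/andP[/eqP el /eqP ek]|ne] := boolP ((l == l') && (k == k')); last first.
  rewrite fsbig1.
    by case: ifP => // _; rewrite dpi_neq // xpair_eqE.
  move=> r _; have [el|nl] := eqVneq l l'; last first.
    by rewrite dpi_neq ?wmul0l // xpair_eqE (negbTE nl).
  rewrite [X in wmul _ X]dpi_neq ?wmul0r //.
  by move: ne; rewrite el eqxx /= xpair_eqE => /negbTE ->; rewrite andbF.
subst l' k'; have dpi_set : ([set m] `<=` [set: Zn n])%classic by [].
rewrite -(@fsbig_widen _ _ _ _ [set m]%classic _ _ dpi_set) => [|r [_ rm]]; last first.
  suff : wmul (dpi l m t (l, r)) (dpi m' k s (r, k)) = 0 by [].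
  rewrite dpi_neq ?wmul0l // xpair_eqE eqxx; apply/eqP => mr.
  by apply: rm; rewrite mr.
rewrite fsbig_set1 dpi_id; case: eqVneq => [mm'|nm].
  by subst m'; rewrite !dpi_id wmulE.
by rewrite dpi_neq ?wmul0r // xpair_eqE eq_sym (negbTE nm).
Qed.

(* t' pi_{l,m}(s) t'' for t' in D_nu' and t'' in D_nu''                       *)
Definition bimod (nu' nu'' l m : Zn n) (t' s t'' : DD) : Ddot :=
  dpi (l + nu') (m - nu'') (t' * s * t'').

(* u~_A^+ 1_l u~_B^- , where 1_l = pi_{l,l}(1) *)
Definition ustd A (l : Zn n) B : Ddot :=
  bimod (degv A) (- degv B) l l (upt A) 1 (umt B).

Definition intD (x : Ddot) : Prop :=
  exists s : seq (Qv * (Theta n * Zn n * Theta n)),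
    (forall p, p \in s -> laurent p.1)
    /\ x = \sum_(p <- s) p.1 *: ustd p.2.1.1 p.2.1.2 p.2.2.

End DoubleHallAlgebra.

Section IntegralForms.
Variables (V : lmodType Qv).
Implicit Types (L : V -> Prop).

Definition is_submodule L : Prop :=
  [/\ L 0, forall x y, L x -> L y -> L (x + y)
    & forall c x, laurent c -> L x -> L (c *: x)].

Definition is_subalgebra (mul : V -> V -> V) L : Prop :=
  is_submodule L /\ forall x y, L x -> L y -> L (mul x y).

Definition is_free L : Prop :=
  exists (I : choiceType) (b : I -> V),
    [/\ forall i, L (b i),
        forall x, L x -> exists (s : seq I) (c : I -> Qv),
          (forall i, laurent (c i)) /\ x = \sum_(i <- s) c i *: b i
      & forall (s : seq I) (c : I -> Qv), uniq s -> (forall i, laurent (c i)) ->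
          \sum_(i <- s) c i *: b i = 0 -> forall i, i \in s -> c i = 0].

(* V is the tensor product of L and Q(v) over Z[v, v^-1], by way of           *)
(* (x, c) |-> c x: this map is the universal balanced biadditive map on       *)
(* L x Q(v).                                                                  *)
Definition balanced L (W : zmodType) (beta : V -> Qv -> W) : Prop :=
  [/\ forall x y c, L x -> L y -> beta (x + y) c = beta x c + beta y c,
      forall x c d, L x -> beta x (c + d) = beta x c + beta x d
    & forall z x c, laurent z -> L x -> beta (z *: x) c = beta x (z * c)].

Definition is_scalar_extension L : Prop :=
  forall (W : zmodType) (beta : V -> Qv -> W), balanced L beta ->
    exists2 g : {additive V -> W},
      forall x c, L x -> g (c *: x) = beta x c
      & forall g' : {additive V -> W},
          (forall x c, L x -> g' (c *: x) = beta x c) -> g' =1 g.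

Definition is_integral_form (mul : V -> V -> V) L : Prop :=
  [/\ is_subalgebra mul L, is_free L & is_scalar_extension L].

End IntegralForms.

(* Main.v *)
(* Closure under multiplication: by u_top u_rad = v^* (u_A + smaller terms) the
   algebras D^+ and D^- are generated over Z[v, v^-1] by the u_A with A = A_lambda,
   so inside each _l D_m it suffices to write u^-_A u^+_B, for such A and B, as a
   Laurent combination of products u^+ u^-. There (5) becomes, after rescaling, a
   triangular system whose solution depends on the weights only. Products of
   Gaussian binomial coefficients satisfy the same system, and their values make
   the coefficients of the solution Laurent polynomials.

   Linear independence: over a field with m^2 elements, D acts with v = m on the
   functions on the set of subrepresentations of a sum of long strings, up to
   errors at subrepresentations near the ends of the strings. A vanishing
   combination of the u^+_A 1_l u^-_B is applied to the indicator function of L'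
   and evaluated at L, where L / (L :&: L') and L' / (L :&: L') are isomorphic to
   M(A0) and M(B0). If dim M(A0) is maximal, only the term of (A0, B0) contributes. *)

From HB Require Import structures.
Require Import Defs.
From mathcomp Require Import all_boot all_order all_algebra finmap.
From mathcomp Require Import fraction boolp fsbigop zify ring.
From mathcomp Require finfield.

Set Implicit Arguments.
Unset Strict Implicit.
Unset Printing Implicit Defensive.

Import Order.TTheory GRing.Theory Num.Theory.
Local Open Scope ring_scope.
Local Open Scope quotient_scope.

(** * Families of subspaces of a representation *)

(** A subquotient L / N is recorded by the ranks of its radical layers ([typ]). These ranks
    determine it up to isomorphism, so Hall numbers become counts of subspaces with prescribed ranks
    inside any representation.

    Solving the triangular system directly produces the orders of the groups GL_k as denominators,
    and no closed formula for the solution is used. The solution is the same for every module, so it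
    can be tested on scalar ones: for each b the Gaussian products form a scalar solution, supported
    above b and equal to 1 at b on the side of the unknown coefficients, which are therefore read
    off one after the other. The same products count intermediate subrepresentations, which is why
    the commutation relation holds in the model.

    The field has m^2 elements because odd powers of v occur in the relations. Evaluation at v = m
    respects sums and products in Q(v) only for large m. An equality in the presented algebra has a
    finite derivation, which uses finitely many coefficients and moves a bounded distance along the
    strings; [eqv] records a margin and a lower bound for m that suffice. A shift [mc] of the
    exponents of K realises arbitrary weights, negative ones included. *)

Section LiftingIsomorphisms.
Variables (F : fieldType) (X Y Z : nat).
Implicit Types (L P N : 'M[F]_X) (M : 'M[F]_Y) (phi : 'M[F]_(X, Z)).
Implicit Types (psi : 'M[F]_(Y, Z)) (g h : 'M[F]_(X, Y)).

Lemma row_notin m (A : 'M[F]_(m, X)) (B : 'M[F]_X) :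
  ~~ (A <= B)%MS -> exists2 x : 'rV_X, (x <= A)%MS & ~~ (x <= B)%MS.
Proof. by move=> /row_subPn[i iB]; exists (row i A); rewrite ?row_sub. Qed.

Lemma separating_functional P (x : 'rV_X) : ~~ (x <= P)%MS ->
  exists f : 'cV_X, P *m f = 0 /\ x *m f = 1%:M.
Proof.
rewrite submxE.
move=> /rV0Pn[j xj].
exists (((x *m cokermx P) 0 j)^-1 *: col j (cokermx P)); split.
  by rewrite -scalemxAr colE [P *m _]mulmxA mulmx_coker mul0mx scaler0.
have xfj : x *m col j (cokermx P) = ((x *m cokermx P) 0 j)%:M.
  rewrite colE [x *m _]mulmxA -colE; apply/matrixP => i k.
  by rewrite !ord1 !mxE eqxx mulr1n.
by rewrite -scalemxAr xfj scale_scalar_mx mulVf.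
Qed.

(* The two cases are whether x can be taken outside P + ker phi, or has to be *)
(* taken in ker phi.                                                          *)
Lemma lift_vectors L P N M phi psi g :
    (P <= L)%MS -> (P *m g <= M)%MS -> (P :&: kermx g :=: N)%MS ->
    P *m g *m psi = P *m phi -> (L *m phi :=: M *m psi)%MS ->
    \rank L = (\rank N + \rank M)%N -> ~~ (L <= P)%MS ->
  exists (x : 'rV_X) (y : 'rV_Y),
    [/\ (x <= L)%MS, ~~ (x <= P)%MS, (y <= M)%MS, ~~ (y <= P *m g)%MS
      & x *m phi = y *m psi].
Proof.
move=> PL PgM ker_g gpsi Lphi rL nLP; pose K := (L :&: kermx phi)%MS.
have [LPK|nLPK] := boolP (L <= P + K)%MS; last first.
  have [x xL xPK] := row_notin nLPK.
  have /submxP[D xD] : (x *m phi <= M *m psi)%MS by rewrite -Lphi submxMr.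
  exists x, (D *m M); split=> //.
  - by apply: contra xPK => xP; apply: submx_trans xP (addsmxSl _ _).
  - exact: submxMl.
  - apply: contra xPK => /submxP[D' yD']; pose p := D' *m P.
    have pphi : p *m phi = x *m phi.
      by rewrite xD mulmxA yD' -!mulmxA [P *m (g *m psi)]mulmxA gpsi mulmxA.
    have -> : x = p + (x - p) by rewrite addrC subrK.
    apply: addmx_sub_adds; first exact: submxMl.
    rewrite sub_capmx addmx_sub ?eqmx_opp //=; last first.
      by apply: submx_trans PL; apply: submxMl.
    by apply/sub_kermxP; rewrite mulmxBl pphi subrr.
  - by rewrite -mulmxA.
have nKP : ~~ (K <= P)%MS.
  apply: contra nLP => KP; apply: submx_trans LPK _.
  by rewrite addsmx_sub submx_refl.
pose K' := (M :&: kermx psi)%MS.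
(* The hypotheses give rank K = rank N + rank K'. If K' were inside the image of P, then rank K'
   would be at most rank (P :&: K) - rank N, which forces P :&: K = K. *)
have nK'g : ~~ (K' <= P *m g)%MS.
  apply: contra nKP => /submxP[D K'D].
  have DP : (D *m P <= P :&: K)%MS.
    rewrite !sub_capmx submxMl (submx_trans (submxMl _ _) PL) /=.
    apply/sub_kermxP; rewrite -mulmxA -gpsi !mulmxA -[D *m P *m g]mulmxA -K'D.
    by apply/sub_kermxP; apply: capmxSr.
  have rK' : (\rank K' <= \rank ((P :&: K) *m g)%MS)%N.
    by apply: mxrankS; rewrite K'D mulmxA submxMr.
  have e1 := mxrank_mul_ker (P :&: K)%MS g.
  have e2 := mxrank_mul_ker L phi; have e3 := mxrank_mul_ker M psi.
  have NK : (N <= (P :&: K) :&: kermx g)%MS.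
    have NPg : (N <= P :&: kermx g)%MS by rewrite ker_g.
    have NP : (N <= P)%MS := submx_trans NPg (capmxSl _ _).
    have Ng : (N <= kermx g)%MS := submx_trans NPg (capmxSr _ _).
    rewrite !sub_capmx NP Ng (submx_trans NP PL) /= andbT.
    have /submxP[E NE] := NP.
    apply/sub_kermxP; rewrite NE -mulmxA -gpsi !mulmxA -NE.
    by rewrite (sub_kermxP Ng) mul0mx.
  have rN := mxrankS NK; have rPK := mxrankS (capmxSr P K).
  move: e2 e3; rewrite -/K -/K' Lphi => e2 e3.
  have PKK : (P :&: K == K)%MS.
    rewrite -(geq_leqif (mxrank_leqif_eq (capmxSr P K))).
    by rewrite -(leq_add2l (\rank (M *m psi)%MS)) e2 rL; lia.
  by rewrite -(eqmxP PKK) capmxSl.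
have [x xK xP] := row_notin nKP.
move: nK'g => /row_subPn[i iK'].
exists x, (row i K'); split=> //.
- by apply: submx_trans xK (capmxSl _ _).
- by apply: submx_trans (row_sub _ _) (capmxSl _ _).
- have /sub_kermxP-> := submx_trans xK (capmxSr _ _).
  by have /sub_kermxP-> := submx_trans (row_sub i _) (capmxSr M (kermx psi)).
Qed.

(** The map [g] on P is extended by one vector at a time, [x] being sent to a [y] supplied by
    [lift_vectors]; a functional vanishing on P keeps the old values. This is the one-vertex step of
    [layers_sqiso]: there phi is the arrow of V followed by the map already built at the next
    vertex, and psi is the arrow of W. *)
Lemma lift_iso L P N M phi psi g :
    (P <= L)%MS -> (P *m g <= M)%MS -> (P :&: kermx g :=: N)%MS ->
    P *m g *m psi = P *m phi -> (L *m phi :=: M *m psi)%MS ->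
    \rank L = (\rank N + \rank M)%N ->
  exists h, [/\ P *m h = P *m g, L *m h *m psi = L *m phi, (L *m h :=: M)%MS
              & (L :&: kermx h :=: N)%MS].
Proof.
have [k] := ubnP (\rank L - \rank P).
elim: k P g => // k IH P g lek PL PgM ker_g gpsi Lphi rL.
have [LP|nLP] := boolP (L <= P)%MS.
  have /submxP[D LD] := LP; have eLP : (L :=: P)%MS by apply/eqmxP; rewrite LP.
  have kL : (L :&: kermx g :=: N)%MS.
    by apply: eqmx_trans ker_g; apply: cap_eqmx.
  exists g; split=> //; first by rewrite LD -!mulmxA [P *m (g *m _)]mulmxA gpsi.
  have LgM : (L *m g <= M)%MS by apply: submx_trans PgM; rewrite submxMr.
  apply/eqmxP; rewrite -(geq_leqif (mxrank_leqif_eq LgM)).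
  by have := mxrank_mul_ker L g; rewrite kL; lia.
have [x [y [xL xP yM yg xy]]] :=
  lift_vectors PL PgM ker_g gpsi Lphi rL nLP.
have [f [Pf xf]] := separating_functional xP.
pose h := g + f *m (y - x *m g).
have Ph : P *m h = P *m g by rewrite mulmxDr mulmxA Pf mul0mx addr0.
have xh : x *m h = y by rewrite mulmxDr mulmxA xf mul1mx addrC subrK.
have Pxh : ((P + x)%MS *m h <= P *m g + y)%MS.
  by rewrite addsmxMr Ph xh.
have xy' : x *m h *m psi = x *m phi by rewrite xh.
have [|||||h' [h'1 h'2 h'3 h'4]] := IH (P + x)%MS h _ _ _ _ _ Lphi rL.
- have PPx : (P < P + x)%MS.
    by rewrite ltmxE addsmxSl; apply: contra xP => /(submx_trans (addsmxSr _ _)).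
  have := rank_ltmx PPx; have := mxrankS (_ : (P + x <= L)%MS).
  by rewrite addsmx_sub PL xL => /(_ isT); lia.
- by rewrite addsmx_sub PL.
- by apply: submx_trans Pxh _; rewrite addsmx_sub PgM.
- apply/eqmxP/andP; split; last first.
    have NPg : (N <= P :&: kermx g)%MS by rewrite ker_g.
    have NP : (N <= P)%MS := submx_trans NPg (capmxSl _ _).
    have Ng : (N <= kermx g)%MS := submx_trans NPg (capmxSr _ _).
    rewrite sub_capmx (submx_trans NP (addsmxSl _ _)) /=.
    have /submxP[E NE] := NP.
    apply/sub_kermxP; rewrite NE -mulmxA Ph mulmxA -NE.
    exact/sub_kermxP.
  apply/rV_subP => u; rewrite sub_capmx => /andP[/sub_addsmxP[[a b] /= ->]].
  move=> /sub_kermxP; rewrite mulmxDl -!mulmxA Ph xh => ab.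
  (* A nonzero component along x would put y into the image of P; hence the kernel does not grow. *)
  have b0 : b = 0.
    apply/eqP; apply: contraNT yg => nb.
    have b00 : b 0 0 != 0.
      by apply: contra nb => /eqP b0; apply/eqP/rowP => i; rewrite ord1 b0 mxE.
    have -> : y = - (b 0 0)^-1 *: (a *m (P *m g)).
      move/eqP: ab; rewrite addr_eq0 => /eqP ->.
      rewrite {2}[b]mx11_scalar mul_scalar_mx scalerN scaleNr opprK scalerA.
      by rewrite mulVf // scale1r.
    by rewrite scalemx_sub // submxMl.
  move: ab; rewrite b0 !mul0mx !addr0 => ab.
  rewrite -ker_g sub_capmx submxMl /=.
  by apply/sub_kermxP; rewrite -mulmxA.
- have /submxP[E PE] : (P + x <= col_mx P x)%MS by rewrite addsmxE.
  rewrite PE -!mulmxA; congr (_ *m _).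
  by rewrite mul_col_mx mul_col_mx !mulmxA Ph xy' -gpsi.
- exists h'; split=> //; rewrite -Ph.
  have /submxP[E ->] := addsmxSl P x.
  by rewrite -!mulmxA h'1.
Qed.

End LiftingIsomorphisms.

Lemma eqmx_rankE (F : fieldType) m1 m2 n (A : 'M[F]_(m1, n)) (B : 'M_(m2, n)) :
  (A :=: B)%MS -> \rank A = \rank B.
Proof. by move=> AB; rewrite AB. Qed.

Lemma ordS_all n (P : 'I_n -> Prop) : (forall v, P (ordS v)) -> forall v, P v.
Proof. by move=> H v; rewrite -(ord_predK v). Qed.

Section Families.
Variables (F : fieldType) (n : nat).
Implicit Types V W : rep F n.

Definition fam V := forall v, 'M[F]_(rdim V v).

(** The cast is needed because [push] is indexed by the target vertex w, and [ordS (ord_pred w)]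
    equals w only propositionally. *)
Definition arr V (v w : 'I_n) : 'M[F]_(rdim V v, rdim V w) :=
  if ordS v =P w is ReflectT e
  then ecast u 'M_(rdim V v, rdim V u) e (rarr V v) else 0.

Lemma arrS V v : arr V v (ordS v) = rarr V v.
Proof. by rewrite /arr; case: eqP => // e; rewrite eq_axiomK. Qed.

(** For a nilpotent subrepresentation L this is its radical, so that [pw k L] is rad^k L. The form
    <<_>> makes the image a square matrix again. *)
Definition push V (L : fam V) : fam V :=
  fun w => <<L (ord_pred w) *m arr V (ord_pred w) w>>%MS.

Lemma pushE V (L : fam V) v : (push L (ordS v) :=: L v *m rarr V v)%MS.
Proof. by rewrite /push ordSK arrS; apply: genmxE. Qed.

Definition fle V (L M : fam V) := forall v, (L v <= M v)%MS.
Definition stable V (L : fam V) := fle (push L) L.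
Definition fadd V (L M : fam V) : fam V := fun v => (L v + M v)%MS.
Definition full V : fam V := fun v => 1%:M.
Definition fzero V : fam V := fun v => 0.
Notation pw k L := (iter k (@push _) L).

Lemma fle_refl V (L : fam V) : fle L L. Proof. by move=> v. Qed.

Lemma fle_trans V (L M N : fam V) : fle L M -> fle M N -> fle L N.
Proof. by move=> LM MN v; apply: submx_trans (LM v) (MN v). Qed.

Lemma stableP V (L : fam V) :
  stable L <-> forall v, (L v *m rarr V v <= L (ordS v))%MS.
Proof.
split=> [H v|H]; first by rewrite -pushE; apply: H.
by apply: ordS_all => v; rewrite pushE; apply: H.
Qed.

Lemma push_mono V (L M : fam V) : fle L M -> fle (push L) (push M).
Proof. by move=> LM; apply: ordS_all => v; rewrite !pushE submxMr. Qed.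

Lemma pw_mono V (L M : fam V) k : fle L M -> fle (pw k L) (pw k M).
Proof. by move=> LM; elim: k => //= k IH; apply: push_mono. Qed.

Lemma pw_le V (L : fam V) k : stable L -> fle (pw k L) L.
Proof.
move=> sL; elim: k => [|k IH] /=; first exact: fle_refl.
by apply: fle_trans (push_mono IH) sL.
Qed.

Lemma stable_pw V (L : fam V) k : stable L -> stable (pw k L).
Proof. by move=> sL; rewrite /stable -iterS iterSr; apply: pw_mono. Qed.

Lemma pw_anti V (L : fam V) j k : stable L -> (j <= k)%N ->
  fle (pw k L) (pw j L).
Proof. by move=> sL /subnK<-; rewrite iterD; apply: pw_le; apply: stable_pw. Qed.

Lemma pushD V (L M : fam V) v :
  (push (fadd L M) v :=: push L v + push M v)%MS.
Proof.
move: v; apply: ordS_all => v; apply: eqmx_trans (pushE _ _) _.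
apply: eqmx_trans (addsmxMr _ _ _) _.
by apply: adds_eqmx; apply: eqmx_sym; apply: pushE.
Qed.

Lemma stable_add V (L M : fam V) : stable L -> stable M -> stable (fadd L M).
Proof. by move=> sL sM v; rewrite pushD addsmxS. Qed.

Lemma stable_full V : stable (full V).
Proof. by move=> v; rewrite submx1. Qed.

Lemma stable0 V : stable (fzero V).
Proof. by apply/stableP => v; rewrite mul0mx sub0mx. Qed.

(* (L + N) / N and M are the same subquotients of V and W by way of g *)
Definition sqiso V W (L N : fam V) (M : fam W)
    (g : forall v, 'M[F]_(rdim V v, rdim W v)) :=
  [/\ forall v, L v *m g v *m rarr W v = L v *m rarr V v *m g (ordS v),
      forall v, (L v *m g v :=: M v)%MS
    & forall v, (L v :&: kermx (g v) :=: N v)%MS].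

Lemma sqiso_ker0 V W (L N : fam V) (M : fam W) g :
  sqiso L N M g -> forall v, N v *m g v = 0.
Proof.
move=> [_ _ ker_g] v; apply/sub_kermxP.
have : (N v <= L v :&: kermx (g v))%MS by rewrite ker_g.
by move/submx_trans; apply; apply: capmxSr.
Qed.

Lemma sqiso_pw V W (L N : fam V) (M : fam W) g k : stable L -> sqiso L N M g ->
  forall v, (pw k L v *m g v :=: pw k M v)%MS.
Proof.
move=> sL [hg Lg _]; elim: k => [|k IH] //=; apply: ordS_all => v.
apply: eqmx_trans (eqmxMr _ (pushE _ _)) _.
have [D eD] : exists D, pw k L v = D *m L v by apply/submxP/pw_le.
rewrite eD -!mulmxA [L v *m _]mulmxA -hg !mulmxA -eD.
by apply: eqmx_trans (eqmxMr _ (IH v)) _; apply/eqmx_sym/pushE.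
Qed.

Lemma sqiso_rank V W (L N : fam V) (M : fam W) g (X : fam V) :
  sqiso L N M g -> fle N X -> fle X L ->
  forall v, \rank (X v) = (\rank (N v) + \rank (X v *m g v))%N.
Proof.
move=> isog NX XL v; have [_ _ ker_g] := isog.
rewrite -(mxrank_mul_ker (X v) (g v)) addnC; congr (_ + _)%N.
apply: eqmx_rankE; apply/eqmxP/andP; split.
  by rewrite -ker_g capmxS.
by rewrite sub_capmx NX /=; apply/sub_kermxP; apply: sqiso_ker0 isog v.
Qed.

Lemma sqiso_layers V W (L N : fam V) (M : fam W) g : stable L -> fle N L ->
  sqiso L N M g ->
  forall k v, \rank (pw k L v + N v)%MS = (\rank (N v) + \rank (pw k M v))%N.
Proof.
move=> sL NL isog k v.
rewrite (sqiso_rank (X := fadd (pw k L) N) isog); first last.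
- by move=> u; rewrite addsmx_sub pw_le ?NL.
- by move=> u; apply: addsmxSr.
congr (_ + _)%N; apply: eqmx_rankE; apply: eqmx_trans (addsmxMr _ _ _) _.
rewrite (sqiso_ker0 isog); apply: eqmx_trans (addsmx0 _ _) _.
by apply: eqmx_trans (sqiso_pw k sL isog v).
Qed.

(** Modulo N the layers of [push L] + N are those of L shifted by one, which is what the induction
    in [layers_sqiso] descends to. *)
Lemma pw_fadd V (L N : fam V) k : stable N ->
  forall v, (pw k (fadd (push L) N) v + N v :=: pw k.+1 L v + N v)%MS.
Proof.
move=> sN; elim: k => [|k IH] v /=.
  by rewrite /fadd -addsmxA; apply: adds_eqmx => //; apply/addsmx_idPl.
have H (Z1 Z2 : fam V) : fle Z1 (fadd Z2 N) ->
    fle (fadd (push Z1) N) (fadd (push Z2) N).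
  move=> Z12 u; rewrite addsmx_sub addsmxSr andbT.
  apply: submx_trans (push_mono Z12 u) _; rewrite pushD addsmxS //; apply: sN.
apply/eqmxP/andP; split; apply: H => u.
  by have := addsmxSl (pw k (fadd (push L) N) u) (N u); rewrite IH.
by have := addsmxSl (pw k.+1 L u) (N u); rewrite -IH.
Qed.

(** The converse of [sqiso_layers]: layer ranks determine the isomorphism type. By induction on the
    nilpotency degree there is an isomorphism on radicals. Being a homomorphism at v involves at the
    next vertex only the values on the radical, which are already fixed, so the vertices can be
    treated independently by [lift_iso]. *)
Lemma layers_sqiso V W (L N : fam V) (M : fam W) :
    stable L -> stable N -> fle N L -> stable M ->
    (exists K, fle (pw K L) N) ->
    (forall k v, \rank (pw k L v + N v)%MS = (\rank (N v) + \rank (pw k M v))%N) ->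
  exists g, sqiso L N M g.
Proof.
move=> sL sN NL sM [K LK] rk; elim: K => [|K IH] in L M sL NL sM LK rk *.
  exists (fun v => 0); split=> v; rewrite ?mulmx0 ?mul0mx //.
    have := rk 0%N v; rewrite /= (eqmx_rankE (addsmx_idPr (LK v))).
    move/eqP; rewrite -{1}[\rank (N v)]addn0 eqn_add2l eq_sym mxrank_eq0.
    by move=> /eqP ->; apply/eqmxP; rewrite !sub0mx.
  apply/eqmxP; rewrite sub_capmx NL (submx_trans (capmxSl _ _) (LK v)) /=.
  by apply/sub_kermxP; rewrite mulmx0.
have [g' isog'] : exists g, sqiso (fadd (push L) N) N (push M) g.
  apply: IH.
  - by apply: stable_add; first apply: (stable_pw 1).
  - by move=> v; apply: addsmxSr.
  - exact: (stable_pw 1).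
  - move=> v; have := addsmxSl (pw K (fadd (push L) N) v) (N v).
    rewrite pw_fadd // => /submx_trans; apply; rewrite addsmx_sub submx_refl.
    by rewrite LK.
  - by move=> k v; rewrite pw_fadd // rk iterSr.
have [hom_g' im_g' ker_g'] := isog'.
have PL : fle (fadd (push L) N) L by move=> v; rewrite addsmx_sub sL NL.
have /fin_all_exists[g Hg] : forall v, exists h,
    [/\ fadd (push L) N v *m h = fadd (push L) N v *m g' v,
        L v *m h *m rarr W v = L v *m (rarr V v *m g' (ordS v)),
        (L v *m h :=: M v)%MS & (L v :&: kermx h :=: N v)%MS].
  move=> v; apply: lift_iso.
  - exact: PL.
  - by rewrite im_g'; apply: sM.
  - exact: ker_g'.
  - by rewrite hom_g' mulmxA.
  - rewrite mulmxA; apply: eqmx_trans (eqmxMr _ (eqmx_sym (pushE _ _))) _.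
    apply: eqmx_trans _ (pushE _ _).
    apply: eqmx_trans _ (im_g' (ordS v)).
    apply: eqmx_sym; apply: eqmx_trans (addsmxMr _ _ _) _.
    by rewrite (sqiso_ker0 isog'); apply: addsmx0.
  - by rewrite -(rk 0%N); apply: eqmx_rankE; apply/eqmx_sym/addsmx_idPl/NL.
exists g; split=> v; have [gP gT gL gN] := Hg v => //.
rewrite gT mulmxA; have [gP' _ _ _] := Hg (ordS v).
have /submxP[D ->] : (L v *m rarr V v <= fadd (push L) N (ordS v))%MS.
  by rewrite -pushE addsmxSl.
by rewrite -!mulmxA gP'.
Qed.

End Families.

Notation pw k L := (iter k (@push _ _ _) L).

Section Isomorphisms.
Variables (F : finFieldType) (n : nat).
Implicit Types V W : rep F n.

Notation subspaces V := {dffun forall v : 'I_n, 'M[F]_(rdim V v)}.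

Lemma quo_isoP V W (N : subspaces V) :
  quo_iso W N <-> exists g, sqiso (full V) N (full W) g.
Proof.
split=> [/existsP[g /andP[/forallP hg /forallP Hg]]|[g [hg Lg kg]]].
  exists g; split=> v; rewrite /full.
  - by rewrite !mul1mx; apply/eqP.
  - have /andP[g1 _] := Hg v; rewrite mul1mx.
    by apply/eqmxP; rewrite submx1 sub1mx.
  - have /andP[_ /eqmxP kg] := Hg v.
    by apply: eqmx_trans kg; apply/eqmxP; rewrite capmxSr sub_capmx submx1 submx_refl.
apply/existsP; exists [ffun v => g v]; apply/andP; split; apply/forallP => v.
  by rewrite !ffunE; have := hg v; rewrite !mul1mx => ->.
rewrite !ffunE -sub1mx; apply/andP; split.
  by have := Lg v; rewrite mul1mx => ->.
apply/eqmxP; apply: eqmx_trans (kg v).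
by apply/eqmxP; rewrite capmxSr sub_capmx submx1 submx_refl.
Qed.

(** The map in [sub_iso] goes into V and the one in [sqiso] comes out of V; pseudo-inverses
    translate one into the other. *)
Lemma sub_isoP V W (N : subspaces V) : stable N ->
  sub_iso W N <-> exists g, sqiso N (fzero V) (full W) g.
Proof.
move=> /stableP sN.
split=> [/existsP[f /andP[/forallP hf /forallP Hf]]|[g [hg Lg kg]]].
  have fp v : f v *m pinvmx (f v) = 1%:M.
    by have /andP[ff _] := Hf v; apply: mulmxVp.
  have Nf v : exists D, N v = D *m f v.
    by have /andP[_ /andP[_ /submxP]] := Hf v.
  exists (fun v => pinvmx (f v)); split=> v; have [D ND] := Nf v.
  - rewrite ND -[D *m _ *m _]mulmxA fp mulmx1 -!mulmxA; congr (_ *m _).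
    by rewrite [RHS]mulmxA (eqP (hf v)) -[RHS]mulmxA fp mulmx1.
  - apply/eqmxP; rewrite /full submx1 /=.
    have /andP[_ /andP[/submxP[E fE] _]] := Hf v.
    by rewrite -(fp v) {1}fE -mulmxA submxMl.
  - apply/eqmxP; rewrite sub0mx andbT submx0; apply/eqP.
    have /submxP[E eE] := capmxSl (N v) (kermx (pinvmx (f v))).
    have := capmxSr (N v) (kermx (pinvmx (f v))).
    move=> /sub_kermxP; rewrite eE ND -!mulmxA fp mulmx1 => ED.
    by rewrite mulmxA ED mul0mx.
(* The section of [g v] with image in N v. *)
pose f v := pinvmx (N v *m g v) *m N v.
have fg v : f v *m g v = 1%:M.
  by rewrite /f -mulmxA mulVpmx // -sub1mx Lg.
have inj v m (Y : 'M_(m, _)) : (Y <= N v)%MS -> Y *m g v = 0 -> Y = 0.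
  move=> YN /sub_kermxP Yg; apply/eqP; rewrite -submx0 -(kg v).
  by rewrite sub_capmx YN.
have fN v : (f v <= N v)%MS by apply: submxMl.
apply/existsP; exists [ffun v => f v]; apply/andP; split; apply/forallP => v.
  rewrite !ffunE -subr_eq0; apply/eqP; apply: inj.
    rewrite addmx_sub ?eqmx_opp //; first by apply: submx_trans (sN v); rewrite submxMr.
    by apply: submx_trans (fN _); apply: submxMl.
  rewrite mulmxBl -[rarr W v *m _ *m _]mulmxA fg mulmx1.
  rewrite /f -[X in X - _]mulmxA -mulmxA [N v *m (_ *m _)]mulmxA -hg.
  by rewrite mulmxA mulVpmx ?mul1mx ?subrr // -sub1mx Lg.
rewrite !ffunE; apply/andP; split; first by apply/row_freeP; exists (g v).
rewrite -(geq_leqif (mxrank_leqif_eq (fN v))).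
have := mxrank_mul_ker (N v) (g v); rewrite kg mxrank0 addn0 => <-.
by rewrite Lg /full -(fg v) mxrankM_maxl.
Qed.

End Isomorphisms.

(** * Isomorphism types of subquotients *)

Section CoordinateSubspaces.
Variables (F : fieldType) (n : nat) (C : Theta n).
Implicit Types (P Q : pred (cell n)) (v : 'I_n).

Definition cellat v (j : 'I_(size (cells_at C v))) : cell n :=
  tnth (in_tuple (cells_at C v)) j.

Lemma mem_cells b :
  (b \in cells C) = (b.1.2 < C b.1.1)%N && (b.2 <= b.1.1.2)%N.
Proof.
apply/allpairsPdep/andP => [[q [k [/allpairsPdep[p [c [_ Hc ->]]] Hk ->]]]|].
  by move: Hc Hk; rewrite !mem_iota /= !add0n ltnS.
move: b => [[p c] k] [Hc Hk]; exists (p, c), k; split; [|by rewrite mem_iota add0n ltnS|by []].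
apply/allpairsPdep; exists p, c; split; [|by rewrite mem_iota|by []].
by rewrite mem_finsupp -lt0n (leq_ltn_trans _ Hc).
Qed.

Lemma uniq_cells : uniq (cells C).
Proof.
apply: allpairs_uniq_dep => [|q _|]; last 1 first.
- by move=> [[p c] k] [[p' c'] k'] _ _ /= [-> -> ->].
- apply: allpairs_uniq_dep => [|p _|]; [exact: fset_uniq|exact: iota_uniq|].
  by move=> [p c] [p' c'] _ _ /= [-> ->].
- exact: iota_uniq.
Qed.

Lemma uniq_cells_at v : uniq (cells_at C v).
Proof. exact/filter_uniq/uniq_cells. Qed.

Lemma mem_cells_at v b :
  (b \in cells_at C v) = (cell_vertex b == v) && (b \in cells C).
Proof. by rewrite mem_filter. Qed.

Lemma mem_cellat v j : @cellat v j \in cells_at C v.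
Proof. exact: mem_tnth. Qed.

Lemma cellat_inj v : injective (@cellat v).
Proof. by move=> i j; apply/tuple_uniqP/uniq_cells_at. Qed.

Lemma cellat_onto v b : b \in cells_at C v -> exists j, @cellat v j = b.
Proof.
move=> bC; have /tnthP[j ->] : b \in in_tuple (cells_at C v) by [].
by exists j.
Qed.

Lemma cell_vertex_next (b : cell n) : cell_vertex (cell_next b) = ordS (cell_vertex b).
Proof. by []. Qed.

(** The span of the basis vectors whose cells satisfy P, encoded as a diagonal matrix of zeros and
    ones so that boolean operations on P become lattice operations on subspaces. *)
Definition coord P : fam (Mrep F C) :=
  fun v => diag_mx (\row_j (P (cellat j))%:R).

Lemma mul_coord P v m (X : 'M[F]_(m, rdim (Mrep F C) v)) i j :
  (X *m coord P v) i j = if P (cellat j) then X i j else 0.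
Proof.
rewrite mul_mx_diag mxE mxE; case: (P _); first by rewrite mulr1.
by rewrite mulr0.
Qed.

Lemma sub_coordP P v m (X : 'M[F]_(m, rdim (Mrep F C) v)) :
  reflect (forall i j, ~~ P (cellat j) -> X i j = 0) (X <= coord P v)%MS.
Proof.
apply: (iffP idP) => [/submxP[D ->] i j /negbTE nP|H].
  by rewrite mul_coord nP.
suff -> : X = X *m coord P v by apply: submxMl.
apply/matrixP => i j; rewrite mul_coord; case: ifP => // /negbT; exact: H.
Qed.

Lemma coordE P v i j :
  coord P v i j = (P (cellat j))%:R *+ (i == j).
Proof. by rewrite !mxE; case: eqP => // ->. Qed.

Lemma coord_mono P Q v : (forall b, b \in cells_at C v -> P b -> Q b) ->
  (coord P v <= coord Q v)%MS.
Proof.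
move=> PQ; apply/sub_coordP => i j nQ; rewrite coordE.
case: (boolP (P _)) => [/(PQ _ (mem_cellat _))|_]; last by rewrite mul0rn.
by rewrite (negbTE nQ).
Qed.

Lemma coord_add P Q v :
  (coord P v + coord Q v :=: coord (predU P Q) v)%MS.
Proof.
apply/eqmxP/andP; split.
  by rewrite addsmx_sub !coord_mono // => b _ /= ->; rewrite ?orbT.
have -> : coord (predU P Q) v
          = coord P v + coord (fun b => Q b && ~~ P b) v :> 'M_(_).
  apply/matrixP => i j; rewrite [RHS]mxE !coordE /= -mulrnDl; congr (_ *+ _).
  by case: (P _); case: (Q _); rewrite ?addr0 ?add0r.
apply: addmx_sub_adds => //; apply: coord_mono => b _ /andP[] //.
Qed.

Lemma coord_cap P Q v :
  (coord P v :&: coord Q v :=: coord (predI P Q) v)%MS.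
Proof.
apply/eqmxP/andP; split.
  apply/sub_coordP => i j; rewrite negb_and => /orP[] H.
    by move: (capmxSl (coord P v) (coord Q v)) => /sub_coordP; apply.
  by move: (capmxSr (coord P v) (coord Q v)) => /sub_coordP; apply.
by rewrite sub_capmx !coord_mono // => b _ /andP[].
Qed.

Lemma rank_coord_le P v : (\rank (coord P v) <= count P (cells_at C v))%N.
Proof.
have -> : count P (cells_at C v) = (\sum_(j < size (cells_at C v)) P (cellat j))%N.
  rewrite -sum1_count big_mkcond /= (big_tnth _ _ (cells_at C v)).
  by apply: eq_bigr => j _; rewrite /cellat; case: (P _).
have -> : coord P v = \sum_j (P (cellat j))%:R *: delta_mx j j.
  apply/matrixP => i k; rewrite summxE (bigD1 k) //= big1 ?addr0 => [|j jk].
    by rewrite coordE !mxE eqxx andbT; case: eqP; rewrite ?mulr1 ?mulr0 ?mulr1n.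
  by rewrite !mxE [k == j]eq_sym (negbTE jk) andbF mulr0.

elim/big_ind2: _ => [|A a B b Aa Bb|j _]; first by rewrite mxrank0.
  by apply: leq_trans (mxrank_add _ _) (leq_add Aa Bb).
by case: (P _); rewrite ?scale1r ?mxrank_delta // scale0r mxrank0.
Qed.

(** The upper bounds of [rank_coord_le] for P and for its complement add up to the whole dimension,
    so both are attained. *)
Lemma rank_coord P v : \rank (coord P v) = count P (cells_at C v).
Proof.
apply/eqP; rewrite eqn_leq rank_coord_le /=.
have := rank_coord_le (predC P) v; have := count_predC P (cells_at C v).
have := (mxrank_adds_leqif (coord P v) (coord (predC P) v)).1.
rewrite coord_add.
have -> : \rank (coord (predU P (predC P)) v) = size (cells_at C v).
  have -> : coord (predU P (predC P)) v = 1%:M.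
    by apply/matrixP => i j; rewrite coordE !mxE /= orbN.
  by rewrite mxrank1.
move=> le1 eq2 le3; rewrite -(leq_add2r (count (predC P) (cells_at C v))) eq2.
by apply: leq_trans le1 _; rewrite leq_add2l.
Qed.

Lemma push_coord P v :
  (push (coord P) v :=: coord (fun b => (0 < b.2)%N && P (b.1, b.2.-1)) v)%MS.
Proof.
move: v; apply: ordS_all => v; apply: eqmx_trans (pushE _ _) _.
have XE i j : (coord P v *m rarr (Mrep F C) v) i j =
    (P (cellat i) && (cellat j == cell_next (cellat i)))%:R.
  rewrite mul_diag_mx [LHS]mxE mxE [rarr _ _ _ _]mxE -natrM mulnb.
  by rewrite -/(cellat i) -/(cellat j).
apply/eqmxP/andP; split.
  apply/sub_coordP => i j; rewrite XE.
  by case: eqP => [->|]; rewrite ?andbF //= -surjective_pairing andbT => /negbTE ->.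
apply/row_subP => j; have [/andP[j0 Pj]|nP] :=
    boolP ((0 < (cellat j).2)%N && P ((cellat j).1, (cellat j).2.-1)); last first.
  suff -> : row j (coord (fun b => (0 < b.2)%N && P (b.1, b.2.-1)) (ordS v)) = 0.
    exact: sub0mx.
  apply/rowP => k; rewrite mxE coordE mxE.
  by case: eqP => // <-; rewrite (negbTE nP) mul0rn.
have [i bi] : exists i, @cellat v i = ((cellat j).1, (cellat j).2.-1).
  apply: cellat_onto; have := mem_cellat j.
  rewrite !mem_cells_at !mem_cells /= => /andP[/eqP Hv /andP[-> Hk]].
  apply/andP; split; last by apply: leq_trans Hk; apply: leq_pred.
  apply/eqP; apply: (can_inj (@ordSK n)); apply: etrans Hv.
  rewrite -cell_vertex_next; congr (cell_vertex _).
  by rewrite /cell_next /= prednK // -surjective_pairing.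
have -> : row j (coord (fun b => (0 < b.2)%N && P (b.1, b.2.-1)) (ordS v))
     = row i (coord P v *m rarr (Mrep F C) v).
  apply/rowP => k; rewrite ![row _ _ _ _]mxE coordE XE bi Pj /= /cell_next /= prednK //.
  case: eqP => [<-|/eqP jk]; last first.
    by rewrite mulr0n -surjective_pairing (inj_eq (@cellat_inj _)) eq_sym (negbTE jk).
  by rewrite j0 Pj -surjective_pairing eqxx.
exact: row_sub.
Qed.

Lemma push_eqmx (V : rep F n) (L M : fam V) : (forall v, L v :=: M v)%MS ->
  forall v, (push L v :=: push M v)%MS.
Proof.
by move=> LM v; apply/eqmxP/andP; split; apply: push_mono => u; rewrite LM.
Qed.

Lemma pw_coord P k v :
  (pw k (coord P) v :=: coord (fun b => (k <= b.2)%N && P (b.1, (b.2 - k)%N)) v)%MS.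
Proof.
elim: k v => [|k IH] v /=.
  by apply/eqmxP/andP; split; apply: coord_mono => -[p j] _; rewrite subn0.
apply: eqmx_trans (push_eqmx IH v) _; apply: eqmx_trans (push_coord _ _) _.
by apply/eqmxP/andP; split; apply: coord_mono => -[p [|j]] _ //=; rewrite subSS.
Qed.

End CoordinateSubspaces.

Section LayerRanks.
Variable n : nat.
Implicit Types (A B : Theta n) (v : 'I_n).

(** The dimension of rad^k M(A) at v, see [rank_pw_full]. *)
Definition rA A k v : nat := count (fun b : cell n => (k <= b.2)%N) (cells_at A v).

(* the number of summands M^{i,j} of length greater than k with socle at v *)
Definition eA A k v : nat :=
  \sum_(p <- finsupp A | (k <= p.2)%N && (iter p.2 (@ordS n) p.1 == v)) A p.

Lemma iterS_cancel k : cancel (iter k (@ord_pred n)) (iter k (@ordS n)).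
Proof. by elim: k => [|k IH] v //; rewrite iterSr iterS ord_predK IH. Qed.

Lemma iterS_cancel' k : cancel (iter k (@ordS n)) (iter k (@ord_pred n)).
Proof. by elim: k => [|k IH] v //; rewrite iterSr iterS ordSK IH. Qed.

Lemma rA_sum A k v : rA A k v =
  (\sum_(p <- finsupp A) A p * \sum_(k <= j < p.2.+1) (iter j (@ordS n) p.1 == v))%N.
Proof.
rewrite /rA /cells_at -sum1_count big_filter_cond big_mkcond /cells big_allpairs_dep.
rewrite big_allpairs_dep; apply: eq_bigr => p _.
rewrite (eq_bigr (fun=> \sum_(k <= j < p.2.+1) (iter j (@ordS n) p.1 == v)))%N.
  by rewrite big_const_seq count_predT size_iota iter_addn_0 mulnC.
move=> c _; rewrite [(p, c).1]/= -[iota 0 _]/(index_iota 0 p.2.+1).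
have [kp|pk] := leqP k p.2.+1; last first.
  rewrite [RHS]big_geq ?(ltnW pk) //.
  rewrite big_nat_cond big1 // => j; rewrite andbT /= => jp.
  by rewrite /cell_vertex /= leqNgt (leq_trans jp (ltnW pk)) andbF.
rewrite (big_cat_nat _ kp) //=.
rewrite big_nat_cond big1 => [|j]; last first.
  by rewrite andbT /= => jk; rewrite leqNgt jk andbF.
rewrite add0n; apply: eq_big_nat => j /andP[kj _].
by rewrite /cell_vertex /= kj andbT; case: eqP.
Qed.

(** The arrow leaving v kills the last cells of strings, counted by [eA], and maps the other cells
    injectively to the next layer. *)
Lemma rA_rec A k v : rA A k v = (eA A k v + rA A k.+1 (ordS v))%N.
Proof.
rewrite !rA_sum /eA [X in (X + _)%N]big_mkcond -big_split /=; apply: eq_bigr => p _.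
have sh : (\sum_(k.+1 <= j < p.2.+1) (iter j (@ordS n) p.1 == ordS v)
           = \sum_(k <= j < p.2) (iter j (@ordS n) p.1 == v))%N.
  rewrite big_add1 /=; apply: eq_bigr => j _.
  by rewrite (inj_eq (can_inj (@ordSK n))).
rewrite sh; have [kp|pk] := leqP k p.2.
  rewrite big_nat_recr //= mulnDr addnC; congr (_ + _)%N.
  by case: eqP; rewrite ?muln1 ?muln0.
by rewrite !big_geq ?(ltnW pk).
Qed.

(** A string of length k + 1 with socle at v has its top k vertices before v. With [rA_rec], this
    recovers the entries of A as second differences of [rA]. *)
Lemma eA_rec A k v : eA A k v = (A (iter k (@ord_pred n) v, k) + eA A k.+1 v)%N.
Proof.
rewrite /eA (bigID (fun p : 'I_n * nat => p.2 == k)) /=; congr (_ + _)%N; last first.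
  apply: eq_bigl => p; rewrite ltn_neqAle [k == _]eq_sym.
  by case: (p.2 == k); rewrite ?andbF ?andbT.
set p0 := (_, k); have [p0A|np0] := boolP (p0 \in finsupp A).
  rewrite big_mkcond (bigD1_seq p0) ?fset_uniq //= leqnn eqxx iterS_cancel eqxx /=.
  rewrite big1 ?addn0 // => -[i l] ne; case: ifP => //=.
  move=> /andP[/andP[_ /eqP ev] /eqP lk].
  by move: ne; rewrite /p0 -ev -lk iterS_cancel' eqxx.
rewrite (fsfun_dflt np0) big_seq_cond big1 // => -[i l] /= /andP[Hp].
move=> /andP[/andP[_ /eqP ev] /eqP lk].
by move: np0; rewrite /p0 -ev -lk iterS_cancel' Hp.
Qed.

Lemma rA_large A : exists K, forall k v, (K <= k)%N -> rA A k v = 0%N.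
Proof.
exists (\max_(p <- finsupp A) p.2).+1 => k v Kk.
rewrite rA_sum big_seq big1 // => p pA; rewrite [X in (_ * X)%N]big_geq ?muln0 //.
apply: leq_trans Kk; rewrite ltnS.
by rewrite (bigD1_seq p) ?fset_uniq //= leq_maxl.
Qed.

Lemma rA_inj A B : (forall k v, rA A k v = rA B k v) -> A = B.
Proof.
move=> AB; have eAB k v : eA A k v = eA B k v.
  by apply/eqP; rewrite -(eqn_add2r (rA A k.+1 (ordS v))) {2}AB -!rA_rec AB.
apply/fsfunP => -[i k]; have := eA_rec A k (iter k (@ordS n) i).
by rewrite eAB eA_rec eAB iterS_cancel' => /eqP; rewrite eqn_add2r => /eqP.
Qed.

(** The two inequalities say that the first and second differences of r are nonnegative; the second
    differences are the entries of A, and [rA] is then computed by descending induction from K. *)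
Lemma rA_exists (r : nat -> 'I_n -> nat) K :
    (forall k v, (K <= k)%N -> r k v = 0%N) ->
    (forall k v, (r k.+1 (ordS v) <= r k v)%N) ->
    (forall k v, (r k.+1 v - r k.+2 (ordS v) <= r k v - r k.+1 (ordS v))%N) ->
  exists A, forall k v, rA A k v = r k v.
Proof.
move=> rK r1 r2; pose kap k v := (r k v - r k.+1 (ordS v))%N.
pose f (p : 'I_n * nat) := let v := iter p.2 (@ordS n) p.1 in
  (kap p.2 v - kap p.2.+1 v)%N.
have f0 p : (K <= p.2)%N -> f p = 0%N by move=> Kp; rewrite /f /kap rK.
pose S : {fset 'I_n * nat} := [fset (p.1, val p.2) | p in {: 'I_n * 'I_K}]%fset.
pose A : Theta n := [fsfun p in S => f p | 0%N].
have AE p : A p = f p.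
  rewrite fsfun_fun; case: ifPn => // pS; rewrite f0 // leqNgt.
  apply: contra pS => pK; apply/imfsetP; exists (p.1, Ordinal pK) => //=.
  by case: (p).
have down (P : nat -> Prop) : (forall k, (K <= k)%N -> P k) ->
    (forall k, P k.+1 -> P k) -> forall k, P k.
  move=> PK PS k; have [j] := ubnP (K - k); elim: j k => // j IH k kj.
  have [/PK//|kK] := leqP K k; apply: PS; apply: IH; lia.
have eK k v : (K <= k)%N -> eA A k v = 0%N.
  move=> Kk; rewrite /eA big1_seq // => p /andP[/andP[kp _] _].
  by rewrite AE f0 // (leq_trans Kk).
have rKA k v : (K <= k)%N -> rA A k v = 0%N.
  move=> Kk; rewrite rA_sum big1 // => p _.
  have [Kp|pK] := leqP K p.2; first by rewrite AE f0.
  by rewrite [X in (_ * X)%N]big_geq ?muln0 // (leq_trans pK).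
have ekap k : forall v, eA A k v = kap k v.
  elim/down: k => [k Kk v|k IH v]; first by rewrite eK // /kap rK.
  by rewrite eA_rec IH AE /f /= iterS_cancel subnK // /kap r2.
exists A; elim/down => [k Kk v|k IH v]; first by rewrite rKA ?rK.
by rewrite rA_rec IH ekap /kap subnK.
Qed.

Lemma dimvecE A v : dimvec A v = (rA A 0 v)%:Z.
Proof. by rewrite ffunE /rA (eq_count (a2 := predT)) ?count_predT. Qed.

End LayerRanks.

Section Types.
Variables (F : fieldType) (n : nat).
Implicit Types (V W : rep F n) (A B C : Theta n).

Lemma pw_eqmx V (L M : fam V) k : (forall v, L v :=: M v)%MS ->
  forall v, (pw k L v :=: pw k M v)%MS.
Proof. by move=> LM; elim: k => //= k IH; apply: push_eqmx. Qed.

Lemma pw_full A k v :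
  (pw k (full (Mrep F A)) v :=: coord F A (fun b => (k <= b.2)%N) v)%MS.
Proof.
have -> : full (Mrep F A) = coord F A predT.
  apply: functional_extensionality_dep => u; apply/matrixP => i j.
  by rewrite coordE !mxE.
apply: eqmx_trans (pw_coord F A predT k v) _.
by apply/eqmxP/andP; split; apply: coord_mono => b _ /=; rewrite andbT.
Qed.

Lemma rank_pw_full A k v : \rank (pw k (full (Mrep F A)) v) = rA A k v.
Proof. by rewrite pw_full rank_coord. Qed.

(* (L + N) / N is isomorphic to M(A), see typ_sqiso *)
Definition typ V (L N : fam V) A : Prop :=
  forall k v, \rank (pw k L v + N v)%MS = (\rank (N v) + rA A k v)%N.

Lemma typ_uniq V (L N : fam V) A B : typ L N A -> typ L N B -> A = B.
Proof.
move=> tA tB; apply: rA_inj => k v; apply/eqP.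
by rewrite -(eqn_add2l (\rank (N v))) -tA -tB.
Qed.

Lemma typ_nilp V (L N : fam V) A : typ L N A ->
  forall K, (forall k v, (K <= k)%N -> rA A k v = 0%N) -> fle (pw K L) N.
Proof.
move=> tA K AK v; have := tA K v; rewrite AK // addn0 => e.
have /eqmxP/andP[_ H] : (N v :=: pw K L v + N v)%MS.
  by apply/eqmxP; rewrite -(geq_leqif (mxrank_leqif_eq (addsmxSr _ _))) e.
by apply: submx_trans H; apply: addsmxSl.
Qed.

Lemma typ_sqiso V (L N : fam V) A : stable L -> stable N -> fle N L ->
  typ L N A <-> exists g, sqiso L N (full (Mrep F A)) g.
Proof.
move=> sL sN NL; split=> [tA|[g isog] k v]; last first.
  by rewrite (sqiso_layers sL NL isog) rank_pw_full.
have [K AK] := rA_large A.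
apply: layers_sqiso => //; first exact: stable_full.
  by exists K; apply: typ_nilp tA _ AK.
by move=> k v; rewrite tA rank_pw_full.
Qed.

Lemma rank_mod m p (X : 'M[F]_(m, p)) (N : 'M_p) :
  \rank (X + N)%MS = (\rank N + \rank (X *m cokermx N))%N.
Proof.
have := mxrank_mul_ker X (cokermx N); have := mxrank_sum_cap X N.
have -> : \rank (X :&: kermx (cokermx N))%MS = \rank (X :&: N)%MS; last by lia.
apply: eqmx_rankE; apply: cap_eqmx => //.
apply/eqmxP/andP; split; last by apply/sub_kermxP; apply: mulmx_coker.
by rewrite submxE; apply/eqP; apply: mulmx_ker.
Qed.

(** The first difference of the layer ranks is the dimension of the kernel of the arrow on rad^k L
    modulo N. It is nonnegative and decreases with k, as [rA_exists] requires. *)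
Lemma typ_exists V (L N : fam V) : stable L -> stable N -> fle N L ->
  (exists K, fle (pw K L) N) -> exists A, typ L N A.
Proof.
move=> sL sN NL [K LK].
pose X k v := (pw k L v + N v)%MS; pose r k v := (\rank (X k v) - \rank (N v))%N.
have rN k v : (\rank (N v) <= \rank (X k v))%N by rewrite mxrankS ?addsmxSr.
pose B v := rarr V v *m cokermx (N (ordS v)).
have NB v : N v *m B v = 0.
  by apply/eqP; rewrite mulmxA -submxE; move/stableP: sN => /(_ v).
have rS k v : r k.+1 (ordS v) = \rank (X k v *m B v).
  rewrite /r /X rank_mod addKn; apply: eqmx_rankE; apply: eqmx_sym.
  apply: eqmx_trans (addsmxMr _ _ _) _; rewrite NB.
  apply: eqmx_trans (addsmx0 _ _) _; rewrite mulmxA.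
  by apply: eqmxMr; apply: eqmx_sym; apply: pushE.
have ker_r k v :
    (r k v - r k.+1 (ordS v) = \rank (X k v :&: kermx (B v))%MS - \rank (N v))%N.
  by rewrite rS /r; have := mxrank_mul_ker (X k v) (B v); lia.
have NK k v : (N v <= X k v :&: kermx (B v))%MS.
  by rewrite sub_capmx addsmxSr; apply/sub_kermxP.
have XS k v : (X k.+1 v <= X k v)%MS.
  by rewrite addsmxS //; apply: (stable_pw k sL).
have [A rAr] : exists A, forall k v, rA A k v = r k v; last first.
  by exists A => k v; rewrite rAr subnKC.
apply: (rA_exists (K := K)) => k v.
- move=> Kk; apply/eqP; rewrite subn_eq0; apply: mxrankS.
  rewrite addsmx_sub submx_refl andbT.
  by apply: submx_trans (pw_anti sL Kk v) (LK v).
- rewrite rS /r; have := mxrank_mul_ker (X k v) (B v).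
  by have := mxrankS (NK k v); lia.
- rewrite !ker_r leq_sub2r //; apply: mxrankS; apply: capmxS => //.
Qed.

End Types.

Lemma card_bij_in (T T' : finType) (P : pred T) (Q : pred T') f h :
    (forall x, P x -> Q (f x)) -> (forall y, Q y -> P (h y)) ->
    (forall x, P x -> h (f x) = x) -> (forall y, Q y -> f (h y) = y) ->
  #|P| = #|Q|.
Proof.
move=> PQ QP hf fh; rewrite -(card_in_image (f := f) (A := P)) => [|x y Px Py].
  apply: eq_card => y; apply/fintype.imageP/idP => [[x Px ->]|Qy]; first exact: PQ.
  by exists (h y); rewrite ?fh //; apply: QP.
by move=> fxy; rewrite -[x]hf // fxy hf.
Qed.

(** * Hall numbers as counts inside subquotients, and Hall polynomials of radical filtrations *)

Section HallCounts.
Variables (F : finFieldType) (n : nat).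
Implicit Types (V W : rep F n) (A B C : Theta n).

Notation subspaces V := {dffun forall v : 'I_n, 'M[F]_(rdim V v)}.

Lemma is_subrepP V (N : subspaces V) :
  reflect ((forall v, <<N v>>%MS = N v) /\ stable N) (is_subrep N).
Proof.
apply: (iffP forallP) => [H|[cN /stableP sN] v]; last by rewrite cN eqxx sN.
split=> [v|]; first by have /andP[/eqP] := H v.
by apply/stableP => v; have /andP[] := H v.
Qed.

Lemma is_subrep_stable V (N : subspaces V) : is_subrep N -> stable N.
Proof. by move=> /is_subrepP[]. Qed.

Definition canon V (L : fam V) : subspaces V := [ffun v => <<L v>>%MS].

Lemma canonE V (L : fam V) v : (canon L v :=: L v)%MS.
Proof. by rewrite ffunE; apply: genmxE. Qed.

Lemma stable_eqmx V (L M : fam V) : (forall v, L v :=: M v)%MS ->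
  stable L -> stable M.
Proof. by move=> LM sL v; rewrite -(push_eqmx LM) -LM; apply: sL. Qed.

Lemma is_subrep_canon V (L : fam V) : stable L -> is_subrep (canon L).
Proof.
move=> sL; apply/is_subrepP; split=> [v|]; first by rewrite !ffunE genmx_id.
by apply: stable_eqmx sL => v; apply/eqmx_sym/canonE.
Qed.

Lemma subrep_eq V (N N' : subspaces V) : is_subrep N -> is_subrep N' ->
  (forall v, N v :=: N' v)%MS -> N = N'.
Proof.
move=> /is_subrepP[cN _] /is_subrepP[cN' _] NN'; apply/ffunP => v.
by rewrite -cN -cN'; apply/genmxP/eqmxP.
Qed.

Lemma canon_id V (N : subspaces V) : is_subrep N -> canon N = N.
Proof. by move=> sN; apply/ffunP => v; rewrite ffunE; case/is_subrepP: sN => ->. Qed.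

Lemma typ_eqmx V (L L' N N' : fam V) A : (forall v, L v :=: L' v)%MS ->
  (forall v, N v :=: N' v)%MS -> typ L N A -> typ L' N' A.
Proof.
move=> LL NN tA k v; rewrite -(eqmx_rankE (NN v)) -tA.
by apply/esym/eqmx_rankE/adds_eqmx; first exact: pw_eqmx.
Qed.

Lemma hall_countE A B C : hall_count F A B C =
  #|[pred N : subspaces (Mrep F C) | [&& is_subrep N,
      `[< typ N (fzero (Mrep F C)) B >] & `[< typ (full (Mrep F C)) N A >]]]|.
Proof.
apply: eq_card => N; rewrite !inE; case sN : (is_subrep N) => //=.
have {}sN := is_subrep_stable sN.
congr (_ && _).
  apply/idP/asboolP => [/(sub_isoP _ sN)|H].
    by move/(typ_sqiso _ sN (@stable0 _ _ _)); apply=> v; apply: sub0mx.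
  apply/(sub_isoP _ sN); apply/(typ_sqiso _ sN (@stable0 _ _ _)) => // v.
  exact: sub0mx.
apply/idP/asboolP => [/quo_isoP|H].
  by move/(typ_sqiso _ (@stable_full _ _ _) sN); apply=> v; apply: submx1.
by apply/quo_isoP; apply/(typ_sqiso _ (@stable_full _ _ _) sN) => // v; apply: submx1.
Qed.

Section Subquotient.
Variables (V W : rep F n) (L L2 : fam V) (g : forall v, 'M[F]_(rdim V v, rdim W v)).
Hypotheses (sL : stable L) (L2L : fle L2 L).
Hypothesis isog : sqiso L L2 (full W) g.

(** With [qpreim], the correspondence between subrepresentations lying between L2 and L and
    subrepresentations of W. *)
Definition qimage (N : fam V) : subspaces W := [ffun v => <<N v *m g v>>%MS].
Definition qpreim (N : fam W) : subspaces V :=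
  [ffun v => <<L v :&: kermx (g v *m cokermx (N v))>>%MS].

Lemma qimageE (N : fam V) v : (qimage N v :=: N v *m g v)%MS.
Proof. by rewrite ffunE; apply: genmxE. Qed.

Lemma qpreimE (N : fam W) v :
  (qpreim N v :=: L v :&: kermx (g v *m cokermx (N v)))%MS.
Proof. by rewrite ffunE; apply: genmxE. Qed.

Lemma sub_qpreim m (N : fam W) v (X : 'M[F]_(m, _)) :
  (X <= qpreim N v)%MS = (X <= L v)%MS && (X *m g v <= N v)%MS.
Proof.
rewrite qpreimE sub_capmx; congr (_ && _); rewrite [RHS]submxE -mulmxA.
by apply/sub_kermxP/eqP.
Qed.

Lemma sub_hom m v (X : 'M[F]_(m, _)) : (X <= L v)%MS ->
  X *m g v *m rarr W v = X *m rarr V v *m g (ordS v).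
Proof.
by have [hg _ _] := isog; move=> /submxP[D ->]; rewrite -!mulmxA [L v *m _]mulmxA hg !mulmxA.
Qed.

Lemma sqiso_sub (N : fam V) : fle L2 N -> fle N L -> sqiso N L2 (qimage N) g.
Proof.
move=> L2N NL; split=> v; first exact: sub_hom.
  exact/eqmx_sym/qimageE.
have [_ _ ker_g] := isog; apply/eqmxP/andP; split.
  by rewrite -ker_g capmxS.
by rewrite sub_capmx L2N /=; apply/sub_kermxP; apply: sqiso_ker0 isog v.
Qed.

Lemma stable_qimage (N : fam V) : fle N L -> stable N -> stable (qimage N).
Proof.
move=> NL /stableP sN; apply/stableP => v.
rewrite (eqmxMr _ (qimageE _ _)) qimageE sub_hom //.
by rewrite submxMr.
Qed.

Lemma stable_qpreim (N : fam W) : stable N -> stable (qpreim N).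
Proof.
move=> /stableP sN; apply/stableP => v.
have : (qpreim N v <= qpreim N v)%MS by [].
rewrite !sub_qpreim => /andP[XL XN].
rewrite -sub_hom // (submx_trans (submxMr _ XN) (sN v)) andbT.
by apply: submx_trans (submxMr _ XL) _; move/stableP: sL; apply.
Qed.

Lemma qimageK (N : fam V) v : fle L2 N -> fle N L ->
  (qpreim (qimage N) v :=: N v)%MS.
Proof.
move=> L2N NL; apply/eqmxP/andP; split; last first.
  by rewrite sub_qpreim NL qimageE /=.
apply/row_subP => i; set x := row i _.
have : (x <= qpreim (qimage N) v)%MS by apply: row_sub.
rewrite sub_qpreim qimageE => /andP[xL /submxP[D xg]].
have -> : x = D *m N v + (x - D *m N v) by rewrite addrC subrK.
apply: addmx_sub; first exact: submxMl.
apply: submx_trans (L2N v); have [_ _ <-] := isog.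
rewrite sub_capmx addmx_sub ?eqmx_opp //=; last first.
  by apply: submx_trans (NL v); apply: submxMl.
by apply/sub_kermxP; rewrite mulmxBl xg mulmxA subrr.
Qed.

Lemma qpreimK (N : fam W) v : (qimage (qpreim N) v :=: N v)%MS.
Proof.
apply/eqmxP/andP; split.
  by have := submx_refl (qpreim N v); rewrite sub_qpreim qimageE => /andP[].
have [_ Lg _] := isog.
have /submxP[D ND] : (N v <= L v *m g v)%MS by rewrite Lg submx1.
rewrite qimageE {1}ND mulmxA submxMr // sub_qpreim submxMl /=.
by rewrite -mulmxA -ND.
Qed.

Lemma typ_qimage_sub (N : fam V) B : stable N -> fle L2 N -> fle N L ->
  typ N L2 B <-> typ (qimage N) (fzero W) B.
Proof.
move=> sN L2N NL; have H := sqiso_layers sN L2N (sqiso_sub L2N NL).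
have e k v : \rank (pw k (qimage N) v + fzero W v)%MS = \rank (pw k (qimage N) v).
  exact/eqmx_rankE/addsmx0.
split=> tB k v; last by rewrite H -e tB mxrank0.
by have := tB k v; rewrite H e mxrank0 => /eqP; rewrite eqn_add2l => /eqP.
Qed.

Lemma typ_qimage_quo (N : fam V) A : stable N -> fle L2 N -> fle N L ->
  typ L N A <-> typ (full W) (qimage N) A.
Proof.
move=> sN L2N NL.
have eN v : \rank (N v) = (\rank (L2 v) + \rank (qimage N v))%N.
  by rewrite (sqiso_rank isog L2N NL) (eqmx_rankE (qimageE _ _)).
have e k v : \rank (pw k L v + N v)%MS
    = (\rank (L2 v) + \rank (pw k (full W) v + qimage N v)%MS)%N.
  rewrite (sqiso_rank (X := fadd (pw k L) N) isog); first last.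
  - by move=> u; rewrite addsmx_sub pw_le ?NL.
  - by move=> u; apply: submx_trans (L2N u) _; apply: addsmxSr.
  congr (_ + _)%N; apply: eqmx_rankE; apply: eqmx_trans (addsmxMr _ _ _) _.
  by apply: adds_eqmx; [apply: sqiso_pw isog v|apply/eqmx_sym/qimageE].
split=> tA k v; have := tA k v; rewrite e eN; last by move=> ->; rewrite addnA.
by move/eqP; rewrite -addnA eqn_add2l => /eqP.
Qed.

End Subquotient.

(** An isomorphism of L / L2 with M(C) carries the intermediate N bijectively to the submodules of
    M(C) and preserves both types. Compositions of operators in the model are evaluated by this
    count. *)
Lemma hall_count_subquotient V (L L2 : fam V) A B C :
    stable L -> stable L2 -> fle L2 L -> typ L L2 C ->
  #|[pred N : subspaces V | [&& is_subrep N, `[< fle L2 N /\ fle N L >],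
       `[< typ N L2 B >] & `[< typ L N A >]]]| = hall_count F A B C.
Proof.
move=> sL sL2 L2L /(typ_sqiso _ sL sL2 L2L)[g isog]; rewrite hall_countE.
apply: (card_bij_in (f := fun N : subspaces V => qimage g N)
                    (h := fun N : subspaces (Mrep F C) => qpreim L g N)).
- move=> N /and4P[sN /asboolP[L2N NL] /asboolP tB /asboolP tA].
  have sN' := is_subrep_stable sN; apply/and3P; split.
  + have <- : canon (qimage g N) = qimage g N.
      by apply/ffunP => v; rewrite !ffunE genmx_id.
    exact/is_subrep_canon/(stable_qimage isog).
  + by apply/asboolP/(typ_qimage_sub isog).
  + by apply/asboolP/(typ_qimage_quo sL isog).
- move=> N /and3P[sN /asboolP tB /asboolP tA]; have sN' := is_subrep_stable sN.
  have sP := stable_qpreim sL isog sN'.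
  have NL : fle (qpreim L g N) L.
    by move=> v; have := submx_refl (qpreim L g N v); rewrite sub_qpreim => /andP[].
  have L2N : fle L2 (qpreim L g N).
    by move=> v; rewrite sub_qpreim L2L (sqiso_ker0 isog) sub0mx.
  have eN v : (N v :=: qimage g (qpreim L g N) v)%MS.
    by apply/eqmx_sym; apply: qpreimK isog N v.
  apply/and4P; split.
  + have <- : canon (qpreim L g N) = qpreim L g N.
      by apply/ffunP => v; rewrite !ffunE genmx_id.
    exact: is_subrep_canon.
  + exact/asboolP.
  + by apply/asboolP/(typ_qimage_sub isog) => //; apply: typ_eqmx tB.
  + by apply/asboolP/(typ_qimage_quo sL isog) => //; apply: typ_eqmx tA.
- move=> N /and4P[sN /asboolP[L2N NL] _ _].
  rewrite -[RHS](canon_id sN); apply/ffunP => v; rewrite [RHS]ffunE [LHS]ffunE.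
  apply/genmxP/eqmxP; apply: eqmx_trans (qimageK isog v L2N NL).
  exact/eqmx_sym/qpreimE.
- move=> N /and3P[sN _ _].
  rewrite -[RHS](canon_id sN); apply/ffunP => v; rewrite [RHS]ffunE [LHS]ffunE.
  apply/genmxP/eqmxP; apply: eqmx_trans (qpreimK isog N v).
  exact/eqmx_sym/qimageE.
Qed.

End HallCounts.

Section HallPolynomials.
Variables (n : nat) (phi : Theta n -> Theta n -> Theta n -> {poly int}).
Hypothesis hphi : is_hall_polynomials phi.
Implicit Types (A B C : Theta n) (lam : Nn n).

Lemma distinct_primes k : exists s : seq nat, [/\ uniq s, size s = k & all prime s].
Proof.
elim: k => [|k [s [us ss ps]]]; first by exists [::].
have [p sp pp] := prime_above (\max_(i <- s) i); exists (p :: s).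
split=> /=; rewrite ?ss ?pp ?us ?andbT //; apply/negP => pis.
by move: sp; rewrite ltnNge (bigD1_seq p) //= leq_maxl.
Qed.

Lemma poly_prime_values (P : {poly int}) c :
  (forall p, prime p -> P.[p%:R] = c) -> P = c%:P.
Proof.
move=> Pc; apply/eqP; rewrite -subr_eq0; apply/negPn/negP => nz.
have [s [us ss ps]] := distinct_primes (size (P - c%:P)).
have := max_poly_roots (p := P - c%:P) (rs := [seq (p%:R : int) | p <- s]) nz.
rewrite size_map ss ltnn => H; apply/notF/H.
  apply/allP => x /mapP[p /(allP ps) pp ->].
  by rewrite /root !hornerE Pc // subrr.
by rewrite map_inj_uniq // => i j /eqP; rewrite eqr_nat => /eqP.
Qed.

Lemma phi_neq0 A B C : phi A B C != 0 ->
  exists F : finFieldType, hall_count F A B C != 0%N.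
Proof.
move=> nz; apply/not_existsP => H; move/eqP: nz; apply.
apply: poly_prime_values => p pp; have := hphi A B C 'F_p.
rewrite card_Fp // => ->; have /negP := H 'F_p; rewrite negbK => /eqP -> //.
Qed.

Lemma AdiagE lam i k : Adiag lam (i, k) = if k == 0%N then lam i else 0%N.
Proof.
rewrite fsfun_fun; case: imfsetP => [[j _ [-> ->]] //|H]; case: eqP => // k0.
by case: H; exists i; rewrite ?k0.
Qed.

Lemma rA_Adiag lam k v : rA (Adiag lam) k v = if k == 0%N then lam v else 0%N.
Proof.
have rk j u : rA (Adiag lam) j.+1 u = 0%N.
  rewrite rA_sum big1 // => -[i [|l]] _; first by rewrite big_geq ?muln0.
  by rewrite AdiagE.
case: k => [|k]; last exact: rk.
rewrite rA_rec rk addn0 eA_rec AdiagE /= /eA big1 ?addn0 // => -[i [|l]] //.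
by rewrite AdiagE.
Qed.

(* B = rad A and lam = top A *)
Definition radical_of A B lam : Prop :=
  (forall k v, rA B k v = rA A k.+1 v)
  /\ (forall v, rA A 0 v = (lam v + rA A 1 v)%N).

Lemma radical_exists A : exists B lam, radical_of A B lam.
Proof.
have [K AK] := rA_large A.
have [B rB] : exists B, forall k v, rA B k v = rA A k.+1 v.
  apply: (rA_exists (K := K)) => k v.
  - by move=> Kk; rewrite AK // leqW.
  - by rewrite (rA_rec A k.+1) leq_addl.
  - by rewrite (rA_rec A k.+2) (rA_rec A k.+1) !addnK (eA_rec A k.+1) leq_addl.
exists B, [ffun v => (rA A 0 v - rA A 1 v)%N]; split=> // v.
rewrite ffunE subnK // /rA; apply: leq_trans (_ : rA A 0 v <= _)%N => //.
by apply: sub_count.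
Qed.

Lemma typ_Adiag (F : fieldType) (V : rep F n) (L N : fam V) lam :
  typ L N (Adiag lam) -> fle (push L) N.
Proof. by move=> /typ_nilp H; apply: (H 1%N) => -[|k] v _ //; rewrite rA_Adiag. Qed.

Lemma typ0 (F : fieldType) (V : rep F n) (N : fam V) B :
  typ N (fzero V) B <-> forall k v, \rank (pw k N v) = rA B k v.
Proof.
have e k v : \rank (pw k N v + fzero V v)%MS = \rank (pw k N v).
  exact/eqmx_rankE/addsmx0.
by split=> H k v; have := H k v; rewrite e mxrank0.
Qed.

(** A submodule with semisimple quotient contains the radical of M(C), hence each power of that
    radical is bounded by the layers of B = rad A. These inequalities are the order for which C is
    smaller than A in [theta_generation]. *)
Lemma phi_radical_supp A B lam C : radical_of A B lam ->
    phi (Adiag lam) B C != 0 ->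
  (forall k v, rA C k v <= rA A k v)%N /\ (forall v, rA C 0 v = rA A 0 v).
Proof.
move=> [rB rlam] /phi_neq0[F]; rewrite hall_countE -lt0n => /card_gt0P[N].
move=> /and3P[sN /asboolP/typ0 tB /asboolP tA].
have TN := typ_Adiag tA.
have C0 v : rA C 0 v = rA A 0 v.
  have := tA 0%N v; rewrite rA_Adiag (eqmx_rankE (addsmx_idPl _)) ?submx1 //=.
  rewrite -(rank_pw_full F) => ->; rewrite rlam addnC -rB -tB /=.
  by [].
split=> // -[|k] v; first by rewrite C0.
rewrite -(rank_pw_full F) -rB -tB iterSr; apply: mxrankS.
by apply: pw_mono.
Qed.

(** The only submodule counted is the radical of M(A): it is contained in any N with semisimple
    quotient, and here it has the same rank as N. *)
Lemma phi_radical A B lam : radical_of A B lam -> phi (Adiag lam) B A = 1.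
Proof.
move=> [rB rlam]; apply: poly_prime_values => p pp.
have := hphi (Adiag lam) B A 'F_p; rewrite card_Fp // => ->.
rewrite hall_countE; set V := Mrep 'F_p A.
have sT : stable (push (full V)) by apply: (stable_pw 1); apply: stable_full.
apply/eqP; rewrite (_ : 1 = 1%:R) // eqr_nat; apply/eqP.
rewrite -(card1 (canon (push (full V)))); apply: eq_card => N.
rewrite !inE; apply/and3P/eqP => [[sN /asboolP/typ0 tB /asboolP tA]|->].
  rewrite -(canon_id sN); apply: subrep_eq; rewrite ?is_subrep_canon //.
    exact: is_subrep_stable.
  move=> v; apply: eqmx_trans (canonE _ _) _.
  apply: eqmx_trans _ (eqmx_sym (canonE _ _)).
  apply: eqmx_sym; apply/eqmxP; rewrite -(geq_leqif (mxrank_leqif_eq _)).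
    have := tB 0%N v; rewrite /= => ->.
    by rewrite rB -(rank_pw_full 'F_p).
  exact: typ_Adiag tA v.
have eT v := canonE (push (full V)) v.
split; first exact: is_subrep_canon.
  apply/asboolP; apply: typ_eqmx (fun v => eqmx_sym (eT v)) (fun v => eqmx_refl _) _.
  by apply/typ0 => k v; rewrite rB -iterSr rank_pw_full.
apply/asboolP; apply: typ_eqmx (fun v => eqmx_refl _) (fun v => eqmx_sym (eT v)) _.
move=> k v; rewrite rA_Adiag; case: k => [|k] /=.
  rewrite (eqmx_rankE (addsmx_idPl _)) ?submx1 //.
  by have := rlam v; rewrite -!(rank_pw_full 'F_p) /= addnC.
rewrite addn0; apply/eqmx_rankE/addsmx_idPr.
by apply: (pw_anti (j := 1) (k := k.+1) (@stable_full _ _ V)).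
Qed.

End HallPolynomials.

(** * Gaussian binomial coefficients and the commutation relation *)

Section GaussianCoefficients.
Variables (K : fieldType) (q : K).
Hypotheses (q0 : q != 0) (q_inf : forall k, (0 < k)%N -> q ^+ k != 1).

(** For a prime power q, [ff (q ^+ m) k] counts the injective linear maps from a k-dimensional to an
    m-dimensional space, and [gl k] is the order of GL_k. Keeping y free allows negative
    exponents. *)
Definition ff (y : K) k := \prod_(s < k) (y - q ^+ s).
Definition gl k := ff (q ^+ k) k.
(* gauss (q ^ m) k is the Gaussian binomial coefficient of m over k *)
Definition gauss y k := ff y k / gl k.

Lemma ffS y k : ff y k.+1 = ff y k * (y - q ^+ k).
Proof. by rewrite /ff big_ord_recr. Qed.

Lemma ff0 y : ff y 0 = 1. Proof. by rewrite /ff big_ord0. Qed.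

Lemma gl0 : gl 0 = 1.
Proof. by rewrite /gl ff0. Qed.

Lemma ff_eq0 c d : (c < d)%N -> ff (q ^+ c) d = 0.
Proof. by move=> cd; rewrite /ff (bigD1 (Ordinal cd)) //= subrr mul0r. Qed.

Lemma ff_shift y k : ff (q * y) k.+1 = (q * y - 1) * q ^+ k * ff y k.
Proof.
elim: k => [|k IH]; first by rewrite ffS !ff0 expr0 !mulr1 mul1r.
by rewrite ffS IH ffS !exprS; ring.
Qed.

Lemma glS k : gl k.+1 = (q ^+ k.+1 - 1) * q ^+ k * gl k.
Proof. by rewrite /gl exprS ff_shift. Qed.

Lemma gl_neq0 k : gl k != 0.
Proof.
elim: k => [|k IH]; first by rewrite /gl ff0 oner_neq0.
by rewrite glS !mulf_neq0 ?expf_neq0 ?subr_eq0 ?q_inf.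
Qed.

Lemma gauss0 y : gauss y 0 = 1.
Proof. by rewrite /gauss /gl !ff0 divr1. Qed.

Lemma gauss_eq0 c d : (c < d)%N -> gauss (q ^+ c) d = 0.
Proof. by move=> cd; rewrite /gauss ff_eq0 ?mul0r. Qed.

Lemma gaussS y j :
  gauss y j.+1 = gauss y j * (y - q ^+ j) / (q ^+ j * (q ^+ j.+1 - 1)).
Proof.
have g := gl_neq0 j; have g' := gl_neq0 j.+1.
have qj : q ^+ j.+1 - 1 != 0 by rewrite subr_eq0 q_inf.
have qj' : q ^+ j != 0 by rewrite expf_neq0.
rewrite /gauss ffS glS; move: (q ^+ j.+1) (q ^+ j) (gl j) qj qj' g => a b c.
by move=> *; field; do !(apply/andP; split).
Qed.

Lemma gauss_shift y j :
  gauss (q * y) j.+1 = gauss y j * (q * y - 1) / (q ^+ j.+1 - 1).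
Proof.
have g := gl_neq0 j; have g' := gl_neq0 j.+1.
have qj : q ^+ j.+1 - 1 != 0 by rewrite subr_eq0 q_inf.
have qj' : q ^+ j != 0 by rewrite expf_neq0.
rewrite /gauss ff_shift glS; move: (q ^+ j.+1) (q ^+ j) (gl j) qj qj' g => a b c.
by move=> *; field; do !(apply/andP; split).
Qed.

Lemma gauss_pascal y j :
  gauss (q * y) j.+1 = gauss y j + q ^+ j.+1 * gauss y j.+1.
Proof.
have qj : q ^+ j.+1 - 1 != 0 by rewrite subr_eq0 q_inf.
have qj' : q ^+ j != 0 by rewrite expf_neq0.
rewrite gauss_shift gaussS exprS in qj *.
by move: (q ^+ j) (gauss y j) qj qj' => a b *; field; apply/andP.
Qed.

Lemma ffD y d j : ff y (d + j) = q ^+ (d * j) * (ff y d * ff (y / q ^+ d) j).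
Proof.
elim: j => [|j IH]; first by rewrite addn0 muln0 ff0 mul1r mulr1.
rewrite addnS !ffS IH mulnS !exprD.
have qd : q ^+ d != 0 by rewrite expf_neq0.
by move: (q ^+ (d * j)) (ff y d) (q ^+ j) => a b c; field.
Qed.

Lemma ff_sym y d j : ff y d * ff (y / q ^+ d) j = ff y j * ff (y / q ^+ j) d.
Proof.
apply: (mulfI (_ : q ^+ (d * j) != 0)); first by rewrite expf_neq0.
by rewrite -ffD mulnC addnC ffD.
Qed.

(** Both sides are the Gaussian trinomial coefficient with parts d, j and c - d - j, or zero when d
    + j exceeds c. *)
Lemma gauss_sym c d j :
  gauss (q ^+ c) d * gauss (q ^+ (c - d)) j
  = gauss (q ^+ c) j * gauss (q ^+ (c - j)) d.
Proof.
have [cdj|cdj] := ltnP c (d + j).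
  have z a b : (c < a + b)%N -> gauss (q ^+ c) a * gauss (q ^+ (c - a)) b = 0.
    move=> cab; have [ca|ac] := ltnP c a; first by rewrite gauss_eq0 ?mul0r.
    by rewrite (gauss_eq0 (c := c - a)) ?mulr0 // ltn_subLR.
  by rewrite !z // addnC.
have sq a : (a <= c)%N -> q ^+ (c - a) = q ^+ c / q ^+ a.
  by move=> ac; rewrite -{2}(subnK ac) exprD mulfK // expf_neq0.
have dc : (d <= c)%N := leq_trans (leq_addr _ _) cdj.
have jc : (j <= c)%N := leq_trans (leq_addl _ _) cdj.
rewrite /gauss !sq // !mulf_div [gl j * _]mulrC; congr (_ / _); exact: ff_sym.
Qed.

(** Trades the denominators occurring in [wtA] and [wtB] for a Gaussian coefficient over [gl c],
    which does not depend on d. *)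
Lemma gl_split c d : (d <= c)%N ->
  (gl (c - d))^-1 / gl d / q ^+ ((c - d) * d) = gauss (q ^+ c) d / gl c.
Proof.
move=> dc; have e : gl c = q ^+ ((c - d) * d) * (ff (q ^+ c) d * gl (c - d)).
  have sq : q ^+ (c - d) = q ^+ c / q ^+ d.
    by rewrite -{2}(subnK dc) exprD mulfK // expf_neq0.
  by rewrite /gl sq mulnC -ffD subnKC.
have g := gl_neq0 c; have g1 := gl_neq0 d; have g2 := gl_neq0 (c - d).
have q' : q ^+ ((c - d) * d) != 0 by rewrite expf_neq0.
have f1 : ff (q ^+ c) d != 0.
  by apply: contraNneq g => f1; rewrite e f1 mul0r mulr0.
rewrite /gauss e; move: (gl d) (gl (c - d)) (q ^+ _) (ff _ _) g1 g2 q' f1 => a b x y.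
by move=> *; field; do !(apply/andP; split).
Qed.

(** This counts linear maps from an e-dimensional space to one with X elements by their rank j: a
    Gaussian coefficient for the kernel, then [ff X j] injections of the quotient. The bound M gives
    all such expansions a common index range. *)
Lemma expr_gauss X e M : (e < M)%N ->
  X ^+ e = \sum_(j < M) gauss (q ^+ e) j * ff X j.
Proof.
have trunc e' M' : (e' < M')%N ->
    \sum_(j < M') gauss (q ^+ e') j * ff X j
    = \sum_(j < e'.+1) gauss (q ^+ e') j * ff X j.
  move=> eM; rewrite -(subnKC eM) big_split_ord /= [X in _ + X]big1 ?addr0 //.
  by move=> i _; rewrite gauss_eq0 ?mul0r // addSn ltnS leq_addr.
move=> eM; rewrite trunc //; elim: e {M eM} => [|e IH].
  by rewrite big_ord_recl big_ord0 gauss0 ff0 mulr1 addr0.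
rewrite big_ord_recl gauss0 ff0 mulr1.
under eq_bigr => j _ do rewrite lift0 exprS gauss_pascal ffS mulrDl.
rewrite big_split /= exprSr IH mulr_suml.
have -> : \sum_(j < e.+1) q ^+ j.+1 * gauss (q ^+ e) j.+1 * (ff X j * (X - q ^+ j))
          = \sum_(j < e.+1) q ^+ j * (gauss (q ^+ e) j * ff X j) - 1.
  rewrite big_ord_recr /= gauss_eq0 // mulr0 mul0r addr0.
  rewrite [in RHS]big_ord_recl gauss0 ff0 !mulr1 expr0 [1 + _]addrC addrK.
  by apply: eq_bigr => j _; rewrite -ffS lift0 mulrA.
have e1 (a b : K) : 1 + (a + (b - 1)) = a + b by ring.
rewrite e1.
rewrite -big_split /=; apply: eq_bigr => j _; by ring.
Qed.

End GaussianCoefficients.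

Section Boxes.
Variable n : nat.
Implicit Types (mu b c beta : Nn n).

Definition vle b c := [forall i, (b i <= c i)%N].
Definition vadd b c : Nn n := [ffun i => (b i + c i)%N].
Definition vsub b c : Nn n := [ffun i => (b i - c i)%N].
Definition vsum c : nat := \sum_i c i.

Definition box mu : seq (Nn n) :=
  [seq below_vec a | a <- enum {: {dffun forall i : 'I_n, 'I_(mu i).+1}}].

Lemma mem_box mu b : (b \in box mu) = vle b mu.
Proof.
apply/mapP/forallP => [[a _ ->] i|H]; first by rewrite ffunE -ltnS.
exists [ffun i => inord (b i)]; first by rewrite mem_enum.
by apply/ffunP => i; rewrite !ffunE inordK // ltnS.
Qed.

Lemma uniq_box mu : uniq (box mu).
Proof.
rewrite map_inj_uniq ?enum_uniq // => a a' /ffunP aa; apply/ffunP => i.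
by apply: val_inj; have := aa i; rewrite !ffunE.
Qed.

Lemma vle_refl c : vle c c. Proof. by apply/forallP. Qed.

Lemma vle_trans a b c : vle a b -> vle b c -> vle a c.
Proof.
move=> /forallP ab /forallP bc; apply/forallP => i.
exact: leq_trans (ab i) (bc i).
Qed.

Lemma vsum_lt b c : vle b c -> b != c -> (vsum b < vsum c)%N.
Proof.
move=> /forallP bc ne; have [i bci] : exists i, b i != c i.
  apply/existsP; apply: contraNT ne => /existsPn H; apply/eqP/ffunP => i.
  by apply/eqP; have := H i; rewrite negbK.
rewrite /vsum (bigD1 i) // [X in (_ < X)%N](bigD1 i) //=.
by rewrite -addSn leq_add ?leq_sum // ltn_neqAle bci bc.
Qed.

Lemma vsum_le b c : vle b c -> (vsum b <= vsum c)%N.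
Proof. by move=> /forallP bc; apply: leq_sum => i _. Qed.

Section Sums.
Variable (R : nmodType).
Implicit Type (f : Nn n -> R).

(** A bound M common to all coordinates turns the index set into a function type, as needed to
    expand a product of sums. *)
Lemma sum_box M mu f : (forall i, mu i < M)%N ->
  \sum_(b <- box mu) f b
  = \sum_(d : {ffun 'I_n -> 'I_M} | [forall i, (d i <= mu i)%N])
      f [ffun i => val (d i)].
Proof.
move=> muM; rewrite -[RHS]big_filter -[RHS](big_map (fun d : {ffun 'I_n -> 'I_M} =>
  [ffun i => val (d i)] : Nn n) xpredT f); apply: perm_big.
apply: uniq_perm; first exact: uniq_box.
  rewrite map_inj_uniq ?filter_uniq ?index_enum_uniq // => d d' /ffunP dd.
  by apply/ffunP => i; apply: val_inj; have := dd i; rewrite !ffunE.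
move=> b; rewrite mem_box; apply/idP/mapP => [/forallP bmu|[d]]; last first.
  rewrite mem_filter => /andP[/forallP H _] ->; apply/forallP => i.
  by rewrite ffunE; apply: H.
exists [ffun i => Ordinal (leq_ltn_trans (bmu i) (muM i))].
  rewrite mem_filter mem_index_enum andbT; apply/forallP => i.
  by rewrite ffunE; apply: bmu.
by apply/ffunP => i; rewrite !ffunE.
Qed.

Lemma sum_box_shift b mu f : vle b mu ->
  \sum_(c <- box mu | vle b c) f c = \sum_(d <- box (vsub mu b)) f (vadd b d).
Proof.
move=> /forallP bmu; rewrite -big_filter -[RHS](big_map (vadd b) xpredT f).
apply: perm_big; apply: uniq_perm; first exact/filter_uniq/uniq_box.
  rewrite map_inj_uniq ?uniq_box // => d d' /ffunP dd; apply/ffunP => i.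
  by have := dd i; rewrite !ffunE => /addnI.
move=> c; rewrite mem_filter mem_box; apply/andP/mapP.
  move=> [/forallP bc /forallP cmu]; exists (vsub c b).
    by rewrite mem_box; apply/forallP => i; rewrite !ffunE leq_sub2r.
  by apply/ffunP => i; rewrite !ffunE subnKC.
move=> [d]; rewrite mem_box => /forallP H ->; split; apply/forallP => i.
  by rewrite ffunE leq_addr.
by have := H i; rewrite !ffunE leq_subRL.
Qed.

End Sums.
End Boxes.

Section CyclicIdentity.
Variables (K : fieldType) (q : K) (n : nat).
Hypotheses (q0 : q != 0) (q_inf : forall k, (0 < k)%N -> q ^+ k != 1).
Notation ff := (ff q).
Notation gl := (gl q).
Notation gauss := (gauss q).

Lemma prod_ordS (f : 'I_n -> K) : \prod_i f (ordS i) = \prod_i f i.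
Proof. by rewrite [RHS](reindex_inj (can_inj (@ordSK n))). Qed.

(* Expanding the powers by expr_gauss turns both sides into the same sum, the *)
(* summation variables of the expansion exchanging their role with d.         *)
Lemma cyclic_identity M (c : 'I_n -> nat) (y : 'I_n -> K) :
    (forall i, c i < M)%N ->
  \sum_(d : {ffun 'I_n -> 'I_M}) \prod_i
     (gauss (q ^+ c i) (d i) * ff (y i) (d i)
      * (y (ord_pred i) / q ^+ d (ord_pred i)) ^+ (c i - d i))
  = \sum_(d : {ffun 'I_n -> 'I_M}) \prod_i
     (gauss (q ^+ c i) (d i) * ff (y (ord_pred i)) (d i)
      * (y i / q ^+ d (ordS i)) ^+ (c i - d i)).
Proof.
move=> cM.
have expand (a X : 'I_n -> K) (d : {ffun 'I_n -> 'I_M}) :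
    \prod_i (gauss (q ^+ c i) (d i) * a i * X i ^+ (c i - d i))
    = \sum_(j : {ffun 'I_n -> 'I_M})
        (\prod_i (gauss (q ^+ c i) (d i) * gauss (q ^+ (c i - d i)) (j i)))
        * \prod_i (a i * ff (X i) (j i)).
  under eq_bigr => i _.
    rewrite (expr_gauss q0 q_inf (X i) (leq_ltn_trans (leq_subr (d i) _) (cM i))).
    rewrite mulr_sumr; over.
  rewrite bigA_distr_bigA; apply: eq_bigr => j _; rewrite -big_split /=.
  by apply: eq_bigr => i _; rewrite mulrACA.
under eq_bigr => d _ do rewrite expand.
under [RHS]eq_bigr => d _ do rewrite expand.
rewrite exchange_big /=; apply: eq_bigr => j _; apply: eq_bigr => d _.
congr (_ * _); first by apply: eq_bigr => i _; apply: gauss_sym.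
rewrite !big_split /=.
have -> : \prod_i ff (y (ord_pred i) / q ^+ d (ord_pred i)) (j i)
          = \prod_i ff (y i / q ^+ d i) (j (ordS i)).
  by rewrite -prod_ordS; apply: eq_bigr => i _; rewrite ordSK.
have -> : \prod_i ff (y (ord_pred i)) (j i) = \prod_i ff (y i) (j (ordS i)).
  by rewrite -prod_ordS; apply: eq_bigr => i _; rewrite ordSK.
by rewrite -!big_split; apply: eq_bigr => i _; apply: ff_sym.
Qed.

Implicit Types (mu b c beta : Nn n) (t : Zn n).

(** What remains of the coefficients of the commutation relation after rescaling: [wtA] belongs to
    the products u^- u^+ and [wtB] to u^+ u^-, see [coefL_wtA] and [coefR_wtB]. *)
Definition wtA t mu beta : K := \prod_i ((gl (mu i - beta i))^-1
  * q ^ ((mu i - beta i)%N%:Z * (t i - (beta i)%:Z - (beta (ord_pred i))%:Z))).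
Definition wtB t mu beta : K := \prod_i ((gl (mu i - beta i))^-1
  * q ^ ((mu i - beta i)%N%:Z * (t (ordS i) - (beta i)%:Z - (beta (ordS i))%:Z))).

(** In the model the exponent is the dimension, at one vertex, of the interval in which the
    intermediate subrepresentation varies, see [qexp_above] and [qexp_below]. *)
Definition qexp t b i : K :=
  q ^ (t (ordS i) - (b (ordS i))%:Z - (b i)%:Z).

(** The case c = mu - b of [cyclic_identity], with summation variable d = beta - b and y =
    [qexp t b]. It provides a scalar solution of [qrel] for each b. *)
Lemma gauss_identity t mu b : vle b mu ->
  \sum_(beta <- box mu | vle b beta)
     wtA t mu beta * \prod_i gauss (qexp t b i) (beta i - b i)
  = \sum_(beta <- box mu | vle b beta)
     wtB t mu beta * \prod_i gauss (qexp t b (ord_pred i)) (beta i - b i).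
Proof.
move=> bmu; rewrite !sum_box_shift //; set c := vsub mu b.
pose M := (\max_i c i).+1; have cM i : (c i < M)%N by rewrite ltnS leq_bigmax.
rewrite !(sum_box _ cM); pose g := \prod_i (gl (c i))^-1.
(* By [gl_split] each summand takes the shape required by [cyclic_identity], up to the constant g;
   the condition d <= c may be dropped since the Gaussian coefficient vanishes beyond it. *)
have term (y : 'I_n -> K) (X : {ffun 'I_n -> 'I_M} -> 'I_n -> int) :
    \sum_(d : {ffun 'I_n -> 'I_M} | [forall i, (d i <= c i)%N])
      (\prod_i ((gl (c i - d i))^-1
          * q ^ ((c i - d i)%N%:Z * (X d i - (d i)%:Z))))
      * \prod_i gauss (y i) (d i)
    = g * \sum_(d : {ffun 'I_n -> 'I_M}) \prod_i
     (gauss (q ^+ c i) (d i) * ff (y i) (d i) * (q ^ X d i) ^+ (c i - d i)).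
  rewrite mulr_sumr big_mkcond; apply: eq_bigr => d _; case: ifPn => [/forallP dc|].
    rewrite -!big_split /=; apply: eq_bigr => i _.
    have := gl_split q0 q_inf (dc i).
    have -> : q ^ ((c i - d i)%N%:Z * (X d i - (d i)%:Z))
        = (q ^ X d i) ^+ (c i - d i) / q ^+ ((c i - d i) * d i).
      rewrite mulrBr expfzDr // -invr_expz -PoszM -exprnP; congr (_ / _).
      by rewrite mulrC -exprz_exp.
    rewrite /gauss; move: (q ^+ (_ * _)) (_ ^+ (c i - d i)) => a x e.
    transitivity ((gl (c i - d i))^-1 / gl (d i) / a * x * ff (y i) (d i)).
      by ring.
    by rewrite e; ring.
  move=> /forallPn[i]; rewrite -ltnNge => ci.
  by rewrite (bigD1 i) //= gauss_eq0 // !mul0r mulr0.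
have qsub (a : int) k : q ^ (a - k%:Z) = q ^ a / q ^+ k.
  by rewrite expfzDr // -invr_expz.
transitivity (\sum_(d : {ffun 'I_n -> 'I_M} | [forall i, (d i <= c i)%N])
   (\prod_i ((gl (c i - d i))^-1 * q ^ ((c i - d i)%N%:Z
      * ((t i - (b i)%:Z - (b (ord_pred i))%:Z - (d (ord_pred i))%:Z) - (d i)%:Z))))
   * \prod_i gauss (qexp t b i) (d i)).
  apply: eq_bigr => d _; congr (_ * _); apply: eq_bigr => i _; rewrite !ffunE.
    by rewrite subnDA !PoszD; congr (_ * q ^ (_ * _)); ring.
  by rewrite addKn.
transitivity (\sum_(d : {ffun 'I_n -> 'I_M} | [forall i, (d i <= c i)%N])
   (\prod_i ((gl (c i - d i))^-1 * q ^ ((c i - d i)%N%:Z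
      * ((t (ordS i) - (b (ordS i))%:Z - (b i)%:Z - (d (ordS i))%:Z) - (d i)%:Z))))
   * \prod_i gauss (qexp t b (ord_pred i)) (d i)); last first.
  apply: eq_bigr => d _; congr (_ * _); apply: eq_bigr => i _; rewrite !ffunE.
    by rewrite subnDA !PoszD; congr (_ * q ^ (_ * _)); ring.
  by rewrite addKn.
rewrite (term (qexp t b) (fun d i =>
  t i - (b i)%:Z - (b (ord_pred i))%:Z - (d (ord_pred i))%:Z)).
rewrite (term (fun i => qexp t b (ord_pred i)) (fun d i =>
  t (ordS i) - (b (ordS i))%:Z - (b i)%:Z - (d (ordS i))%:Z)).
have := cyclic_identity (qexp t b) cM.
under eq_bigr => d _ do under eq_bigr => i _ do
  rewrite {2}/qexp ord_predK -qsub.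
under [RHS]eq_bigr => d _ do under eq_bigr => i _ do
  rewrite {2}/qexp -qsub.
by move=> ->.
Qed.

Section Inversion.
Variable t : Zn n.

(* Relation (5), once the generators are rescaled, see rel5_qrel. *)
Definition qrel (M : lmodType K) (X Y : Nn n -> M) : Prop :=
  forall mu, \sum_(beta <- box mu) wtA t mu beta *: X beta
           = \sum_(beta <- box mu) wtB t mu beta *: Y beta.

Lemma wtA_diag mu : wtA t mu mu = 1.
Proof. by rewrite /wtA big1 // => i _; rewrite subnn mul0r expr0z gl0 invr1 mulr1. Qed.

(** The diagonal coefficient [wtA t mu mu] is 1, so X mu is isolated and the smaller X beta are
    eliminated by induction. The coefficients z are chosen before the module, which is what permits
    testing them on scalar solutions. *)
Lemma qrel_solve mu : exists z : Nn n -> K,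
  (forall g, ~~ vle g mu -> z g = 0) /\
  forall (M : lmodType K) (X Y : Nn n -> M), qrel X Y ->
    X mu = \sum_(g <- box mu) z g *: Y g.
Proof.
have [k] := ubnP (vsum mu); elim: k mu => // k IH mu muk.
have /choice[z Hz] : forall beta, exists zb : Nn n -> K,
    vle beta mu -> beta != mu -> (forall g, ~~ vle g beta -> zb g = 0) /\
    forall (M : lmodType K) (X Y : Nn n -> M), qrel X Y ->
      X beta = \sum_(g <- box beta) zb g *: Y g.
  move=> beta.
  have [bm|nbm] := boolP (vle beta mu); last by exists (fun=> 0).
  have [->|ne] := eqVneq beta mu; first by exists (fun=> 0).
  have [zb Hzb] := IH beta (leq_trans (vsum_lt bm ne) muk).
  by exists zb.
exists (fun g => if vle g mu then wtB t mu g
   - \sum_(beta <- box mu | beta != mu) wtA t mu beta * z beta g else 0).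
split=> [g /negbTE -> //|M X Y XY].
have := XY mu; rewrite (bigD1_seq mu) ?uniq_box ?mem_box ?vle_refl //=.
rewrite wtA_diag scale1r.
move/(canRL (addrK _)) => ->.
have -> : \sum_(beta <- box mu | beta != mu) wtA t mu beta *: X beta
  = \sum_(g <- box mu) (\sum_(beta <- box mu | beta != mu) wtA t mu beta * z beta g) *: Y g.
  under [RHS]eq_bigr => g _ do rewrite scaler_suml.
  rewrite exchange_big /= [LHS]big_seq_cond [RHS]big_seq_cond.
  apply: eq_bigr => beta /andP[]; rewrite mem_box => bm ne.
  have [z0 /(_ M X Y XY) ->] := Hz beta bm ne.
  rewrite scaler_sumr.
  rewrite [RHS](bigID (fun g => vle g beta)) /= [X in _ + X]big1 ?addr0; last first.
    by move=> g /z0 ->; rewrite mulr0 scale0r.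
  rewrite -[RHS]big_filter; under [RHS]eq_bigr do rewrite -scalerA.
  apply: perm_big; apply: uniq_perm; rewrite ?filter_uniq ?uniq_box // => g.
  rewrite mem_filter !mem_box; case: (boolP (vle g beta)) => //= gb.
  by rewrite (vle_trans gb bm).
rewrite -sumrB big_seq [RHS]big_seq; apply: eq_bigr => g.
by rewrite mem_box => ->; rewrite scalerBl.
Qed.

(* The functionals of gauss_identity take unitriangular values on the Y g. *)
Lemma qrel_solution_in (L : {pred K}) (mu : Nn n) (z : Nn n -> K) :
    subring_closed L ->
    (forall (m : int) k, gauss (q ^ m) k \in L) ->
    (forall (M : lmodType K) (X Y : Nn n -> M), qrel X Y ->
       X mu = \sum_(g <- box mu) z g *: Y g) ->
  forall b, vle b mu -> z b \in L.
Proof.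
move=> [L1 LB LM] gL sol.
have L0 : 0 \in L by rewrite -(subrr 1) LB.
have LD x y : x \in L -> y \in L -> x + y \in L.
  by move=> xL yL; rewrite -[y]opprK LB // -[- y]add0r LB.
pose Xb b beta : K^o := if vle b beta then \prod_i gauss (qexp t b i) (beta i - b i) else 0.
pose Yb b beta : K^o :=
  if vle b beta then \prod_i gauss (qexp t b (ord_pred i)) (beta i - b i) else 0.
have rel b : qrel (Xb b) (Yb b).
  move=> nu; have [bnu|nb] := boolP (vle b nu).
    have := gauss_identity t bnu; rewrite [LHS]big_mkcond [RHS]big_mkcond /= => e.
    transitivity (\sum_(beta <- box nu) if vle b beta then
        wtA t nu beta * \prod_i gauss (qexp t b i) (beta i - b i) else 0).
      by apply: eq_bigr => beta _; rewrite /Xb; case: ifP => _; rewrite ?scaler0.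
    rewrite e; symmetry.
    transitivity (\sum_(beta <- box nu) if vle b beta then
        wtB t nu beta * \prod_i gauss (qexp t b (ord_pred i)) (beta i - b i) else 0).
      by apply: eq_bigr => beta _; rewrite /Yb; case: ifP => _; rewrite ?scaler0.
    by [].
  have nb' beta : beta \in box nu -> vle b beta = false.
    by rewrite mem_box => bn; apply: contraNF nb => /vle_trans; apply.
  rewrite [LHS]big_seq [RHS]big_seq; apply: eq_bigr => beta /nb' e.
  by rewrite /Xb /Yb e !scaler0.
have prodL (f : 'I_n -> K) : (forall i, f i \in L) -> \prod_i f i \in L.
  by move=> fL; apply: (big_ind (fun x => x \in L)) => // x y; apply: LM.
have YL b beta : Yb b beta \in L.
  by rewrite /Yb; case: ifP => // _; apply: prodL => i; apply: gL.
have XL b beta : Xb b beta \in L.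
  by rewrite /Xb; case: ifP => // _; apply: prodL => i; apply: gL.
(* Since [Yb b] vanishes unless b <= g, the solution attached to b expresses z b through the z g
   with g strictly above b; hence the induction descends from mu. *)
move=> b bmu; have [k] := ubnP (vsum mu - vsum b).
elim: k b bmu => // k IH b bmu bk.
have := sol _ _ _ (rel b); rewrite (bigD1_seq b) ?uniq_box ?mem_box //=.
have -> : Yb b b = 1.
  by rewrite /Yb vle_refl big1 // => i _; rewrite subnn gauss0.
rewrite [_ *: _]mulr1 => /(canLR (addrK _)) <-; apply: LB => //.
rewrite big_seq_cond; apply: (big_ind (fun x => x \in L)) => // g /andP[]; rewrite mem_box => gmu gb.
have [bg|nbg] := boolP (vle b g); last first.
  by rewrite /Yb (negbTE nbg) scaler0.
apply: LM => //; apply: IH => //.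
have := vsum_lt bg; rewrite eq_sym => /(_ gb); have := vsum_le gmu; lia.
Qed.

End Inversion.
End CyclicIdentity.

(** * The commutation relation as a rescaled triangular system *)

Section Gaps.
Variable n : nat.
Implicit Types (lam mu a b : Nn n) (tau : Zn n).

Lemma prod_exprz (K : fieldType) (x : K) (f : 'I_n -> int) : x != 0 ->
  \prod_i x ^ f i = x ^ (\sum_i f i).
Proof.
by move=> x0; apply/esym/(big_morph (fun z => x ^ z)) => // a b; rewrite expfzDr.
Qed.

Lemma sum_ordS (R : nmodType) (f : 'I_n -> R) : \sum_i f (ordS i) = \sum_i f i.
Proof. by rewrite [RHS](reindex_inj (can_inj (@ordSK n))). Qed.

(** In the commutation relation alpha - beta = lambda - mu =: tau for all summands, so alpha is the
    vector [gapv tau b] = b + tau. Fixing tau and varying mu gives one system of equations. The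
    absolute value in [gapv] is harmless where [gap_nonneg] holds. *)
Definition gap_nonneg tau b := [forall i, 0 <= (b i)%:Z + tau i].
Definition gapv tau b : Nn n := [ffun i => absz ((b i)%:Z + tau i)].

Lemma gapvE tau b i : gap_nonneg tau b -> (gapv tau b i)%:Z = (b i)%:Z + tau i.
Proof. by move=> /forallP H; rewrite ffunE gez0_abs. Qed.

Lemma gap_nonneg_box tau mu b : gap_nonneg tau mu -> vle b mu ->
  gap_nonneg tau b = vle (vsub mu b) (gapv tau mu).
Proof.
move=> nt /forallP bm; apply: eq_forallb => i; rewrite !ffunE.
have := forallP nt i; have := bm i; lia.
Qed.

Lemma gapv_box tau mu b : gap_nonneg tau mu -> vle b mu -> gap_nonneg tau b ->
  gapv tau b = vsub (gapv tau mu) (vsub mu b).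
Proof.
move=> nt /forallP bm nb; apply/ffunP => i; rewrite !ffunE.
have := forallP nt i; have := bm i; have := forallP nb i; lia.
Qed.

Lemma sum_same_gap (R : nmodType) lam mu (f : Nn n -> Nn n -> R) :
  \sum_(ab : {dffun forall i : 'I_n, 'I_(lam i).+1}
             * {dffun forall i : 'I_n, 'I_(mu i).+1} | same_gap ab)
     f (below_vec ab.1) (below_vec ab.2)
  = \sum_(b <- box mu | vle (vsub mu b) lam) f (vsub lam (vsub mu b)) b.
Proof.
pose h ab : Nn n * Nn n := (@below_vec n lam ab.1, @below_vec n mu ab.2).
rewrite -[LHS]big_filter -[LHS](big_map h xpredT (fun p => f p.1 p.2)).
rewrite -[RHS]big_filter -[RHS](big_map (fun b => (vsub lam (vsub mu b), b)) xpredT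
   (fun p => f p.1 p.2)).
apply: perm_big; apply: uniq_perm.
- rewrite map_inj_uniq ?filter_uniq ?index_enum_uniq // => -[x y] [x' y'] [/ffunP e1 /ffunP e2].
  congr (_, _); apply/ffunP => i; apply: val_inj.
    by have := e1 i; rewrite !ffunE.
  by have := e2 i; rewrite !ffunE.
- rewrite map_inj_uniq ?filter_uniq ?uniq_box // => b b' [] _ //.
move=> [a b]; apply/mapP/mapP => [[[x y]]|[b']].
  rewrite mem_filter /= => /andP[/forallP gap _] [-> ->].
  have xl i : (x i <= lam i)%N by rewrite -ltnS.
  have yl i : (y i <= mu i)%N by rewrite -ltnS.
  exists (below_vec y).
    rewrite mem_filter mem_box; apply/andP; split; apply/forallP => i.
      by rewrite !ffunE -(eqP (gap i)) leq_subr.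
    by rewrite ffunE.
  congr (_, _); apply/ffunP => i; rewrite !ffunE -(eqP (gap i)).
  by rewrite subKn.
rewrite mem_filter mem_box => /andP[/forallP gl /forallP bm] [-> ->].
exists ([ffun i => inord (lam i - (mu i - b' i))], [ffun i => inord (b' i)]).
  rewrite mem_filter mem_index_enum andbT; apply/forallP => i /=; rewrite !ffunE.
  rewrite !inordK ?ltnS ?leq_subr //.
  by rewrite subKn //; have := gl i; rewrite ffunE.
congr (_, _); apply/ffunP => i; rewrite !ffunE inordK ?ltnS //.
by rewrite leq_subr.
Qed.

End Gaps.

Section RescaledCommutation.
Variables (K : fieldType) (v : K) (n : nat).
Hypotheses (v0 : v != 0) (v_inf : forall k, (0 < k)%N -> (v ^+ 2) ^+ k != 1).
Implicit Types (lam mu a b : Nn n) (l t tau : Zn n).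
Notation q := (v ^+ 2).

(** The coefficient [kappa] with v free: it is used for v = [vv] in Q(v) and for v = m in the
    rationals. *)
Definition kappaK lam a b : K :=
  v ^ (2 * \sum_i (zv lam i - zv a i) * (1 - zv a i - zv b i))
  * \prod_i \prod_(0 <= s < (lam i - a i)%N)
      (v ^+ (2 * (lam i - a i)) - v ^+ (2 * s))^-1.

(* The coefficients of relation (5) with K acting from the left by the weight l. *)
Definition coefL lam mu l a b : K :=
  v ^ eul (zv mu) (zv mu) * (kappaK lam a b * v ^ eul (zv b) (zv lam + zv mu - zv b))
  * v ^ eul (zv mu - zv b) l.
Definition coefR lam mu l a b : K :=
  v ^ eul (zv mu) (zv lam)
  * (kappaK lam a b * v ^ (eul (zv mu - zv b) (zv a) + eul (zv mu) (zv b)))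
  * v ^ (- eul (zv mu - zv b) l).

Definition lin l b : int := \sum_i (2 - l i - l (ordS i)) * (b i)%:Z.
(** Chosen so that, after multiplication by this power of v, the coefficients depend on mu, apart
    from [wtA] and [wtB], only through one factor common to both sides. The weights of the model
    produce the same exponent, see [weight_dn_up]. *)
Definition rescale l a b : int := lin l b - eul (zv b) (zv a).

Lemma q0 : q != 0. Proof. by rewrite expf_neq0. Qed.

Lemma kappaK_gl lam mu a b : (forall i, lam i - a i = mu i - b i)%N ->
  \prod_i \prod_(0 <= s < (lam i - a i)%N)
      (v ^+ (2 * (lam i - a i)) - v ^+ (2 * s))^-1
  = \prod_i (gl q (mu i - b i))^-1.
Proof.
move=> gap; apply: eq_bigr => i _; rewrite gap big_mkord /gl /ff -prodfV.
by apply: eq_bigr => s _; rewrite !exprM.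
Qed.

Lemma wt_exponent (g : Nn n) (f : 'I_n -> int) :
  \prod_i ((gl q (g i))^-1 * q ^ (f i))
  = (\prod_i (gl q (g i))^-1) * v ^ (2 * \sum_i f i).
Proof. by rewrite big_split /= prod_exprz ?q0 // -exprz_exp. Qed.

Section Exponents.
Variables (lam mu a b : Nn n) (l t : Zn n).
Hypotheses (bmu : vle b mu) (lamE : forall i, lam i = (a i + (mu i - b i))%N).
Hypothesis tE : forall i, t i = l i - ((lam i)%:Z - (mu i)%:Z).

Let g i : int := (mu i - b i)%N%:Z.
Let muE i : (mu i)%:Z = (b i)%:Z + g i.
Proof. by rewrite /g -PoszD subnKC //; apply: (forallP bmu). Qed.
Let lamZ i : (lam i)%:Z = (a i)%:Z + g i.
Proof. by rewrite lamE PoszD. Qed.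
Let gap i : (lam i - a i = mu i - b i)%N.
Proof. by rewrite lamE addKn. Qed.

Lemma coefL_wtA : coefL lam mu l a b * v ^ rescale l a b
  = v ^ (eul (zv mu) (zv mu) + lin l mu) * wtA q t mu b.
Proof.
rewrite /coefL /kappaK (kappaK_gl gap) /wtA.
under [X in _ = _ * X]eq_bigr => i _ do
  rewrite (_ : (mu i - b i)%N = vsub mu b i) ?[RHS]ffunE //.
rewrite wt_exponent; under [X in _ = _ * (X * _)]eq_bigr => i _ do rewrite ffunE.
set G := \prod_i _^-1; move: G => G.
have vD (x y : int) : v ^ (x + y) = v ^ x * v ^ y by rewrite expfzDr.
transitivity (G * v ^ (eul (zv mu) (zv mu)
   + 2 * (\sum_i (zv lam i - zv a i) * (1 - zv a i - zv b i))
   + eul (zv b) (zv lam + zv mu - zv b) + eul (zv mu - zv b) l + rescale l a b)).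
  by rewrite !vD; do 5!move: (v ^ _) => ?; ring.
rewrite [RHS]mulrCA -vD; congr (_ * v ^ _).
(* A cyclic shift of the index removes the predecessors, so that the exponents agree summand by
   summand. *)
have -> : \sum_i (vsub mu b i)%:Z * (t i - (b i)%:Z - (b (ord_pred i))%:Z)
   = \sum_i (g i * (t i - (b i)%:Z) - g (ordS i) * (b i)%:Z).
  under eq_bigr => i _ do rewrite mulrBr ffunE.
  rewrite sumrB [RHS]sumrB; congr (_ - _).
  rewrite -[LHS]sum_ordS; apply: eq_bigr => i _; by rewrite ordSK.
rewrite /rescale /lin /eul !mulr_sumr; do ![rewrite -sumrB | rewrite -big_split /=].
apply: eq_bigr => i _; rewrite !ffunE ?tE ?lamZ ?muE; ring.
Qed.

Lemma coefR_wtB : coefR lam mu l a b * v ^ rescale l a b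
  = v ^ (eul (zv mu) (zv mu) + lin l mu) * wtB q t mu b.
Proof.
rewrite /coefR /kappaK (kappaK_gl gap) /wtB.
under [X in _ = _ * X]eq_bigr => i _ do
  rewrite (_ : (mu i - b i)%N = vsub mu b i) ?[RHS]ffunE //.
rewrite wt_exponent; under [X in _ = _ * (X * _)]eq_bigr => i _ do rewrite ffunE.
set G := \prod_i _^-1; move: G => G.
have vD (x y : int) : v ^ (x + y) = v ^ x * v ^ y by rewrite expfzDr.
transitivity (G * v ^ (eul (zv mu) (zv lam)
   + 2 * (\sum_i (zv lam i - zv a i) * (1 - zv a i - zv b i))
   + (eul (zv mu - zv b) (zv a) + eul (zv mu) (zv b))
   - eul (zv mu - zv b) l + rescale l a b)).
  by rewrite !vD; do 5!move: (v ^ _) => ?; ring.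
rewrite [RHS]mulrCA -vD; congr (_ * v ^ _).
rewrite /rescale /lin /eul !mulr_sumr; do ![rewrite -sumrB | rewrite -big_split /=].
apply: eq_bigr => i _; rewrite !ffunE ?tE ?lamZ ?muE; ring.
Qed.

End Exponents.

Definition rel5 (M : lmodType K) tau mu l (X Y : Nn n -> M) : Prop :=
  \sum_(b <- box mu | gap_nonneg tau b) coefL (gapv tau mu) mu l (gapv tau b) b *: X b
  = \sum_(b <- box mu | gap_nonneg tau b) coefR (gapv tau mu) mu l (gapv tau b) b *: Y b.

Section OneGap.
Variables (tau l : Zn n).

Let lamE mu b i : gap_nonneg tau mu -> vle b mu -> gap_nonneg tau b ->
  (gapv tau mu i = gapv tau b i + (mu i - b i))%N.
Proof.
move=> nm /forallP bm nb; have := bm i.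
by have := gapvE i nm; have := gapvE i nb; lia.
Qed.

Let tE mu i : gap_nonneg tau mu ->
  (l - tau) i = l i - ((gapv tau mu i)%:Z - (mu i)%:Z).
Proof. by move=> nm; rewrite gapvE // !ffunE; ring. Qed.

Lemma rel5_qrel (M : lmodType K) (X Y : Nn n -> M) :
    (forall mu, gap_nonneg tau mu -> rel5 tau mu l X Y) ->
  let r b := v ^ (- rescale l (gapv tau b) b) in
  qrel q (l - tau) (fun b => if gap_nonneg tau b then r b *: X b else 0)
                   (fun b => if gap_nonneg tau b then r b *: Y b else 0).
Proof.
move=> H r mu; have [nm|nnm] := boolP (gap_nonneg tau mu); last first.
  rewrite [LHS]big_seq [RHS]big_seq; apply: eq_bigr => b; rewrite mem_box => bm.
  have -> : gap_nonneg tau b = false; last by rewrite !scaler0.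
  apply: contraNF nnm => /forallP nb; apply/forallP => i.
  by have := nb i; have := forallP bm i; lia.
have e (c w : Nn n -> K) (Z : Nn n -> M) :
   (forall b, vle b mu -> gap_nonneg tau b -> c b * v ^ rescale l (gapv tau b) b
      = v ^ (eul (zv mu) (zv mu) + lin l mu) * w b) ->
   v ^ (eul (zv mu) (zv mu) + lin l mu) *:
     (\sum_(b <- box mu) w b *: (if gap_nonneg tau b then r b *: Z b else 0))
   = \sum_(b <- box mu | gap_nonneg tau b) c b *: Z b.
  move=> cw; rewrite scaler_sumr [RHS]big_mkcond [LHS]big_seq [RHS]big_seq.
  apply: eq_bigr => b; rewrite mem_box => bm; case: ifP => nb; last by rewrite !scaler0.
  rewrite !scalerA -cw // /r -mulrA -expfzDr // subrr expr0z mulr1 //.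
apply: (scalerI (expfz_neq0 (eul (zv mu) (zv mu) + lin l mu) v0)).
rewrite (e (fun b => coefL (gapv tau mu) mu l (gapv tau b) b)); last first.
  by move=> b bm nb; apply: coefL_wtA => // i; [apply: lamE|apply: tE].
rewrite (e (fun b => coefR (gapv tau mu) mu l (gapv tau b) b)); last first.
  by move=> b bm nb; apply: coefR_wtB => // i; [apply: lamE|apply: tE].
exact: H.
Qed.

(** The scalar solutions of [gauss_identity] with the rescaling undone; e absorbs a power of v
    common to all b. [rel5_pair] applies this to counts of intermediate subrepresentations. *)
Lemma rel5_gauss (e : int) mu b0 : gap_nonneg tau mu -> vle b0 mu ->
    gap_nonneg tau b0 ->
  let t := l - tau in
  let X b := if vle b0 b then v ^ (rescale l (gapv tau b) b + e)
    * \prod_i gauss q (qexp q t b0 i) (b i - b0 i) else 0 in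
  let Y b := if vle b0 b then v ^ (rescale l (gapv tau b) b + e)
    * \prod_i gauss q (qexp q t b0 (ord_pred i)) (b i - b0 i) else 0 in
  rel5 (M := K^o) tau mu l X Y.
Proof.
move=> nm bm nb t X Y.
have nn b : vle b0 b -> gap_nonneg tau b.
  move=> /forallP bb; apply/forallP => i.
  by have := forallP nb i; have := bb i; lia.
have E (c w h : Nn n -> K) (Z : Nn n -> K) :
   (forall b, vle b mu -> gap_nonneg tau b -> c b * v ^ rescale l (gapv tau b) b
      = v ^ (eul (zv mu) (zv mu) + lin l mu) * w b) ->
   (forall b, Z b = if vle b0 b then v ^ (rescale l (gapv tau b) b + e) * h b else 0) ->
   \sum_(b <- box mu | gap_nonneg tau b) c b * Z b
   = v ^ (eul (zv mu) (zv mu) + lin l mu + e)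
     * \sum_(b <- box mu | vle b0 b) w b * h b.
  move=> cw ZE; rewrite mulr_sumr [LHS]big_mkcond [RHS]big_mkcond.
  rewrite [LHS]big_seq [RHS]big_seq; apply: eq_bigr => b; rewrite mem_box => bmu.
  rewrite ZE; case: ifPn => [nb'|nnb]; last first.
    by rewrite ifN //; apply: contra nnb; apply: nn.
  case: ifP => _; last by rewrite mulr0.
  have cwb := cw b bmu nb'.
  transitivity ((c b * v ^ rescale l (gapv tau b) b) * (v ^ e * h b)).
    by rewrite expfzDr // !mulrA.
  by rewrite cwb [in RHS](expfzDr _ e v0) mulrACA.
rewrite /rel5; transitivity (\sum_(b <- box mu | gap_nonneg tau b)
   coefL (gapv tau mu) mu l (gapv tau b) b * X b); first by [].
transitivity (\sum_(b <- box mu | gap_nonneg tau b)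
   coefR (gapv tau mu) mu l (gapv tau b) b * Y b); last by [].
rewrite (E _ (wtA q t mu) (fun b => \prod_i gauss q (qexp q t b0 i) (b i - b0 i))) //; last first.
  by move=> b bmu nb'; apply: coefL_wtA => // i; [apply: lamE|apply: tE].
rewrite (E _ (wtB q t mu) (fun b => \prod_i gauss q (qexp q t b0 (ord_pred i)) (b i - b0 i))) //; last first.
  by move=> b bmu nb'; apply: coefR_wtB => // i; [apply: lamE|apply: tE].
by rewrite gauss_identity ?q0.
Qed.

End OneGap.
End RescaledCommutation.

Lemma div_eq_cross (K : fieldType) (a b c d : K) : b != 0 -> d != 0 ->
  a / b = c / d -> a * d = c * b.
Proof. by move=> b0 d0 /eqP; rewrite eqr_div // => /eqP. Qed.

(** * Laurent polynomials inside Q(v), and evaluation of Q(v) at large integers *)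

Section FractionField.

Lemma fracE (c : Qv) : exists a b : {poly rat}, b != 0 /\ c = tofrac a / tofrac b.
Proof.
elim/quotW: c => x; exists \n_x, \d_x; have d0 := denom_ratioP x; split=> //.
have d0' : tofrac \d_x != 0 by rewrite tofrac_eq0.
apply: (canRL (mulfK d0')).
change (FracField.mul (\pi_(Qv) x) (FracField.tofrac \d_x) = FracField.tofrac \n_x).
rewrite !piE; apply/eqmodP; rewrite /= FracField.equivfE /FracField.mulf.
rewrite !numden_Ratio ?mulr1 ?oner_neq0 ?mulf_neq0 ?denom_ratioP ?oner_neq0 //.
by rewrite mulrC.
Qed.

Lemma vv0 : vv != 0. Proof. by rewrite -unitfE vv_unit. Qed.

Lemma vv_inf k : (0 < k)%N -> (vv ^+ 2) ^+ k != 1.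
Proof.
move=> k0; rewrite -exprM -tofracXn -tofrac1 tofrac_eq; apply/eqP => e.
have := congr1 (fun p : {poly rat} => size p) e.
by rewrite size_polyXn size_poly1 => -[/eqP]; rewrite muln_eq0 /= -leqn0 leqNgt k0.
Qed.

Definition lau : {pred Qv} := fun c => `[< laurent c >].

Lemma lauP c : reflect (laurent c) (c \in lau). Proof. exact: asboolP. Qed.

Lemma lau_poly (p : {poly int}) : tofrac (map_poly intr p) \in lau.
Proof. by apply/lauP; exists p, 0%N; rewrite expr0 divr1. Qed.

Lemma lau_poly_vv (p : {poly int}) k : tofrac (map_poly intr p) / vv ^+ k \in lau.
Proof. by apply/lauP; exists p, k. Qed.

Lemma lau_closed : subring_closed lau.
Proof.
have h k : tofrac (map_poly intr 'X^k) = vv ^+ k :> Qv.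
  by rewrite map_polyXn tofracXn.
have v0 k : vv ^+ k != 0 by rewrite expf_neq0 ?vv0.
split=> [|_ _ /lauP[p [k ->]] /lauP[r [j ->]]|_ _ /lauP[p [k ->]] /lauP[r [j ->]]].
- have -> : 1 = tofrac (map_poly intr 1) :> Qv by rewrite rmorph1 tofrac1.
  exact: lau_poly.
- have -> : tofrac (map_poly intr p) / vv ^+ k - tofrac (map_poly intr r) / vv ^+ j
    = tofrac (map_poly intr (p * 'X^j - r * 'X^k)) / vv ^+ (k + j) :> Qv.
    rewrite rmorphB !rmorphM /= tofracB !tofracM !h exprD.
    by rewrite -mulNr addf_div // mulNr.
  exact: lau_poly_vv.
- have -> : tofrac (map_poly intr p) / vv ^+ k * (tofrac (map_poly intr r) / vv ^+ j)
    = tofrac (map_poly intr (p * r)) / vv ^+ (k + j) :> Qv.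
    by rewrite rmorphM /= tofracM exprD invfM mulrACA.
  exact: lau_poly_vv.
Qed.
HB.instance Definition _ := GRing.isSubringClosed.Build Qv lau lau_closed.

Lemma lau_vv (z : int) : vv ^ z \in lau.
Proof.
have h k : tofrac (map_poly intr 'X^k) = vv ^+ k :> Qv.
  by rewrite map_polyXn tofracXn.
case: z => k; first by rewrite -exprnP -h lau_poly.
rewrite NegzE -invr_expz -exprnP.
have -> : (vv ^+ k.+1)^-1 = tofrac (map_poly intr 1) / vv ^+ k.+1.
  by rewrite rmorph1 tofrac1 mul1r.
exact: lau_poly_vv.
Qed.

(** The Pascal rule is used upwards for positive m and solved backwards for negative m, where the
    power of v dividing out is invertible among Laurent polynomials. Negative m occur because
    weights are arbitrary integers. *)
Lemma lau_gauss (m : int) k : gauss (vv ^+ 2) ((vv ^+ 2) ^ m) k \in lau.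
Proof.
have q0 : vv ^+ 2 != 0 by rewrite expf_neq0 ?vv0.
have qe (z : int) : (vv ^+ 2) ^ z = vv ^ (2 * z) by rewrite -exprz_exp.
have lq j : (vv ^+ 2) ^+ j \in lau by rewrite -exprM exprnP lau_vv.
have pas (y : Qv) j := gauss_pascal q0 vv_inf y j.
elim: k m => [|k IH] m; first by rewrite gauss0 rpred1.
elim/int_ind: m => [|m IHm|m IHm].
- by rewrite expr0z -[1](expr0 (vv ^+ 2)) gauss_eq0 ?rpred0.
- rewrite -exprnP (exprS _ m) pas; apply: rpredD; first exact: (IH m%:Z).
  by apply: rpredM; [exact: lq|exact: IHm].
- have := pas ((vv ^+ 2) ^ (- m.+1%:Z)) k.
  have -> : vv ^+ 2 * (vv ^+ 2) ^ (- m.+1%:Z) = (vv ^+ 2) ^ (- m%:Z).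
    rewrite -[X in X * _]expr1z -expfzDr //; congr (_ ^ _).
    by rewrite -addn1 PoszD; lia.
  move/(canLR (addKr _)).
  move/(canLR (mulKf (expf_neq0 _ q0))) => <-.
  rewrite rpredM //; last by rewrite rpredD ?rpredN ?IH.
  by rewrite -exprM exprnP invr_expz lau_vv.
Qed.

Lemma common_denominator (c : Qv) : exists2 d, d \in lau & d != 0 /\ d * c \in lau.
Proof.
have [a [b [b0 ->]]] := fracE c.
have [r [x x0 ae]] := rat_poly_scale a; have [s [y y0 be]] := rat_poly_scale b.
have F (z : int) (p : {poly int}) : tofrac (z%:~R *: map_poly intr p : {poly rat}) \in lau.
  have -> : z%:~R *: map_poly intr p = map_poly intr (z *: p) :> {poly rat}.
    by apply/polyP => i; rewrite coefZ !coef_map /= coefZ rmorphM.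
  exact: lau_poly.
have e1 : a * (x * y)%:~R%:P = y%:~R *: map_poly intr r.
  rewrite ae mulrC mul_polyC scalerA rmorphM /= mulrAC mulfV ?mul1r //.
  by rewrite intr_eq0.
have e2 : b * (x * y)%:~R%:P = x%:~R *: map_poly intr s.
  rewrite be mulrC mul_polyC scalerA rmorphM /= -mulrA mulfV ?mulr1 //.
  by rewrite intr_eq0.
have xy0 : ((x * y)%:~R : rat) != 0 by rewrite intr_eq0 mulf_neq0.
have b0' : tofrac b != 0 by rewrite tofrac_eq0.
exists (tofrac (b * (x * y)%:~R%:P)); first by rewrite e2 F.
split; first by rewrite tofrac_eq0 mulf_neq0 // polyC_eq0.
have -> : tofrac (b * (x * y)%:~R%:P) * (tofrac a / tofrac b)
          = tofrac (a * (x * y)%:~R%:P).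
  by rewrite !tofracM [tofrac b * _]mulrC mulrACA mulfV // mulr1 mulrC.
by rewrite e1 F.
Qed.

Lemma common_denominators (s : seq Qv) :
  exists2 d, d \in lau & d != 0 /\ forall c, c \in s -> d * c \in lau.
Proof.
elim: s => [|c s [d dL [d0 ds]]]; first by exists 1; rewrite ?rpred1 ?oner_neq0.
have [e eL [e0 ec]] := common_denominator c; exists (e * d); first by rewrite rpredM.
split=> [|x]; first exact: (@mulf_neq0 Qv _ _ e0 d0).
rewrite inE => /orP[/eqP ->|/ds xs]; first by rewrite mulrAC rpredM.
by rewrite -mulrA rpredM.
Qed.

End FractionField.

Section Evaluation.

Definition num_den (c : Qv) : {poly rat} * {poly rat} :=
  let: exist a H := cid (fracE c) in (a, projT1 (cid H)).

Lemma num_denE c : (num_den c).2 != 0 /\ c = tofrac (num_den c).1 / tofrac (num_den c).2.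
Proof. by rewrite /num_den; case: (cid (fracE c)) => a H /=; case: (cid H). Qed.

(* A ring homomorphism only where the denominators do not vanish. *)
Definition ev (m : nat) (c : Qv) : rat := (num_den c).1.[m%:R] / (num_den c).2.[m%:R].

(** Only large m are considered because [ev] uses one chosen fraction for each c, whose denominator
    may vanish at small m; with this restriction the field operations are respected. *)
Definition isev (c : Qv) (e : nat -> rat) :=
  exists m0, forall m, (m0 <= m)%N -> ev m c = e m.

Lemma poly_eventually (b : {poly rat}) : b != 0 ->
  exists m0, forall m, (m0 <= m)%N -> b.[m%:R] != 0.
Proof.
move=> b0; apply: contrapT => /forallNP H.
have roots k : exists s : seq nat, [/\ uniq s, size s = k & all (fun m => b.[m%:R] == 0) s].
  elim: k => [|k [s [us ss rs]]]; first by exists [::].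
  have /existsNP[m /not_implyP[ms /negP/negPn bm]] := H (\max_(i <- s) i).+1.
  exists (m :: s); split=> /=; rewrite ?ss ?bm ?us ?andbT //; apply/negP => min.
  by move: ms; rewrite ltnNge (bigD1_seq m) //= leq_maxl.
have [s [us ss rs]] := roots (size b).
have := max_poly_roots (p := b) (rs := [seq m%:R | m <- s]) b0.
rewrite size_map ss ltnn => F; apply/notF/F.
  by apply/allP => x /mapP[m /(allP rs) bm ->].
by rewrite map_inj_uniq // => i j /eqP; rewrite eqr_nat => /eqP.
Qed.

Lemma isev_frac (a b : {poly rat}) : b != 0 ->
  isev (tofrac a / tofrac b) (fun m => a.[m%:R] / b.[m%:R]).
Proof.
move=> b0; set c := _ / _; have [d0 ce] := num_denE c.
have [m0 H0] := poly_eventually b0; have [m1 H1] := poly_eventually d0.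
exists (maxn m0 m1) => m; rewrite geq_max => /andP[/H0 bm /H1 dm].
apply/eqP; rewrite /ev eqr_div // -!hornerM; apply/eqP; congr (_.[_]).
apply/eqP; rewrite -tofrac_eq !tofracM; apply/eqP/esym.
by apply: div_eq_cross ce; rewrite tofrac_eq0.
Qed.

Lemma isev_ext c e e' : isev c e -> (forall m, e m = e' m) -> isev c e'.
Proof. by move=> [m0 H] ee; exists m0 => m /H ->. Qed.

Lemma isev_def c : exists a b : {poly rat}, [/\ b != 0, c = tofrac a / tofrac b &
  exists m0, forall m, (m0 <= m)%N -> b.[m%:R] != 0 /\ ev m c = a.[m%:R] / b.[m%:R]].
Proof.
have [a [b [b0 ->]]] := fracE c; exists a, b; split=> //.
have [m0 H0] := poly_eventually b0; have [m1 H1] := isev_frac a b0.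
by exists (maxn m0 m1) => m; rewrite geq_max => /andP[/H0 ? /H1].
Qed.

Lemma isev_poly (a : {poly rat}) : isev (tofrac a) (fun m => a.[m%:R]).
Proof.
have := isev_frac a (oner_neq0 _); rewrite tofrac1 divr1.
by move=> /isev_ext; apply=> m; rewrite hornerE divr1.
Qed.

Lemma isev_lift2 c d e e' (op : Qv -> Qv -> Qv) (opr : rat -> rat -> rat) :
    (forall a b x y : {poly rat}, b != 0 -> y != 0 -> exists r s, [/\ s != 0,
       op (tofrac a / tofrac b) (tofrac x / tofrac y) = tofrac r / tofrac s &
       forall m, b.[m] != 0 -> y.[m] != 0 ->
         r.[m] / s.[m] = opr (a.[m] / b.[m]) (x.[m] / y.[m])]) ->
  isev c e -> isev d e' -> isev (op c d) (fun m => opr (e m) (e' m)).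
Proof.
move=> H [m0 H0] [m1 H1].
have [a [b [b0 ce [m2 H2]]]] := isev_def c; have [x [y [y0 de [m3 H3]]]] := isev_def d.
have [r [s [s0 e2 e3]]] := H a b x y b0 y0.
have [m4 H4] := isev_frac r s0.
exists (maxn m0 (maxn m1 (maxn m2 (maxn m3 m4)))) => m.
rewrite !geq_max => /and5P[/H0 <- /H1 <- /H2[bm ->] /H3[ym ->] /H4 h4].
by rewrite ce de e2 h4 e3.
Qed.

Lemma isevD c d e e' : isev c e -> isev d e' -> isev (c + d) (fun m => e m + e' m).
Proof.
apply: (@isev_lift2 _ _ _ _ +%R +%R) => a b x y b0 y0.
exists (a * y + x * b), (b * y); split; first exact: mulf_neq0.
  by rewrite addf_div ?tofrac_eq0 // tofracD !tofracM.
by move=> m bm ym; rewrite addf_div // !hornerE.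
Qed.

Lemma isevM c d e e' : isev c e -> isev d e' -> isev (c * d) (fun m => e m * e' m).
Proof.
apply: (@isev_lift2 _ _ _ _ *%R *%R) => a b x y b0 y0.
exists (a * x), (b * y); split; first exact: mulf_neq0.
  by rewrite mulf_div !tofracM.
by move=> m bm ym; rewrite mulf_div !hornerE.
Qed.

Lemma isev_eq c e e' : isev c e -> isev c e' ->
  exists m0, forall m, (m0 <= m)%N -> e m = e' m.
Proof.
move=> [m0 H0] [m1 H1]; exists (maxn m0 m1) => m.
by rewrite geq_max => /andP[/H0 <- /H1].
Qed.

Lemma isev0 : isev 0 (fun=> 0).
Proof. by have := isev_poly 0; rewrite tofrac0 => /isev_ext; apply=> m; rewrite horner0. Qed.

Lemma isev1 : isev 1 (fun=> 1).
Proof. by have := isev_poly 1; rewrite tofrac1 => /isev_ext; apply=> m; rewrite hornerE. Qed.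

Lemma isevV c e : isev c e -> isev c^-1 (fun m => (e m)^-1).
Proof.
move=> ce; have [c0|c0] := eqVneq c 0.
  have c0' : isev c (fun=> 0) by rewrite c0; apply: isev0.
  have [m0 H0] := isev_eq ce c0'.
  rewrite c0 invr0; have [m1 H1] := isev0; exists (maxn m0 m1) => m.
  by rewrite geq_max => /andP[/H0 -> /H1 ->]; rewrite invr0.
have [m0 H0] := ce; have [a [b [b0 cE [m2 H2]]]] := isev_def c.
have a0 : a != 0 by apply: contraNneq c0 => a0; rewrite cE a0 tofrac0 mul0r.
have [m1 H1] := isev_frac b a0; exists (maxn m0 (maxn m1 m2)) => m.
rewrite !geq_max => /and3P[/H0 <- /H1 h1 /H2[bm ->]].
by rewrite invf_div -h1 cE invf_div.
Qed.

Lemma isevN c e : isev c e -> isev (- c) (fun m => - e m).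
Proof.
move=> ce; have m1 : isev (- 1) (fun=> -1).
  by have := isev_poly (- 1); rewrite tofracN tofrac1 => /isev_ext; apply=> m; rewrite !hornerE.
by have := isevM m1 ce; rewrite mulN1r => /isev_ext; apply=> m; rewrite mulN1r.
Qed.

Lemma isev_vv : isev vv (fun m => m%:R).
Proof. by apply: isev_ext (isev_poly 'X) _ => m; rewrite hornerX. Qed.

Lemma isevX c e k : isev c e -> isev (c ^+ k) (fun m => e m ^+ k).
Proof.
move=> ce; elim: k => [|k IH]; first exact: isev1.
by rewrite exprS; apply: isev_ext (isevM ce IH) _ => m; rewrite exprS.
Qed.

Lemma isev_vvz (z : int) : isev (vv ^ z) (fun m => m%:R ^ z).
Proof.
case: z => k; first exact: isevX isev_vv.
by rewrite NegzE -invr_expz; apply/isevV/isevX/isev_vv.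
Qed.

Lemma isev_prod (I : Type) (r : seq I) (f : I -> Qv) (e : I -> nat -> rat) :
  (forall i, isev (f i) (e i)) -> isev (\prod_(i <- r) f i) (fun m => \prod_(i <- r) e i m).
Proof.
move=> fe; elim: r => [|i r IH].
  by rewrite big_nil; apply: isev_ext isev1 _ => m; rewrite big_nil.
by rewrite big_cons; apply: isev_ext (isevM (fe i) IH) _ => m; rewrite big_cons.
Qed.

Lemma isev_neq0 c : c != 0 -> exists m0, forall m, (m0 <= m)%N -> ev m c != 0.
Proof.
move=> c0; have [a [b [b0 cE [m0 H0]]]] := isev_def c.
have a0 : a != 0 by apply: contraNneq c0 => a0; rewrite cE a0 tofrac0 mul0r.
have [m1 H1] := poly_eventually a0; exists (maxn m0 m1) => m.
by rewrite geq_max => /andP[/H0[bm ->] /H1 am]; rewrite mulf_neq0 ?invr_eq0.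
Qed.

End Evaluation.

(** * Straightening *)

Section HallSupport.
Variables (n : nat) (phi : Theta n -> Theta n -> Theta n -> {poly int}).
Hypothesis hphi : is_hall_polynomials phi.
Implicit Types (A B C : Theta n) (lam : Nn n).

Lemma rA_le0 A k v : (rA A k v <= rA A 0 v)%N.
Proof. by rewrite /rA; apply: sub_count. Qed.

Lemma entry_rA A (i : 'I_n) k : (A (i, k) <= rA A k (iter k (@ordS n) i))%N.
Proof. by rewrite rA_rec eA_rec iterS_cancel' -addnA leq_addr. Qed.

Lemma rA_total A k : (\sum_v rA A k v = \sum_v eA A k v + \sum_v rA A k.+1 v)%N.
Proof.
rewrite (eq_bigr _ (fun v _ => rA_rec A k v)) big_split /=; congr (_ + _)%N.
exact: (sum_ordS (fun v => rA A k.+1 v)).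
Qed.

Lemma eA_mono A k v : (eA A k.+1 v <= eA A k v)%N.
Proof. by rewrite [X in (_ <= X)%N]eA_rec leq_addl. Qed.

(** A string of length k + 1 makes the total layer dimension drop strictly at each of the first k +
    1 steps. *)
Lemma entry_length A i k : (0 < A (i, k))%N -> (k < \sum_v rA A 0 v)%N.
Proof.
move=> Aik; have e0 j : (j <= k)%N -> (0 < \sum_v eA A j v)%N.
  move=> jk; rewrite (bigD1 (iter k (@ordS n) i)) //= addn_gt0; apply/orP; left.
  apply: (@leq_trans (eA A k (iter k (@ordS n) i))).
    by rewrite eA_rec iterS_cancel' addn_gt0 Aik.
  move: (iter k _ i) => w; move: jk => /subnK <-.
  elim: (k - j)%N => [|d IH] //; rewrite addSn.
  exact: leq_trans (eA_mono _ _ _) IH.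
have : forall j, (j <= k.+1)%N -> (j + \sum_v rA A j v <= \sum_v rA A 0 v)%N.
  elim=> // j IH jk; apply: leq_trans (IH (ltnW jk)); rewrite (rA_total A j) addSn -addnS.
  by rewrite leq_add2l -add1n leq_add2r; apply: e0.
by move=> /(_ k.+1 (leqnn _)); apply: leq_trans; rewrite leq_addr.
Qed.

(** The total dimension bounds both the entries and, by [entry_length], the lengths of the
    strings. *)
Lemma finitely_many_dim (d : 'I_n -> nat) : exists s : seq (Theta n),
  forall C, (forall v, rA C 0 v = d v) -> C \in s.
Proof.
pose D := (\sum_v d v).+1.
pose th (f : {ffun 'I_n * 'I_D -> 'I_D}) : Theta n :=
  [fsfun p in [fset (q.1, val q.2) | q in {: 'I_n * 'I_D}]%fset =>
     (if insub p.2 is Some k then val (f (p.1, k)) else 0%N) | 0%N].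
exists [seq th f | f <- enum {: {ffun 'I_n * 'I_D -> 'I_D}}] => C Cd.
have CD p : (C p < D)%N.
  case: p => i k; rewrite ltnS; apply: leq_trans (entry_rA C i k) _.
  apply: leq_trans (rA_le0 _ _ _) _; rewrite Cd (bigD1 (iter k (@ordS n) i)) //=.
  exact: leq_addr.
apply/mapP; exists [ffun q => Ordinal (CD (q.1, val q.2))]; first by rewrite mem_enum.
apply/fsfunP => -[i k]; rewrite fsfun_fun; case: imfsetP => [[[j k'] _ [-> ->]]|nS] /=.
  by rewrite valK ffunE.
apply/eqP; rewrite -leqn0 leqNgt; apply/negP => /entry_length kD.
have kD' : (k < D)%N by rewrite ltnW // /D ltnS (eq_bigr _ (fun v _ => esym (Cd v))).
by apply: nS; exists (i, Ordinal kD').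
Qed.

Lemma phi_dim A B C : phi A B C != 0 -> forall v, rA C 0 v = (rA A 0 v + rA B 0 v)%N.
Proof.
move=> /(phi_neq0 hphi)[F]; rewrite hall_countE -lt0n => /card_gt0P[N].
move=> /and3P[_ /asboolP/typ0 tB /asboolP tA] v.
have := tA 0%N v; rewrite (eqmx_rankE (addsmx_idPl _)) ?submx1 //=.
by rewrite -(rank_pw_full F C 0 v) /= => ->; have /= -> := tB 0%N v; rewrite addnC.
Qed.

(** The relations [drel_up] and [drel_um] take a list of the nonzero Hall polynomials as an
    argument. It exists because dimension vectors add up in extensions. *)
Lemma phi_support A B : exists s : seq (Theta n),
  uniq s /\ forall C, (C \in s) = (phi A B C != 0).
Proof.
have [s Hs] := finitely_many_dim (fun v => rA A 0 v + rA B 0 v)%N.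
exists (undup [seq C <- s | phi A B C != 0]); split; first exact: undup_uniq.
move=> C; rewrite mem_undup mem_filter; case: (boolP (phi _ _ _ != 0)) => //= nz.
by apply: Hs; apply: phi_dim.
Qed.

Lemma lau_hall A B C : hall_at_v2 phi A B C \in lau.
Proof.
rewrite /hall_at_v2 horner_coef; apply: rpred_sum => i _.
rewrite rpredM //; last by rewrite -exprM exprnP lau_vv.
by rewrite coef_map /= rpred_int.
Qed.

Section Generation.
Variables (V : lmodType Qv) (u : Theta n -> V) (P : V -> Prop).
Hypotheses (PD : forall x y, P x -> P y -> P (x + y))
  (PZ : forall c x, c \in lau -> P x -> P (c *: x)) (P0 : P (u (Theta0 n))).
Hypothesis Prad : forall A B lam, radical_of A B lam -> P (u B) ->
  forall s, uniq s -> (forall C, (C \in s) = (phi (Adiag lam) B C != 0)) ->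
  exists e : int,
    P (\sum_(C <- s) (vv ^ e * hall_at_v2 phi (Adiag lam) B C) *: u C).

Lemma P_sum (I : eqType) (r : seq I) (Q : pred I) (f : I -> V) :
  (forall i, i \in r -> Q i -> P (f i)) -> P (\sum_(i <- r | Q i) f i).
Proof.
have PP : P 0 by rewrite -(scale0r (u (Theta0 n))); apply: PZ => //; exact: rpred0.
move=> H; rewrite big_seq_cond; apply: big_ind => // i /andP[]; exact: H.
Qed.

Lemma theta_generation A : P (u A).
Proof.
have [D AD] := rA_large A.
have [N] := ubnP (\sum_(k < D) \sum_v rA A k v).
elim: N A AD => // N IH A AD; rewrite ltnS => AN.
have [A0|A0] := eqVneq (\sum_v rA A 0 v)%N 0%N.
  have -> : A = Theta0 n; last by [].
  have z v : rA A 0 v = 0%N.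
    by move/eqP: A0; rewrite sum_nat_eq0 => /forallP/(_ v)/eqP.
  apply: rA_inj => k v; transitivity 0%N.
    by apply/eqP; rewrite -leqn0 -(z v) rA_le0.
  by apply/esym; rewrite rA_sum big_seq big1 // => p; rewrite finsupp0 inE.
have D0 : (0 < D)%N.
  by rewrite lt0n; apply: contra_neq A0 => D0; rewrite big1 // => v _; rewrite AD ?D0.
have [B [lam ABl]] := radical_exists A.
have PB : P (u B).
  apply: IH => [k v Dk|]; first by rewrite ABl.1 AD // leqW.
  apply: leq_trans _ AN; case: D D0 AD => // D _ AD.
  rewrite [X in (_ < X)%N]big_ord_recl big_ord_recr /=.
  have -> : (\sum_v rA B D v = 0)%N by apply: big1 => v _; rewrite ABl.1 AD.
  rewrite addn0 -[X in (X < _)%N]add0n -addSn leq_add //; first by rewrite lt0n.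
  by apply: leq_sum => k _; apply: leq_sum => v _; rewrite ABl.1.
have [s [us sE]] := phi_support (Adiag lam) B.
have [e] := Prad ABl PB us sE.
have As : A \in s by rewrite sE (phi_radical hphi ABl) oner_neq0.
have hA : hall_at_v2 phi (Adiag lam) B A = 1.
  by rewrite /hall_at_v2 (phi_radical hphi ABl) rmorph1 hornerC.
rewrite (bigD1_seq A) //= hA mulr1; set R := \sum_(_ <- _ | _) _ => PR.
have -> : u A = vv ^ (- e) *: ((vv ^ e *: u A + R) + (-1) *: R).
  rewrite scaleN1r addrK scalerA -expfzDr ?vv0 // addNr expr0z scale1r //.
apply: PZ; first exact: lau_vv.
apply: PD PR _; apply: PZ; first by rewrite rpredN rpred1.
apply: P_sum => C Cs CA; apply: PZ; first by rewrite rpredM ?lau_vv ?lau_hall.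
have nz : phi (Adiag lam) B C != 0 by rewrite -sE.
have [le0 _] := phi_radical_supp hphi ABl nz.
apply: IH => [k v Dk|]; first by apply/eqP; rewrite -leqn0 -(AD k v Dk) le0.
apply: leq_trans _ AN.
have [k [v kv]] : exists k v, rA C k v != rA A k v.
  apply: contrapT => H; move/eqP: CA; apply; apply: rA_inj => k v; apply/eqP.
  by apply/negPn/negP => kv; apply: H; exists k, v.
have kD : (k < D)%N.
  rewrite ltnNge; apply: contra kv => Dk; have := le0 k v; rewrite AD // leqn0.
  by move=> /eqP ->.
rewrite (bigD1 (Ordinal kD)) //= [X in (_ < X)%N](bigD1 (Ordinal kD)) //= -addSn.
apply: leq_add; last by apply: leq_sum => j _; apply: leq_sum => w _.
rewrite (bigD1 v) //= [X in (_ < X)%N](bigD1 v) //= -addSn.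
by apply: leq_add; [rewrite ltn_neqAle kv le0|apply: leq_sum => w _].
Qed.

End Generation.
End HallSupport.

Lemma sum_gap (R : nmodType) n (tau : Zn n) mu (f : Nn n -> Nn n -> R) :
  gap_nonneg tau mu ->
  \sum_(b <- box mu | vle (vsub mu b) (gapv tau mu)) f (vsub (gapv tau mu) (vsub mu b)) b
  = \sum_(b <- box mu | gap_nonneg tau b) f (gapv tau b) b.
Proof.
move=> nm; rewrite [LHS]big_mkcond [RHS]big_mkcond [LHS]big_seq [RHS]big_seq.
apply: eq_bigr => b; rewrite mem_box => bm; rewrite -(gap_nonneg_box nm bm).
by case: ifP => // nb; rewrite (gapv_box nm bm nb).
Qed.

Lemma dotC n (l m : Zn n) : dot l m = dot m l.
Proof. by apply: eq_bigr => i _; rewrite mulrC. Qed.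

Lemma eulNl n (l m : Zn n) : eul (- l) m = - eul l m.
Proof.
rewrite /eul opprB addrC -!sumrN; congr (_ + _); apply: eq_bigr => i _.
  by rewrite ffunE mulNr opprK.
by rewrite ffunE mulNr.
Qed.

Section WeightSpaces.
Variables (n : nat) (phi : Theta n -> Theta n -> Theta n -> {poly int}).
Implicit Types (A B C : Theta n) (lam mu : Nn n) (l m : Zn n).
Notation DD := (DD phi).
Notation up := (up phi).
Notation um := (um phi).
Implicit Types (t u x y : DD).

Lemma wpi_sum l m (I : Type) (r : seq I) (P : pred I) (f : I -> DD) :
  wpi l m (\sum_(i <- r | P i) f i) = \sum_(i <- r | P i) wpi l m (f i).
Proof. by apply: (big_morph (wpi l m)); [apply: wpiD|apply: wpi0]. Qed.

Lemma wpi_mull l l' m t u u' : homog (l - l') t -> wpi l' m u = wpi l' m u' ->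
  wpi l m (t * u) = wpi l m (t * u').
Proof.
move=> ht /wpiP H; apply/wpiP; rewrite -mulrBr; exact: wideal_mull ht H.
Qed.

Lemma wpi_kk l m j x : wpi l m (kk phi j * x) = vv ^ dot l j *: wpi l m x.
Proof.
rewrite -wpiZ; apply/wpiP.
have -> : kk phi j * x - vv ^ dot l j *: x = kshift phi l j * x.
  by rewrite /kshift mulrBl -presented_scaleAl mul1r.
exact: wideal_l.
Qed.

Lemma dclass_sum (I : Type) (r : seq I) (P : pred I) (f : I -> term Qv (gen n)) :
  dclass phi (\big[@TAdd _ _/TZero]_(i <- r | P i) f i)
  = \sum_(i <- r | P i) dclass phi (f i).
Proof. by apply: (big_morph (dclass phi)) => // a b; apply: pclassD. Qed.

Lemma wpi_comm_lhs l m tau mu x : gap_nonneg tau mu ->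
  wpi l m (dclass phi (comm_lhs (gapv tau mu) mu) * x)
  = \sum_(b <- box mu | gap_nonneg tau b) coefL vv (gapv tau mu) mu l (gapv tau b) b
     *: wpi l m (um (Adiag b) * up (Adiag (gapv tau b)) * x).
Proof.
move=> nm; rewrite /comm_lhs dclass_Z dclass_sum -presented_scaleAl wpiZ mulr_suml wpi_sum.
pose f a b := coefL vv (gapv tau mu) mu l a b *: wpi l m (um (Adiag b) * up (Adiag a) * x).
rewrite -(sum_gap f nm) -(sum_same_gap _ _ f) scaler_sumr.
apply: eq_bigr => ab _ /=.
rewrite dclass_Z !dclass_M -presented_scaleAl wpiZ -[_ * x]mulrA.
rewrite -[dclass phi (tKt _)]/(kk phi (rootv _)) wpi_kk !scalerA.
by rewrite dotC dot_rootv.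
Qed.

Lemma wpi_comm_rhs l m tau mu x : gap_nonneg tau mu ->
  wpi l m (dclass phi (comm_rhs (gapv tau mu) mu) * x)
  = \sum_(b <- box mu | gap_nonneg tau b) coefR vv (gapv tau mu) mu l (gapv tau b) b
     *: wpi l m (up (Adiag (gapv tau b)) * um (Adiag b) * x).
Proof.
move=> nm; rewrite /comm_rhs dclass_Z dclass_sum -presented_scaleAl wpiZ mulr_suml wpi_sum.
pose f a b := coefR vv (gapv tau mu) mu l a b *: wpi l m (up (Adiag a) * um (Adiag b) * x).
rewrite -(sum_gap f nm) -(sum_same_gap _ _ f) scaler_sumr.
apply: eq_bigr => ab _ /=.
rewrite dclass_Z !dclass_M -presented_scaleAl wpiZ -[_ * x]mulrA.
rewrite -[dclass phi (tKt _)]/(kk phi (rootv _)) wpi_kk !scalerA.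
by rewrite dotC dot_rootv -[zv (below_vec _) - _]opprB eulNl.
Qed.

Lemma comm_rel5 l m tau mu x : gap_nonneg tau mu ->
  rel5 vv tau mu l
    (fun b => wpi l m (um (Adiag b) * up (Adiag (gapv tau b)) * x))
    (fun b => wpi l m (up (Adiag (gapv tau b)) * um (Adiag b) * x)).
Proof.
move=> nm; rewrite /rel5 -wpi_comm_lhs // -wpi_comm_rhs //.
by rewrite (drelP (drel_comm phi (gapv tau mu) mu)).
Qed.

(** The elements K stand on the left in the commutation relation, so only the left weight l enters
    the coefficients; they serve for every right factor x and right weight m. *)
Lemma straighten lam mu l : exists s : seq (Qv * (Nn n * Nn n)),
  (forall p, p \in s -> p.1 \in lau) /\
  forall m x, wpi l m (um (Adiag mu) * up (Adiag lam) * x)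
    = \sum_(p <- s) p.1 *: wpi l m (up (Adiag p.2.1) * um (Adiag p.2.2) * x).
Proof.
pose tau : Zn n := zv lam - zv mu.
have nm : gap_nonneg tau mu.
  by apply/forallP => i; rewrite !ffunE; lia.
have lamE : gapv tau mu = lam.
  apply/ffunP => i; apply/eqP; rewrite -eqz_nat gapvE // !ffunE addrC subrK.
  exact: eqxx.
have vi k : (0 < k)%N -> (vv ^+ 2) ^+ k != 1 by apply: vv_inf.
have q0' : vv ^+ 2 != 0 by apply: q0 vv0.
have [z [z0 zX]] := qrel_solve (vv ^+ 2) (l - tau) mu.
have zL b : vle b mu -> z b \in lau.
  exact: (qrel_solution_in q0' vi lau_closed lau_gauss zX).
pose r b := vv ^ (- rescale l (gapv tau b) b).
exists [seq (vv ^ rescale l (gapv tau mu) mu * (z g * r g), (gapv tau g, g))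
         | g <- [seq g <- box mu | gap_nonneg tau g]].
split=> [p /mapP[g]|m x].
  rewrite mem_filter mem_box => /andP[_ gm] -> /=.
  by rewrite rpredM ?lau_vv // rpredM ?lau_vv // zL.
have := zX _ _ _ (rel5_qrel vv0 (fun mu' nm' => comm_rel5 l m x nm')).
rewrite nm lamE => e.
have -> : wpi l m (um (Adiag mu) * up (Adiag lam) * x)
  = vv ^ rescale l lam mu *: (vv ^ (- rescale l lam mu)
     *: wpi l m (um (Adiag mu) * up (Adiag lam) * x)).
  by rewrite scalerA -vvD subrr expr0z scale1r.
rewrite e scaler_sumr [RHS]big_map [RHS]big_filter [RHS]big_mkcond.
apply: eq_bigr => g _ /=.
by case: ifP => _; rewrite ?scaler0 // !scalerA mulrA.
Qed.

End WeightSpaces.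

Section TriangularSpans.
Variables (n : nat) (phi : Theta n -> Theta n -> Theta n -> {poly int}).
Hypothesis hphi : is_hall_polynomials phi.
Implicit Types (A B C : Theta n) (lam mu : Nn n) (l m : Zn n).
Notation DD := (DD phi).
Notation up := (up phi).
Notation um := (um phi).
Implicit Types (t u x y : DD).

Lemma up0 : up (Theta0 n) = 1. Proof. exact: drelP (drel_up0 _). Qed.
Lemma um0 : um (Theta0 n) = 1. Proof. exact: drelP (drel_um0 _). Qed.

Lemma up_mul A B s : uniq s -> (forall C, (C \in s) = (phi A B C != 0)) ->
  up A * up B = \sum_(C <- s)
    (vv ^ eul (dimvec A) (dimvec B) * hall_at_v2 phi A B C) *: up C.
Proof.
move=> us sE; rewrite -dclass_M (drelP (drel_up us sE)) dclass_sum.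
by apply: eq_bigr => C _; rewrite dclass_Z.
Qed.

Lemma um_mul A B s : uniq s -> (forall C, (C \in s) = (phi B A C != 0)) ->
  um A * um B = \sum_(C <- s)
    (vv ^ eul (dimvec B) (dimvec A) * hall_at_v2 phi B A C) *: um C.
Proof.
move=> us sE; rewrite -dclass_M (drelP (drel_um us sE)) dclass_sum.
by apply: eq_bigr => C _; rewrite dclass_Z.
Qed.

Lemma up_generation (P : DD -> Prop) :
    (forall x y, P x -> P y -> P (x + y)) ->
    (forall c x, c \in lau -> P x -> P (c *: x)) -> P 1 ->
    (forall lam x, P x -> P (up (Adiag lam) * x)) ->
  forall A, P (up A).
Proof.
move=> PD PZ P1 PM; apply: (theta_generation hphi) => //; first by rewrite up0.
move=> A B lam _ PB s us sE; exists (eul (dimvec (Adiag lam)) (dimvec B)).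
by rewrite -up_mul //; apply: PM.
Qed.

(** Multiplication is on the right here because the product of the u^- uses Hall polynomials with
    the two factors exchanged. *)
Lemma um_generation (P : DD -> Prop) :
    (forall x y, P x -> P y -> P (x + y)) ->
    (forall c x, c \in lau -> P x -> P (c *: x)) -> P 1 ->
    (forall lam x, P x -> P (x * um (Adiag lam))) ->
  forall A, P (um A).
Proof.
move=> PD PZ P1 PM; apply: (theta_generation hphi) => //; first by rewrite um0.
move=> A B lam _ PB s us sE; exists (eul (dimvec (Adiag lam)) (dimvec B)).
by rewrite -um_mul //; apply: PM.
Qed.

Section Coefficients.
Variable S : {pred Qv}.
Hypotheses (SM : forall a b, a \in S -> b \in S -> a * b \in S)
           (Slau : {subset lau <= S}).

(** S is taken to be [lau] for closure under multiplication and [predT] for spanning over Q(v). *)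
Definition inspan l m (x : wD phi l m) : Prop :=
  exists s : seq (Qv * (Theta n * Theta n)), (forall p, p \in s -> p.1 \in S) /\
    x = \sum_(p <- s) p.1 *: wpi l m (up p.2.1 * um p.2.2).

Lemma inspan0 l m : inspan (0 : wD phi l m).
Proof. by exists [::]; rewrite big_nil. Qed.

Lemma inspanD l m (x y : wD phi l m) : inspan x -> inspan y -> inspan (x + y).
Proof.
move=> [s [sS ->]] [s' [sS' ->]]; exists (s ++ s'); rewrite big_cat; split=> // p.
by rewrite mem_cat => /orP[/sS|/sS'].
Qed.

Lemma inspanZ l m c (x : wD phi l m) : c \in S -> inspan x -> inspan (c *: x).
Proof.
move=> cS [s [sS ->]]; exists [seq (c * p.1, p.2) | p <- s]; split=> [p|].
  by move=> /mapP[r rs ->] /=; apply: SM => //; apply: sS.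
by rewrite scaler_sumr big_map; apply: eq_bigr => p _; rewrite scalerA.
Qed.

Lemma inspan_sum l m (I : eqType) (r : seq I) (f : I -> wD phi l m) :
  (forall i, i \in r -> inspan (f i)) -> inspan (\sum_(i <- r) f i).
Proof.
elim: r => [|i r IH] H; first by rewrite big_nil; apply: inspan0.
rewrite big_cons; apply: inspanD; first by apply: H; rewrite mem_head.
by apply: IH => j jr; apply: H; rewrite inE jr orbT.
Qed.

Lemma inspan_gen l m A B : inspan (wpi l m (up A * um B)).
Proof.
exists [:: (1, (A, B))]; rewrite big_seq1 scale1r; split=> // p.
by rewrite inE => /eqP -> /=; apply: Slau; apply: rpred1.
Qed.

(** All left weights at once: left multiplication by a homogeneous element changes l and leaves m
    fixed. *)
Definition inW m t : Prop := forall l, inspan (wpi l m t).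

Lemma inWD m t u : inW m t -> inW m u -> inW m (t + u).
Proof. by move=> tW uW l; rewrite wpiD; apply: inspanD. Qed.

Lemma inWZ m c t : c \in S -> inW m t -> inW m (c *: t).
Proof. by move=> cS tW l; rewrite wpiZ; apply: inspanZ. Qed.

Lemma inW_sum m (I : eqType) (r : seq I) (f : I -> DD) :
  (forall i, i \in r -> inW m (f i)) -> inW m (\sum_(i <- r) f i).
Proof.
by move=> H l; rewrite wpi_sum; apply: inspan_sum => i ir; apply: H.
Qed.

Lemma inspan_mull l l' m t u : homog (l - l') t -> inW m u ->
  (forall A B, inspan (wpi l m (t * (up A * um B)))) -> inspan (wpi l m (t * u)).
Proof.
move=> ht /(_ l')[s [sS e]] H.
have e' : wpi l' m u = wpi l' m (\sum_(p <- s) p.1 *: (up p.2.1 * um p.2.2)).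
  by rewrite wpi_sum e; apply: eq_bigr => p _; rewrite wpiZ.
rewrite (wpi_mull ht e') mulr_sumr wpi_sum; apply: inspan_sum => p ps.
by rewrite -presented_scaleAr wpiZ; apply: inspanZ (H _ _); apply: sS.
Qed.

Lemma inW_base m A B : inW m (up A * um B).
Proof. by move=> l; apply: inspan_gen. Qed.

Lemma inW_up_mul m A t : inW m t -> inW m (up A * t).
Proof.
move=> tW l; have ht : homog (l - (l - degv A)) (up A).
  by rewrite opprB addrC subrK; apply: homog_up.
apply: inspan_mull ht tW _ => A' B; rewrite mulrA.
have [s [us sE]] := phi_support hphi A A'.
rewrite (up_mul us sE) mulr_suml wpi_sum; apply: inspan_sum => C _.
rewrite -presented_scaleAl wpiZ; apply: inspanZ (inspan_gen _ _ _ _).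
by apply: Slau; rewrite rpredM ?lau_vv ?lau_hall.
Qed.

(** Induction over the generation of u^+_A by semisimple factors. Moving u^- past the first factor
    with [straighten] produces other semisimple u^-, so the induction hypothesis must hold for every
    mu and B. *)
Lemma inW_umdiag_upum m mu A B : inW m (um (Adiag mu) * (up A * um B)).
Proof.
move: A mu B; apply: (up_generation (P := fun u => forall mu B,
  inW m (um (Adiag mu) * (u * um B)))) => [x y Hx Hy mu B|c x cL Hx mu B|mu B|lam x Hx mu B l].
- by rewrite mulrDl mulrDr; apply: inWD.
- by rewrite -presented_scaleAl -presented_scaleAr; apply: inWZ => //; apply: Slau.
- rewrite mul1r; have [s [us sE]] := phi_support hphi B (Adiag mu).
  rewrite (um_mul us sE); apply: inW_sum => C _; apply: inWZ.
    by apply: Slau; rewrite rpredM ?lau_vv ?lau_hall.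
  by rewrite -[um C]mul1r -up0; apply: inW_base.
- have [s [sL sE]] := straighten phi lam mu l.
  rewrite !mulrA -[_ * x * um B]mulrA sE; apply: inspan_sum => p ps.
  apply: inspanZ; first exact/Slau/sL.
  by rewrite -mulrA; apply: inW_up_mul; apply: Hx.
Qed.

Lemma inW_umdiag_mul m mu t : inW m t -> inW m (um (Adiag mu) * t).
Proof.
move=> tW l; have ht : homog (l - (l + degv (Adiag mu))) (um (Adiag mu)).
  by rewrite opprD addrA subrr sub0r; apply: homog_um.
by apply: inspan_mull ht tW _ => A B; apply: inW_umdiag_upum.
Qed.

Lemma inW_um_mul m B t : inW m t -> inW m (um B * t).
Proof.
move: B t; apply: (um_generation (P := fun u => forall t, inW m t -> inW m (u * t)))
  => [x y Hx Hy t tW|c x cL Hx t tW|t|lam x Hx t tW].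
- by rewrite mulrDl; apply: inWD; [apply: Hx|apply: Hy].
- by rewrite -presented_scaleAl; apply: inWZ (Hx _ tW); apply: Slau.
- by rewrite mul1r.
- by rewrite -mulrA; apply: Hx; apply: inW_umdiag_mul.
Qed.

Lemma inW_product m A B A' B' : inW m (up A * um B * (up A' * um B')).
Proof. by rewrite -mulrA; apply/inW_up_mul/inW_um_mul/inW_base. Qed.

End Coefficients.

Lemma dclass_one : dclass phi TOne = 1. Proof. by []. Qed.

Lemma kk_evec (i : 'I_n) (z : int) : kk phi (evec i *~ z) = dclass phi (tkpow i z).
Proof.
have ev k : (evec i *~ z) k = if k == i then z else 0.
  have -> : (evec i *~ z) k = evec i k *~ z.
    case: z => z; first by rewrite -!pmulrn ffunMnE.
    by rewrite !NegzE !mulrNz -!pmulrn ffunE ffunMnE.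
  by rewrite ffunE; case: eqP => _; rewrite ?mul0rz // intz.
rewrite /kk /tK.
have -> : dclass phi (\big[@TMul _ _/TOne]_k tkpow k ((evec i *~ z) k))
          = \prod_k dclass phi (tkpow k ((evec i *~ z) k)).
  by apply: (big_morph (dclass phi)) => // x y; rewrite dclass_M.
rewrite (eq_bigr (fun k => if k == i then dclass phi (tkpow i z) else 1)).
  by rewrite -big_mkcond big_pred1_eq.
by move=> k _; rewrite ev; case: eqP => [->|].
Qed.

(** Each generator preserves the span under left multiplication; the K act on a weight component by
    scalars. *)
Lemma inW_all m t : inW predT m t.
Proof.
have SM (a b : Qv) : a \in predT -> b \in predT -> a * b \in predT by [].
have Sl : {subset lau <= predT} by [].
suff H (x : term Qv (gen n)) : forall t, inW predT m t -> inW predT m (dclass phi x * t).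
  elim/pelim: t => x; rewrite -[pclass _ x]mulr1; apply: H.
  by rewrite -[1]mulr1 -[X in X * _]up0 -um0; apply: inW_base.
have HK j u : inW predT m u -> inW predT m (kk phi j * u).
  by move=> uW l; rewrite wpi_kk; apply: inspanZ.
elim: x => [||[A|A|i|i]|x IHx y IHy|x IHx y IHy|c x IHx] u uW.
- move=> l; have -> : dclass phi TZero = 0 by [].
  by rewrite mul0r wpi0; apply: inspan0.
- by rewrite dclass_one mul1r.
- exact: inW_up_mul.
- exact: inW_um_mul.
- have -> : dclass phi (TGen (Kp i)) = kk phi (evec i *~ 1).
    by rewrite kk_evec /= dclass_M dclass_one mulr1.
  exact: HK.
- have -> : dclass phi (TGen (Km i)) = kk phi (evec i *~ (Negz 0)).
    by rewrite kk_evec /= dclass_M dclass_one mulr1.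
  exact: HK.
- have -> : dclass phi (TAdd x y) = dclass phi x + dclass phi y by apply: pclassD.
  by rewrite mulrDl; apply: inWD; [apply: IHx|apply: IHy].
- by rewrite dclass_M -mulrA; apply: IHx; apply: IHy.
- by rewrite dclass_Z -presented_scaleAl; apply: inWZ => //; apply: IHx.
Qed.

End TriangularSpans.

Lemma mulf_invM (K : fieldType) (a b : K) : a != 0 -> a * (a * b)^-1 = b^-1.
Proof. by move=> a0; rewrite invfM mulrA mulfV // mul1r. Qed.

Lemma mulf_conj (K : fieldType) (a b : K) : a != 0 -> a * b * a^-1 = b.
Proof. by move=> a0; rewrite mulrAC mulfV // mul1r. Qed.

(** * Closure under multiplication, denominators and extension of scalars *)

Section DirectSums.
Variables (R : pzRingType) (I : choiceType) (V : I -> lmodType R).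

Lemma dinjD i (v w : V i) : dinj (v + w) = dinj v + dinj w.
Proof.
apply: dsum_eqP => k; have [<-|ne] := eqVneq i k.
  by rewrite [RHS]/= -![dinj_comp _ _]/(dinj _ i) !dinj_id.
by rewrite [RHS]/= -![dinj_comp _ _]/(dinj _ k) !dinj_neq ?addr0.
Qed.

Lemma dinjZ i a (v : V i) : dinj (a *: v) = a *: dinj v.
Proof.
apply: dsum_eqP => k; have [<-|ne] := eqVneq i k.
  by rewrite [RHS]/= -![dinj_comp _ _]/(dinj _ i) !dinj_id.
by rewrite [RHS]/= -![dinj_comp _ _]/(dinj _ k) !dinj_neq ?scaler0.
Qed.

Lemma dsum_sum (J : Type) (r : seq J) (f : J -> dsum V) k :
  (\sum_(j <- r) f j) k = \sum_(j <- r) f j k.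
Proof. by elim: r => [|j r IH]; rewrite ?big_nil // !big_cons -IH. Qed.

Lemma dsum_decomp (x : dsum V) : exists s : seq I, x = \sum_(i <- s) dinj (x i).
Proof.
have [s xs] := dcomp_fin x; exists (undup s); apply: dsum_eqP => k.
rewrite dsum_sum; have [ks|ks] := boolP (k \in s).
  rewrite (bigD1_seq k) ?mem_undup ?undup_uniq //= -[dinj_comp _ _]/(dinj _ k) dinj_id.
  by rewrite big1 ?addr0 // => i ik; rewrite -[dinj_comp _ _]/(dinj _ k) dinj_neq.
rewrite xs // big_seq big1 // => i; rewrite mem_undup => ii.
by rewrite dinj_neq //; apply: contraNneq ks => <-.
Qed.

End DirectSums.

Section SubalgebraOfDdot.
Variables (n : nat) (phi : Theta n -> Theta n -> Theta n -> {poly int}).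
Hypothesis hphi : is_hall_polynomials phi.
Implicit Types (A B C : Theta n) (l m k : Zn n).
Notation DD := (DD phi).
Notation up := (up phi).
Notation um := (um phi).
Notation Ddot := (Ddot phi).
Implicit Types (t u : DD) (x y z : Ddot).

Lemma dpiD l m t u : dpi l m (t + u) = dpi l m t + dpi l m u.
Proof. by rewrite /dpi wpiD; exact: (@dinjD _ _ (fun p => wD phi p.1 p.2 : lmodType Qv) (l, m)). Qed.

Lemma dpiZ l m c t : dpi l m (c *: t) = c *: dpi l m t.
Proof. by rewrite /dpi wpiZ; exact: (@dinjZ _ _ (fun p => wD phi p.1 p.2 : lmodType Qv) (l, m)). Qed.

Lemma dpi0 l m : dpi l m 0 = 0 :> Ddot.
Proof. by rewrite -[0 in LHS](scale0r (0 : DD)) dpiZ scale0r. Qed.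

Lemma dpi_sum l m (I : Type) (r : seq I) (f : I -> DD) :
  dpi l m (\sum_(i <- r) f i) = \sum_(i <- r) dpi l m (f i).
Proof. by apply: (big_morph (dpi l m)); [apply: dpiD|apply: dpi0]. Qed.

Lemma dpi_wpi l m t u : wpi l m t = wpi l m u -> dpi l m t = dpi l m u.
Proof. by rewrite /dpi => ->. Qed.

Lemma wmulDl l m k (x x' : wD phi l m) (y : wD phi m k) :
  wmul (x + x') y = wmul x y + wmul x' y.
Proof.
have [t ht <-] := wD_homog x; have [t' ht' <-] := wD_homog x'.
have [u hu <-] := wD_homog y.
by rewrite -wpiD !wmulE ?mulrDl ?wpiD //; apply: homog_D.
Qed.

Lemma wmulDr l m k (x : wD phi l m) (y y' : wD phi m k) :
  wmul x (y + y') = wmul x y + wmul x y'.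
Proof.
have [t ht <-] := wD_homog x; have [u hu <-] := wD_homog y.
have [u' hu' <-] := wD_homog y'.
by rewrite -wpiD !wmulE ?mulrDr ?wpiD //; apply: homog_D.
Qed.

(** Replaces the sum over all middle weights by one over a fixed finite set, so that sums for
    different factors can be added. *)
Lemma ddmul_fset (r : {fset (Zn n)}) x y l k :
  (forall m, m \notin r -> x (l, m) = 0) ->
  ddmul x y (l, k) = \sum_(m <- r) (wmul (x (l, m)) (y (m, k)) : wD phi l k).
Proof.
by move=> xr; rewrite ddmulP; apply: fsbigTE => m /xr ->; apply: wmul0l.
Qed.

Lemma row_support x : exists r : {fset (Zn n)}, forall l m, m \notin r -> x (l, m) = 0.
Proof.
have [s xs] := dcomp_fin x; exists [fset p.2 | p in s]%fset => l m mr.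
by apply: xs; apply: contra mr => lms; apply/imfsetP; exists (l, m).
Qed.

Lemma ddmulDl x y z : ddmul (x + y) z = ddmul x z + ddmul y z.
Proof.
have [r xr] := row_support x; have [r' yr] := row_support y.
apply: dsum_eqP => -[l k].
have xr' m : m \notin (r `|` r')%fset -> x (l, m) = 0.
  by rewrite in_fsetU negb_or => /andP[/(xr l)].
have yr' m : m \notin (r `|` r')%fset -> y (l, m) = 0.
  by rewrite in_fsetU negb_or => /andP[_ /(yr l)].
have e : (ddmul x z + ddmul y z) (l, k) = ddmul x z (l, k) + ddmul y z (l, k) by [].
rewrite e !(ddmul_fset (r := (r `|` r')%fset)) //; last first.
  by move=> m mr; rewrite [LHS]/= xr' // yr' // addr0.
by rewrite -big_split; apply: eq_bigr => m _; exact: wmulDl.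
Qed.

Lemma ddmulDr x y z : ddmul x (y + z) = ddmul x y + ddmul x z.
Proof.
have [r xr] := row_support x; apply: dsum_eqP => -[l k].
have e : (ddmul x y + ddmul x z) (l, k) = ddmul x y (l, k) + ddmul x z (l, k) by [].
rewrite e !(ddmul_fset (r := r)) => [|m|m|m]; try exact: xr.
by rewrite -big_split; apply: eq_bigr => m _; exact: wmulDr.
Qed.

Lemma ddmul0l z : ddmul 0 z = 0.
Proof. by apply: (addrI (ddmul 0 z)); rewrite -ddmulDl !addr0. Qed.

Lemma ddmul0r x : ddmul x 0 = 0.
Proof. by apply: (addrI (ddmul x 0)); rewrite -ddmulDr !addr0. Qed.

Lemma ustdE A l B : ustd phi A l B
  = (vv ^ norm_exp A * vv ^ norm_exp B) *: dpi (l + degv A) (l + degv B) (up A * um B).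
Proof.
rewrite /ustd /bimod opprK mulr1 /upt /umt -presented_scaleAl -presented_scaleAr scalerA.
by rewrite dpiZ.
Qed.

Lemma homog_upum A B : homog (degv A - degv B) (up A * um B).
Proof. by apply: homog_M; [apply: homog_up|apply: homog_um]. Qed.

Lemma homog_upum_weight A B l : homog (l + degv A - (l + degv B)) (up A * um B).
Proof. by rewrite opprD addrACA subrr add0r; apply: homog_upum. Qed.

Section Coefficients.
Variable S : {pred Qv}.
Hypotheses (SM : forall a b, a \in S -> b \in S -> a * b \in S)
           (Slau : {subset lau <= S}).

Definition ustd_span x : Prop :=
  exists s : seq (Qv * (Theta n * Zn n * Theta n)),
    (forall p, p \in s -> p.1 \in S)
    /\ x = \sum_(p <- s) p.1 *: ustd phi p.2.1.1 p.2.1.2 p.2.2.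

Lemma ustd_span0 : ustd_span 0. Proof. by exists [::]; rewrite big_nil. Qed.

Lemma ustd_spanD x y : ustd_span x -> ustd_span y -> ustd_span (x + y).
Proof.
move=> [s [sS ->]] [s' [sS' ->]]; exists (s ++ s'); rewrite big_cat; split=> // p.
by rewrite mem_cat => /orP[/sS|/sS'].
Qed.

Lemma ustd_spanZ c x : c \in S -> ustd_span x -> ustd_span (c *: x).
Proof.
move=> cS [s [sS ->]]; exists [seq (c * p.1, p.2) | p <- s]; split=> [p|].
  by move=> /mapP[r rs ->] /=; apply: SM => //; apply: sS.
by rewrite scaler_sumr big_map; apply: eq_bigr => p _; rewrite scalerA.
Qed.

Lemma ustd_span_sum (I : eqType) (r : seq I) (f : I -> Ddot) :
  (forall i, i \in r -> ustd_span (f i)) -> ustd_span (\sum_(i <- r) f i).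
Proof.
elim: r => [|i r IH] H; first by rewrite big_nil; apply: ustd_span0.
rewrite big_cons; apply: ustd_spanD; first by apply: H; rewrite mem_head.
by apply: IH => j jr; apply: H; rewrite inE jr orbT.
Qed.

(** Unless its degree is l - m the element vanishes; otherwise it is, up to a power of v, the
    standard element of weight l - deg u^+_A. *)
Lemma ustd_span_dpi_gen l m A B : ustd_span (dpi l m (up A * um B)).
Proof.
have [e|ne] := eqVneq (degv A - degv B) (l - m); last first.
  have -> : dpi l m (up A * um B) = 0; last exact: ustd_span0.
  rewrite -(dpi0 l m); apply: dpi_wpi.
  by rewrite (wpi_homog0 (homog_upum A B)) // wpi0.
exists [:: (vv ^ (- (norm_exp A + norm_exp B)), (A, l - degv A, B))].
split=> [p|]; first by rewrite inE => /eqP -> /=; apply/Slau/lau_vv.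
rewrite big_seq1 /= ustdE scalerA -!vvD addNr expr0z scale1r subrK.
congr (dpi _ _ _); apply: (addIr (- degv B)); rewrite addrK.
by apply: (addrI (degv A)); rewrite addrCA e addrCA subrr addr0 addrC subrK.
Qed.

Lemma ustd_span_dpi l m t : inspan S (wpi l m t) -> ustd_span (dpi l m t).
Proof.
move=> [s [sS e]].
rewrite (dpi_wpi (u := \sum_(p <- s) p.1 *: (up p.2.1 * um p.2.2))); last first.
  by rewrite e wpi_sum; apply: eq_bigr => p _; rewrite wpiZ.
rewrite dpi_sum; apply: ustd_span_sum => p ps; rewrite dpiZ.
by apply: ustd_spanZ; [apply: sS|apply: ustd_span_dpi_gen].
Qed.

Lemma ustd_span_ddmul x y : ustd_span x -> ustd_span y -> ustd_span (ddmul x y).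
Proof.
move=> [s [sS ->]] [s' [sS' ->]].
rewrite (big_morph (fun x => ddmul x _) (fun a b => ddmulDl a b _) (ddmul0l _)).
apply: ustd_span_sum => p ps; rewrite (big_morph (ddmul _) (ddmulDr _) (ddmul0r _)).
apply: ustd_span_sum => p' ps'; rewrite !ustdE !scalerA -!dpiZ.
rewrite ddmulE; try by apply: homog_Z; apply: homog_upum_weight.
case: eqP => _; last exact: ustd_span0.
rewrite -presented_scaleAl -presented_scaleAr !dpiZ.
have Sc q : q \in S -> forall a b : int, q * (vv ^ a * vv ^ b) \in S.
  by move=> qS a b; apply: SM => //; apply: Slau; rewrite rpredM ?lau_vv.
apply: ustd_spanZ; first by apply: Sc; apply: sS.
apply: ustd_spanZ; first by apply: Sc; apply: sS'.
by apply: ustd_span_dpi; apply: inW_product.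
Qed.

End Coefficients.

Lemma intDP x : intD x <-> ustd_span lau x.
Proof.
split=> -[s [sL ->]]; exists s; split=> // p /sL; first by move/lauP.
by move/lauP.
Qed.

Lemma lauM (a b : Qv) : a \in lau -> b \in lau -> a * b \in lau.
Proof. exact: rpredM. Qed.

Lemma intD_subalgebra : is_subalgebra (@ddmul n phi) (@intD n phi).
Proof.
split; last first.
  by move=> x y /intDP xL /intDP yL; apply/intDP; apply: ustd_span_ddmul lauM _ _ _ xL yL.
split=> [|x y /intDP xL /intDP yL|c x /lauP cL /intDP xL]; apply/intDP.
- exact: ustd_span0.
- exact: ustd_spanD.
- exact: ustd_spanZ lauM _ _ cL xL.
Qed.

Lemma ustd_span_all x : ustd_span predT x.
Proof.
have [s ->] := dsum_decomp x; apply: ustd_span_sum => -[l m] _.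
have [t <-] : exists t, wpi l m t = x (l, m) by exists (wrepr (x (l, m))); apply: wreprK.
by apply: ustd_span_dpi => //; apply: inW_all.
Qed.

Lemma intD_denominator x : exists d : Qv, [/\ d \in lau, d != 0 & intD (d *: x)].
Proof.
have [s [_ ->]] := ustd_span_all x.
have [d dL [d0 ds]] := common_denominators [seq p.1 | p <- s]; exists d; split=> //.
apply/intDP; rewrite scaler_sumr; exists [seq (d * p.1, p.2) | p <- s].
split=> [p /mapP[q qs ->]|]; first by apply: ds; apply: map_f.
by rewrite big_map; apply: eq_bigr => p _; rewrite scalerA.
Qed.

End SubalgebraOfDdot.

Section ScalarExtension.
Variables (V : lmodType Qv) (L : V -> Prop).
Hypothesis subL : is_submodule L.
Hypothesis denom : forall x, exists d : Qv, [/\ d \in lau, d != 0 & L (d *: x)].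

(** Any factorisation must send x to [beta] (d x) d^-1 for a denominator d of x, which gives
    uniqueness. Balancedness shows that the value does not depend on d. *)
Lemma scalar_extension_of_denominators : is_scalar_extension L.
Proof.
move=> W beta [bDl bDr bZ]; have [L0 LD LZ] := subL.
have [den denP] := choice denom.
pose g x := beta (den x *: x) (den x)^-1.
have gE x d : d \in lau -> d != 0 -> L (d *: x) -> g x = beta (d *: x) d^-1.
  move=> /lauP dL d0 Ldx; have [/lauP eL e0 Lex] := denP x; rewrite /g.
  (* Two denominators are compared through their product. *)
  have H (a b : Qv) : laurent a -> a != 0 -> b != 0 -> L (b *: x) ->
      beta (b *: x) b^-1 = beta (a *: (b *: x)) (a * b)^-1.
    by move=> aL a0 b0 Lbx; rewrite (bZ a _ _ aL Lbx) (@mulf_invM Qv a b a0).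
  by rewrite (H d (den x)) // [RHS](H (den x) d) // !scalerA [d * _]mulrC.
have gB : zmod_morphism g.
  move=> x y; have [dL d0 Lx] := denP x; have [eL e0 Ly] := denP y.
  pose d := den x * den y.
  have dl : d \in lau by apply: lauM.
  have dn0 : d != 0 by apply: (@mulf_neq0 Qv _ _ d0 e0).
  have Ldx : L (d *: x) by rewrite /d mulrC -scalerA; apply: LZ => //; apply/lauP.
  have Ldy : L (d *: y) by rewrite /d -scalerA; apply: LZ => //; apply/lauP.
  have m1L : laurent (-1) by apply/lauP; rewrite rpredN rpred1.
  have LNy : L (- (d *: y)) by rewrite -scaleN1r; apply: LZ.
  have Ldxy : L (d *: (x - y)) by rewrite scalerBr; apply: LD.
  rewrite (gE _ d) // (gE x d) // (gE y d) // scalerBr bDl //; congr (_ + _).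
  have b0 : beta 0 d^-1 = 0.
    by apply: (addrI (beta 0 d^-1)); rewrite addr0 -bDl // addr0.
  by apply/eqP; rewrite -addr_eq0 -bDl // addNr b0.
pose G : {additive V -> W} :=
  HB.pack g (GRing.isZmodMorphism.Build V W g gB).
exists G => [x c Lx|g' Hg' x].
  (* A denominator d of c works for c x; the Laurent scalar d c then moves to the second argument,
     where d d^-1 cancels. *)
  have [d dL [d0 dc]] := common_denominator c.
  have Ldc : L (d *: (c *: x)) by rewrite scalerA; apply: LZ => //; apply/lauP.
  rewrite -[LHS]/(g (c *: x)) (gE _ d) // scalerA bZ //; last exact/lauP.
  by rewrite (@mulf_conj Qv).
have [dL d0 Lx] := denP x; rewrite -[RHS]/(beta (den x *: x) (den x)^-1) -Hg' //.
by rewrite scalerA (@mulVf Qv _ d0) scale1r.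
Qed.

End ScalarExtension.

(** * An approximate module of functions on subrepresentations *)

Section CountingSubspaces.
Variable F : finFieldType.
Notation q := (#|F|%:R : rat).

Lemma card_F_gt1 : (1 < #|F|)%N.
Proof.
by rewrite (cardD1 0) (cardD1 1) !inE oner_neq0.
Qed.

Lemma qF0 : q != 0.
Proof. by rewrite pnatr_eq0 -lt0n ltnW // card_F_gt1. Qed.

Lemma qF_inf k : (0 < k)%N -> q ^+ k != 1.
Proof.
move=> k0; rewrite -natrX -[1]/(1%:R) eqr_nat -(expn0 #|F|) eqn_exp2l ?card_F_gt1 //.
by rewrite -lt0n.
Qed.

Lemma card_row_space d (M : 'M[F]_d) :
  #|[pred w : 'rV[F]_d | (w <= M)%MS]| = (#|F| ^ \rank M)%N.
Proof.
have inj := row_free_inj (row_base_free M).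
rewrite -[in RHS](mul1n (\rank M)) -(card_mx F 1 (\rank M)).
rewrite -(card_imset predT (inj 1%N)); apply: eq_card => w.
rewrite inE; apply/idP/imsetP => [|[u _ ->]].
  by rewrite -(eq_row_base M) => /submxP[D ->]; exists D.
by rewrite -(eq_row_base M) submxMl.
Qed.

Lemma rank_add_vector d (M : 'M[F]_d) (w : 'rV_d) : ~~ (w <= M)%MS ->
  \rank (M + w)%MS = (\rank M).+1.
Proof.
move=> wM; apply/eqP; rewrite eqn_leq; apply/andP; split.
  apply: leq_trans (mxrank_adds_leqif M w).1 _.
  by rewrite -[(\rank M).+1]addn1 leq_add2l rank_leq_row.
apply: rank_ltmx; rewrite ltmxE addsmxSl.
by apply: contra wM => /(submx_trans (addsmxSr _ _)).
Qed.

Definition subspace_pred d (M R : 'M[F]_d) j : pred 'M[F]_d :=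
  fun X => [&& <<X>>%MS == X, (M <= X)%MS, (X <= R)%MS & \rank X == (\rank M + j)%N].

(** Pairs of a subspace X and a vector w in X outside M are counted twice: the number of w is the
    same for each X, and for fixed w the X lie above M + w with one dimension less to choose. *)
Lemma card_subspaces d (M R : 'M[F]_d) j : (M <= R)%MS ->
  #|subspace_pred M R j|%:R = gauss q (q ^+ (\rank R - \rank M)) j.
Proof.
elim: j M => [|j IH] M MR.
  rewrite gauss0; apply: (congr1 (fun k => k%:R) (_ : _ = 1%N)).
  rewrite -(card1 <<M>>%MS); apply: eq_card => X.
  rewrite !inE /subspace_pred unfold_in addn0; apply/and4P/eqP => [[/eqP cX MX XR rX]|->].
    rewrite -cX; apply/genmxP; apply/andP; split; last exact: MX.
    by rewrite -(geq_leqif (mxrank_leqif_sup MX)) (eqP rX).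
  by rewrite genmx_id !genmxE submx_refl MR; split.
pose P := subspace_pred M R j.+1.
have inX X : P X -> #|[pred w : 'rV[F]_d | (w <= X)%MS && ~~ (w <= M)%MS]|
    = (#|F| ^ (\rank M + j.+1) - #|F| ^ \rank M)%N.
  move=> /and4P[_ MX _ /eqP rX]; rewrite -rX -!card_row_space.
  rewrite -(cardID [pred w : 'rV[F]_d | (w <= M)%MS] [pred w : 'rV[F]_d | (w <= X)%MS]).
  have -> : #|[predI [pred w : 'rV[F]_d | (w <= X)%MS] & [pred w : 'rV[F]_d | (w <= M)%MS]]|
     = #|[pred w : 'rV[F]_d | (w <= M)%MS]|.
    apply: eq_card => w; rewrite !inE andbC; case: (boolP (w <= M)%MS) => //= wM.
    by apply: submx_trans wM MX.
  by rewrite addKn; apply: eq_card => w; rewrite !inE andbC.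
have onw (w : 'rV[F]_d) : (w <= R)%MS -> ~~ (w <= M)%MS ->
    #|[pred X | P X && (w <= X)%MS]|%:R = gauss q (q ^+ (\rank R - (\rank M).+1)) j.
  move=> wR wM; rewrite -(rank_add_vector wM) -IH; last by rewrite addsmx_sub MR.
  congr _%:R; apply: eq_card => X; rewrite !inE /P /subspace_pred unfold_in.
  rewrite rank_add_vector // addSnnS addsmx_sub.
  by case: (_ == X) => //=; case: (M <= X)%MS => //=; case: (X <= R)%MS; rewrite ?andbF //= andbC.
have double : (#|P| * (#|F| ^ (\rank M + j.+1) - #|F| ^ \rank M)
   = \sum_(w : 'rV[F]_d | (w <= R)%MS && ~~ (w <= M)%MS) #|[pred X | P X && (w <= X)%MS]|)%N.
  rewrite -sum_nat_const (eq_bigr _ (fun X PX => esym (inX X PX))).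
  under eq_bigr => X _ do rewrite -sum1_card.
  rewrite (exchange_big_dep (fun w : 'rV[F]_d => (w <= R)%MS && ~~ (w <= M)%MS)) /=.
    apply: eq_bigr => w /andP[wR wM]; rewrite -sum1_card; apply: eq_bigl => X.
    by rewrite !inE wM andbT.
  by move=> X w /and4P[_ _ XR _] /andP[wX ->]; rewrite (submx_trans wX XR).
have cardw : #|[pred w : 'rV[F]_d | (w <= R)%MS && ~~ (w <= M)%MS]|
    = (#|F| ^ \rank R - #|F| ^ \rank M)%N.
  rewrite -!card_row_space.
  rewrite -(cardID [pred w : 'rV[F]_d | (w <= M)%MS] [pred w : 'rV[F]_d | (w <= R)%MS]).
  have -> : #|[predI [pred w : 'rV[F]_d | (w <= R)%MS] & [pred w : 'rV[F]_d | (w <= M)%MS]]|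
     = #|[pred w : 'rV[F]_d | (w <= M)%MS]|.
    apply: eq_card => w; rewrite !inE andbC; case: (boolP (w <= M)%MS) => //= wM.
    by apply: submx_trans wM MR.
  by rewrite addKn; apply: eq_card => w; rewrite !inE andbC.
have F0 : (0 < #|F|)%N := ltnW card_F_gt1.
have d2 (g : rat) : (forall w : 'rV[F]_d, (w <= R)%MS -> ~~ (w <= M)%MS ->
      #|[pred X | P X && (w <= X)%MS]|%:R = g) ->
    #|P|%:R * (q ^+ (\rank M + j.+1) - q ^+ \rank M) = (q ^+ \rank R - q ^+ \rank M) * g.
  move=> {}onw.
  rewrite -!natrX -!natrB ?leq_pexp2l ?leq_addr ?mxrankS // -natrM double natr_sum.
  rewrite (eq_bigr (fun=> g)).
    by rewrite sumr_const -cardw mulr_natl.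
  by move=> w /andP[wR wM]; rewrite onw.
have q0 := qF0; have qj : q ^+ j.+1 - 1 != 0 by rewrite subr_eq0 qF_inf.
have qm : q ^+ \rank M != 0 by rewrite expf_neq0.
apply: (mulIf (_ : q ^+ (\rank M + j.+1) - q ^+ \rank M != 0)).
  by rewrite exprD -[X in _ - X]mulr1 -mulrBr mulf_neq0.
rewrite -/P (d2 _ onw); have := mxrankS MR; rewrite leq_eqVlt => /orP[/eqP e|lt].
  by rewrite -e subrr mul0r subnn gauss_eq0 ?mul0r.
have -> : (\rank R - \rank M)%N = (\rank R - (\rank M).+1).+1 by rewrite -subSn.
rewrite [q ^+ _.+1 in RHS]exprS gauss_shift ?qF0 //; last exact: qF_inf.
have -> : q ^+ \rank R = q ^+ \rank M * (q * q ^+ (\rank R - (\rank M).+1)).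
  by rewrite -exprS -exprD -subSn // subSS subnKC // ltnW.
have alg (g a b c x : rat) : b - 1 != 0 ->
    (a * (x * c) - a) * g = g * (x * c - 1) / (b - 1) * (a * b - a).
  by move=> b1; field.
by rewrite exprD; apply: alg.
Qed.

Lemma gauss_codim c k : (k <= c)%N ->
  gauss q (q ^+ c) (c - k) = gauss q (q ^+ c) k.
Proof.
move=> kc; have gs := gauss_sym qF0 c k (c - k).
have g1 a : gauss q (q ^+ a) a = 1.
  by rewrite /gauss -[ff _ _ _]/(gl q a) mulfV // gl_neq0 ?qF0 //; apply: qF_inf.
by move: gs; rewrite subKn // !g1 !mulr1.
Qed.

End CountingSubspaces.

Section CountingSubrepresentations.
Variables (F : finFieldType) (n : nat) (V : rep F n).
Notation q := (#|F|%:R : rat).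
Notation subspaces V := {dffun forall v : 'I_n, 'M[F]_(rdim V v)}.
Implicit Types (X Y L : fam V).

(** As the arrows map Y into X, every family of subspaces between X and Y is stable, and the
    vertices contribute independently. *)
Lemma card_between X Y (k : 'I_n -> nat) : fle X Y -> fle (push Y) X ->
  #|[pred N : subspaces V | [&& is_subrep N, `[< fle X N /\ fle N Y >] &
      [forall v, \rank (N v) == (\rank (X v) + k v)%N]]]|%:R
  = \prod_v gauss q (q ^+ (\rank (Y v) - \rank (X v))) (k v).
Proof.
move=> XY YX; under eq_bigr => v _ do rewrite -card_subspaces //.
rewrite -natr_prod; congr _%:R.
have := @card_family 'I_n (fun v => 'M[F]_(rdim V v) : finType)
  (fun v => subspace_pred (X v) (Y v) (k v)).
rewrite foldrE big_map big_enum => <-; apply: eq_card => N; rewrite inE.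
apply/and3P/familyP => [[/is_subrepP[cN _] /asboolP[XN NY] /forallP rN] v|H].
  by rewrite /subspace_pred unfold_in cN eqxx XN NY rN.
have {}H v := and4P (H v).
have XN : fle X N by move=> v; case: (H v).
have NY : fle N Y by move=> v; case: (H v).
split; first 1 last.
- exact/asboolP.
- by apply/forallP => v; case: (H v).
apply/is_subrepP; split=> [v|]; first by case: (H v) => /eqP.
by apply: fle_trans (push_mono NY) (fle_trans YX XN).
Qed.

Lemma typ_AdiagP X L (b : Nn n) : fle X L -> stable X ->
  typ L X (Adiag b) <-> fle (push L) X /\ forall v, \rank (L v) = (\rank (X v) + b v)%N.
Proof.
move=> XL sX; have e0 v : \rank (L v + X v)%MS = \rank (L v).
  by apply: eqmx_rankE; apply/addsmx_idPl.
split=> [tL|[LX rL] [|k] v]; rewrite ?rA_Adiag /=.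
- split=> [|v]; first exact: typ_Adiag tL.
  by have := tL 0%N v; rewrite /= rA_Adiag e0.
- by rewrite e0 rL.
- rewrite addn0; apply: eqmx_rankE; apply/addsmx_idPr.
  have H : fle (pw k.+1 L) X.
    elim: k => [|k IH] //=; apply: fle_trans (push_mono IH) _; exact: sX.
  exact: H v.
Qed.

Definition preim X : fam V := fun v => kermx (rarr V v *m cokermx (X (ordS v))).
Definition nullity v : nat := \rank (kermx (rarr V v)).

Lemma sub_preim m v (Z : 'M[F]_(m, rdim V v)) X :
  (Z <= preim X v)%MS = (Z *m rarr V v <= X (ordS v))%MS.
Proof.
rewrite /preim [RHS]submxE -mulmxA; apply/sub_kermxP/eqP => //.
Qed.

Lemma rank_push L v : (kermx (rarr V v) <= L v)%MS ->
  (\rank (push L (ordS v)) + nullity v = \rank (L v))%N.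
Proof.
move=> kL; rewrite (eqmx_rankE (pushE L v)) -(mxrank_mul_ker (L v) (rarr V v)).
by congr (_ + _)%N; apply/esym/eqmx_rankE/capmx_idPr.
Qed.

Lemma rank_preim X v : (X (ordS v) <= push (full V) (ordS v))%MS ->
  \rank (preim X v) = (nullity v + \rank (X (ordS v)))%N.
Proof.
rewrite pushE /full mul1mx => Xim.
have := mxrank_mul_ker (preim X v) (rarr V v).
have -> : \rank (preim X v *m rarr V v) = \rank (X (ordS v)).
  apply: eqmx_rankE; apply/eqmxP; rewrite -sub_preim submx_refl /=.
  have /submxP[D XD] := Xim; rewrite XD submxMr // sub_preim -XD //.
have -> : \rank (preim X v :&: kermx (rarr V v))%MS = nullity v.
  apply: eqmx_rankE; apply/capmx_idPr; rewrite sub_preim.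
  by have /sub_kermxP -> : (kermx (rarr V v) <= kermx (rarr V v))%MS by []; apply: sub0mx.
by move=> <-; rewrite addnC.
Qed.

End CountingSubrepresentations.

(* D acts on functions on the subrepresentations of mV, with v specialised to *)
(* mm: u_A^+ (resp. u_A^-) sums over the subrepresentations below (resp.      *)
(* above) the given one with quotient M(A), and K_i multiplies by a power of  *)
(* mm. By mV_nilp and mV_preim all strings of mV have length mH + 1.          *)
Record model (n : nat) := Model {
  mF : finFieldType;
  mm : nat;
  mm_gt0 : (0 < mm)%N;
  mF_card : #|mF| = (mm ^ 2)%N;
  mV : rep mF n;
  mH : nat;
  mc : int;
  mV_nilp : fle (pw mH.+1 (full mV)) (fzero mV);
  mV_preim : forall v d p (X : 'M_(p, rdim mV v)), (d <= mH)%N ->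
    (X *m rarr mV v <= pw d.+1 (full mV) (ordS v))%MS -> (X <= pw d (full mV) v)%MS }.

(** A chosen upper bound for the lengths of the strings of A; it bounds how far u_A moves a
    subrepresentation along the strings. *)
Definition ht n (A : Theta n) : nat := projT1 (cid (rA_large A)).

Lemma htP n (A : Theta n) k v : (ht A <= k)%N -> rA A k v = 0%N.
Proof. by rewrite /ht; case: (cid _) => K H; apply: H. Qed.

(** The argument shared by u^+ u^+ and u^- u^-: the two ends L and L2 determine the type C0 of their
    subquotient, and the number of intermediate L1 is its Hall number. *)
Lemma sum_of_products (T : finType) (Th : eqType) (r : Th -> T -> T -> bool)
    (w : T -> T -> rat) (h : Th -> rat) (A B : Th) (e : rat) (s : seq Th) (L : T) f :
    uniq s -> (forall C, C \notin s -> h C = 0) ->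
    (forall L1 L2, r A L L1 -> r B L1 L2 -> w L L1 * w L1 L2 = e * w L L2) ->
    (forall L2, exists C0, [/\ forall C, r C L L2 -> C = C0,
        (r C0 L L2 = false) -> forall L1, r A L L1 && r B L1 L2 = false &
        r C0 L L2 -> #|[pred L1 | r A L L1 && r B L1 L2]|%:R = h C0]) ->
  \sum_(L1 | r A L L1) w L L1 * (\sum_(L2 | r B L1 L2) w L1 L2 * f L2)
  = \sum_(C <- s) (e * h C) * \sum_(L2 | r C L L2) w L L2 * f L2.
Proof.
move=> us h0 wE HC.
transitivity (\sum_L2 \sum_(L1 | r A L L1 && r B L1 L2) e * w L L2 * f L2).
  under eq_bigr => L1 _ do rewrite mulr_sumr.
  rewrite (exchange_big_dep predT) //=; apply: eq_bigr => L2 _.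
  by apply: eq_bigr => L1 /andP[r1 r2]; rewrite mulrA wE.
under [RHS]eq_bigr => C _ do rewrite mulr_sumr.
rewrite [RHS](exchange_big_dep predT) //=; apply: eq_bigr => L2 _.
have [C0 [Cu Cn Cc]] := HC L2; rewrite sumr_const.
have [r0|nr0] := boolP (r C0 L L2); last first.
  rewrite (eq_card0 (fun L1 => Cn (negbTE nr0) L1)) mulr0n big1 // => C rC.
  by case/negP: nr0; rewrite -(Cu C rC).
have [Cs|nCs] := boolP (C0 \in s).
  rewrite big_mkcond (bigD1_seq C0) //= r0.
  rewrite big1 ?addr0 => [|C ne]; last by case: ifP => // /Cu e'; rewrite e' eqxx in ne.
  by rewrite -mulr_natl (Cc r0) !mulrA [h C0 * e]mulrC.
have z := h0 C0 nCs; rewrite -mulr_natl (Cc r0) z mul0r big_seq_cond big1 // => C.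
by move=> /andP[Cs rC]; rewrite (Cu C rC) z mulr0 mul0r.
Qed.

Section Operators.
Variables (n : nat) (M : model n).
Notation F := (mF M).
Notation V := (mV M).
Notation H := (mH M).
Notation m := ((mm M)%:R : rat).
Notation sub := {dffun forall v : 'I_n, 'M[F]_(rdim V v)}.
Notation R k := (pw k (full V)).
Implicit Types (L N : sub) (f g : sub -> rat) (A B C : Theta n).

Definition zr L : Zn n := [ffun v => (\rank (L v))%:Z].
Definition rho : Zn n := [ffun v => (nullity V (ord_pred v))%:Z].
(** When L contains the kernels of the arrows, this is the dimension vector of L modulo its radical,
    by [rank_push]. *)
Definition kap L : Zn n := [ffun v => rho v + zr L v - zr L (ord_pred v)].
Definition ell : Zn n := [ffun v => 2 - rho v - rho (ordS v)].

Definition r_up A L N : bool := is_subrep N && `[< fle N L /\ typ L N A >].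
Definition r_dn A L N : bool := is_subrep N && `[< fle L N /\ typ N L A >].
Definition w_up L N : rat := m ^ eul (zr L - zr N) (zr N).
(** The Euler forms here and in [w_up] produce the twists of the Hall products. The linear part is
    additive along chains and does not affect these; [ell] is chosen so that the exponent of a
    product of both weights is [rescale] up to a term independent of b, see [weight_dn_up]. *)
Definition w_dn L N : rat := m ^ (dot ell (zr N - zr L) - eul (zr N) (zr N - zr L)).

Definition op_gen (g : gen n) f L : rat :=
  match g with
  | Up A => \sum_(N | r_up A L N) w_up L N * f N
  | Um A => \sum_(N | r_dn A L N) w_dn L N * f N
  | Kp i => m ^ (kap L i - mc M) * f L
  | Km i => m ^ (- (kap L i - mc M)) * f L
  end.

Fixpoint sem (x : term Qv (gen n)) f L : rat :=
  match x with
  | TZero => 0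
  | TOne => f L
  | TGen g => op_gen g f L
  | TAdd x y => sem x f L + sem y f L
  | TMul x y => sem x (sem y f) L
  | TScale c x => ev (mm M) c * sem x f L
  end.

Lemma m0 : m != 0. Proof. by rewrite pnatr_eq0 -lt0n mm_gt0. Qed.

Lemma mD (a b : int) : m ^ (a + b) = m ^ a * m ^ b.
Proof. by rewrite expfzDr ?m0. Qed.

Lemma sem_lin x a b f g L :
  sem x (fun N => a * f N + b * g N) L = a * sem x f L + b * sem x g L.
Proof.
elim: x f g L => [||[A|A|i|i]|x IHx y IHy|x IHx y IHy|c x IHx] f g L //=.
- by rewrite !mulr0 addr0.
- rewrite !mulr_sumr -big_split; apply: eq_bigr => N _ /=.
  by rewrite mulrDr; congr (_ + _); apply: mulrCA.
- rewrite !mulr_sumr -big_split; apply: eq_bigr => N _ /=.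
  by rewrite mulrDr; congr (_ + _); apply: mulrCA.
- by rewrite mulrDr; congr (_ + _); apply: mulrCA.
- by rewrite mulrDr; congr (_ + _); apply: mulrCA.
- by rewrite IHx IHy !mulrDr addrACA.
- rewrite -IHx; congr (sem x _ L); apply: functional_extensionality_dep => N.
  exact: IHy.
- by rewrite IHx mulrDr; congr (_ + _); apply: mulrCA.
Qed.

(* Relation (5) fails near the two ends of the strings. *)
Definition interior d L : Prop :=
  [/\ is_subrep L, (d <= H)%N, fle (R (H.+1 - d)) L & fle L (R d)].

Lemma interior_mono d e L : (d <= e)%N -> interior e L -> interior d L.
Proof.
move=> de [sL eH lo hi]; split=> //; first exact: leq_trans de eH.
  by apply: fle_trans (pw_anti (@stable_full _ _ V) _) lo; rewrite leq_sub2l.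
by apply: fle_trans hi _; apply: pw_anti; first exact: stable_full.
Qed.

Lemma interior_up A d L N : interior (d + ht A) L -> r_up A L N -> interior d N.
Proof.
move=> [sL dH lo hi] /andP[sN /asboolP[NL tA]].
have e := typ_nilp tA (fun k v => @htP _ A k v).
have dH' : (d <= H)%N := leq_trans (leq_addr _ _) dH.
split=> //.
  apply: fle_trans e; apply: fle_trans (pw_mono (ht A) lo).
  rewrite -iterD (_ : (ht A + (H.+1 - (d + ht A)) = H.+1 - d)%N); last by lia.
  exact: fle_refl.
apply: fle_trans NL (fle_trans hi _); apply: pw_anti; first exact: stable_full.
exact: leq_addr.
Qed.

Lemma preim_pw (L : fam V) d e : (d + e <= H.+1)%N ->
  fle (pw e L) (R (d + e)) -> fle L (R d).
Proof.
elim: e => [|e IH] de; first by rewrite addn0.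
rewrite addnS in de *; move=> Le; apply: IH; first exact: ltnW.
by move=> v; apply: mV_preim => //; have := Le (ordS v); rewrite /= pushE.
Qed.

(** Some power rad^e of N lies in L and so in rad^(d+e) of the whole; [mV_preim] pulls this back,
    step by step, to N inside rad^d. *)
Lemma interior_dn A d L N : interior (d + ht A) L -> r_dn A L N -> interior d N.
Proof.
move=> [sL dH lo hi] /andP[sN /asboolP[LN tA]].
have e := typ_nilp tA (fun k v => @htP _ A k v).
have dH' : (d <= H)%N := leq_trans (leq_addr _ _) dH.
split=> //.
  apply: fle_trans _ (fle_trans lo LN); apply: pw_anti; first exact: stable_full.
  by rewrite leq_sub2l // leq_addr.
by apply: (preim_pw (e := ht A)); [apply: leqW|apply: fle_trans e hi].
Qed.

Fixpoint ext (x : term Qv (gen n)) : nat :=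
  match x with
  | TZero | TOne => 0
  | TGen (Up A) | TGen (Um A) => ht A
  | TGen _ => 0
  | TAdd x y | TMul x y => ext x + ext y
  | TScale _ x => ext x
  end.

(** [ext x] bounds how far the operators in x reach, so errors near the ends stay invisible to L
    with a sufficient margin. *)
Lemma sem_local x d f g : (forall L, interior d L -> f L = g L) ->
  forall L, interior (d + ext x) L -> sem x f L = sem x g L.
Proof.
elim: x d f g => [||[A|A|i|i]|x IHx y IHy|x IHx y IHy|c x IHx] d f g fg L iL //=.
- by apply: fg; rewrite addn0 in iL.
- by apply: eq_bigr => N rN; rewrite fg //; apply: interior_up iL rN.
- by apply: eq_bigr => N rN; rewrite fg //; apply: interior_dn iL rN.
- by rewrite fg // -[d]addn0.
- by rewrite fg // -[d]addn0.
- rewrite (IHx d f g) // ?(IHy d f g) //; apply: interior_mono iL;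
    by rewrite /= leq_add2l ?leq_addr ?leq_addl.
- apply: (IHx (d + ext y)%N); last by rewrite -addnA [(ext y + _)%N]addnC.
  by move=> N; apply: IHy.
- by rewrite (IHx d f g).
Qed.

End Operators.

Arguments sem {n} M.
Arguments ext {n}.

(** Both d and m0 depend on x and y only and hold for all models, so a model may be chosen after an
    equality in the algebra has been given. *)
Definition eqv n (x y : term Qv (gen n)) : Prop :=
  exists d m0, forall M : model n, (m0 <= mm M)%N ->
    forall f L, interior d L -> sem M x f L = sem M y f L.

Section Congruence.
Variables (n : nat) (rel : term Qv (gen n) -> term Qv (gen n) -> Prop).
Hypothesis rel_eqv : forall x y, rel x y -> eqv x y.

Lemma eqv_exact (x y : term Qv (gen n)) :
  (forall M f L, sem M x f L = sem M y f L) -> eqv x y.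
Proof. by move=> H; exists 0%N, 0%N => M _ f L _; apply: H. Qed.

Lemma pcong_eqv x y : pcong rel x y -> eqv x y.
Proof.
elim=> {x y}.
- exact: rel_eqv.
- by move=> x; apply: eqv_exact.
- by move=> x y _ [d [k H]]; exists d, k => M kM f L iL; rewrite H.
- move=> x y z _ [d [k H]] _ [d' [k' H']]; exists (maxn d d'), (maxn k k') => M.
  rewrite geq_max => /andP[kM kM'] f L iL.
  rewrite H ?H' //; apply: interior_mono iL; by rewrite ?leq_maxl ?leq_maxr.
- move=> x x' y y' _ [d [k H]] _ [d' [k' H']]; exists (maxn d d'), (maxn k k') => M.
  rewrite geq_max => /andP[kM kM'] f L iL /=.
  by rewrite H ?H' //; apply: interior_mono iL; rewrite ?leq_maxl ?leq_maxr.
- move=> x x' y y' _ [d [k H]] _ [d' [k' H']].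
  (* The equality for the second factor is needed at all places reached by x, hence the additional
     margin. *)
  exists (maxn d (d' + ext x)), (maxn k k') => M.
  rewrite geq_max => /andP[kM kM'] f L iL /=.
  rewrite (@sem_local _ M x d' (sem M y f) (sem M y' f)).
  + by rewrite H //; apply: interior_mono iL; rewrite leq_maxl.
  + by move=> N iN; apply: H'.
  + by apply: interior_mono iL; rewrite leq_maxr.
- move=> c x x' _ [d [k H]]; exists d, k => M kM f L iL /=.
  by rewrite H.
- by move=> x y z; apply: eqv_exact => M f L /=; rewrite addrA.
- by move=> x y; apply: eqv_exact => M f L /=; rewrite addrC.
- by move=> x; apply: eqv_exact => M f L /=; rewrite add0r.
- move=> x; have [k Hk] := isevN isev1; exists 0%N, k => M kM f L _ /=.
  by rewrite Hk // mulN1r addNr.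
- by move=> x y z; apply: eqv_exact.
- by move=> x; apply: eqv_exact.
- by move=> x; apply: eqv_exact.
- by move=> x y z; apply: eqv_exact.
- move=> x y z; apply: eqv_exact => M f L /=.
  have := sem_lin x 1 1 (sem M y f) (sem M z f) L; rewrite !mul1r => <-.
  congr (sem M x _ L); apply: functional_extensionality_dep => N.
  by rewrite !mul1r.
- move=> a b x.
  have [k Hk] : isev (a * b) (fun m => ev m a * ev m b).
    by apply: isevM; exists 0%N.
  by exists 0%N, k => M kM f L _ /=; rewrite Hk // mulrA.
- move=> x; have [k Hk] := isev1; exists 0%N, k => M kM f L _ /=.
  by rewrite Hk // mul1r.
- by move=> a x y; apply: eqv_exact => M f L /=; rewrite mulrDr.
- move=> a b x.
  have [k Hk] : isev (a + b) (fun m => ev m a + ev m b).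
    by apply: isevD; exists 0%N.
  by exists 0%N, k => M kM f L _ /=; rewrite Hk // mulrDl.
- by move=> a x y; apply: eqv_exact.
- move=> a x y; apply: eqv_exact => M f L /=.
  have := sem_lin x (ev (mm M) a) 0 (sem M y f) (sem M y f) L.
  rewrite mul0r addr0 => <-; congr (sem M x _ L).
  by apply: functional_extensionality_dep => N; rewrite mul0r addr0.
Qed.

End Congruence.

Section EulerForm.
Variable n : nat.
Implicit Types (a b c : Zn n).

Lemma eulDl a b c : eul (a + b) c = eul a c + eul b c.
Proof.
rewrite /eul addrACA -opprD -!big_split /=; congr (_ - _);
  by apply: eq_bigr => i _; rewrite ffunE mulrDl.
Qed.

Lemma eulDr a b c : eul a (b + c) = eul a b + eul a c.
Proof.
rewrite /eul addrACA -opprD -!big_split /=; congr (_ - _);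
  by apply: eq_bigr => i _; rewrite ffunE mulrDr.
Qed.

Lemma eulNr a b : eul a (- b) = - eul a b.
Proof.
rewrite /eul opprB addrC -!sumrN; congr (_ + _); apply: eq_bigr => i _;
  by rewrite ffunE mulrN ?opprK.
Qed.

Lemma eul0l a : eul 0 a = 0.
Proof. by apply: (addrI (eul 0 a)); rewrite -eulDl !addr0. Qed.

Lemma eul0r a : eul a 0 = 0.
Proof. by apply: (addrI (eul a 0)); rewrite -eulDr !addr0. Qed.

Lemma dotDr a b c : dot a (b + c) = dot a b + dot a c.
Proof. by rewrite dotC dotDl ![dot _ a]dotC. Qed.

Lemma dotNr a b : dot a (- b) = - dot a b.
Proof. by rewrite dotC dotNl dotC. Qed.

Lemma dot0r a : dot a 0 = 0.
Proof. by rewrite dotC dot0l. Qed.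

Lemma dotBl a b c : dot (a - b) c = dot a c - dot b c.
Proof. by rewrite dotDl dotNl. Qed.

End EulerForm.

Section EventualValues.

Lemma isev_seq (I : eqType) (s : seq I) (c : I -> Qv) (e : I -> nat -> rat) :
  (forall i, isev (c i) (e i)) ->
  exists m0, forall m, (m0 <= m)%N -> forall i, i \in s -> ev m (c i) = e i m.
Proof.
move=> H; elim: s => [|i s [m0 H0]]; first by exists 0%N.
have [m1 H1] := H i; exists (maxn m0 m1) => m; rewrite geq_max => /andP[h0 h1] j.
by rewrite inE => /orP[/eqP -> |js]; [apply: H1|apply: H0].
Qed.

Lemma isev_int (z : int) : isev z%:~R (fun=> z%:~R).
Proof.
have := isev_poly (z%:~R)%:P.
have -> : tofrac (z%:~R)%:P = z%:~R :> Qv.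
  have -> : (z%:~R)%:P = z%:~R :> {poly rat} by rewrite rmorph_int.
  exact: rmorph_int.
by move=> /isev_ext; apply=> m; rewrite hornerC.
Qed.

Lemma isev_horner (p : {poly int}) c e : isev c e ->
  isev (map_poly intr p).[c] (fun m => (map_poly intr p).[e m]).
Proof.
move=> ce; elim/poly_ind: p => [|p z IH].
  by rewrite rmorph0 horner0; apply: isev_ext isev0 _ => m; rewrite rmorph0 horner0.
have -> : (map_poly intr (p * 'X + z%:P)).[c] = (map_poly intr p).[c] * c + z%:~R :> Qv.
  by rewrite rmorphD rmorphM /= map_polyX map_polyC hornerMXaddC.
apply: isev_ext (isevD (isevM IH ce) (isev_int z)) _ => m.
by rewrite rmorphD rmorphM /= map_polyX map_polyC hornerMXaddC.
Qed.

End EventualValues.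

(** * Verification in the model of the relations other than the commutation relation *)

Section ModelRelations.
Variables (n : nat) (phi : Theta n -> Theta n -> Theta n -> {poly int}).
Hypothesis hphi : is_hall_polynomials phi.
Implicit Types (A B C : Theta n) (j : Zn n).

Lemma isev_hall A B C : isev (hall_at_v2 phi A B C)
  (fun m => (map_poly intr (phi A B C)).[m%:R ^+ 2]).
Proof. by apply: isev_horner; apply: isevX isev_vv. Qed.

Lemma rA_Theta0 k v : rA (Theta0 n) k v = 0%N.
Proof. by rewrite rA_sum big_seq big1 // => p; rewrite finsupp0 inE. Qed.

Section InModel.
Variable M : model n.
Notation F := (mF M).
Notation V := (mV M).
Notation m := ((mm M)%:R : rat).
Notation sub := {dffun forall v : 'I_n, 'M[F]_(rdim V v)}.
Implicit Types (L N P : sub) (f : sub -> rat).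

Definition kc : Zn n := [ffun=> mc M].

Lemma hall_value A B C :
  (map_poly intr (phi A B C)).[m ^+ 2] = (hall_count F A B C)%:R.
Proof.
have -> : m ^+ 2 = (#|F|%:R : int)%:~R by rewrite mF_card natrX rmorphXn /= rmorph_nat.
by rewrite horner_map /= hphi rmorph_nat.
Qed.

Lemma sem_sum (I : Type) (r : seq I) (Q : pred I) (x : I -> term Qv (gen n)) f L :
  sem M (\big[@TAdd _ _/TZero]_(i <- r | Q i) x i) f L = \sum_(i <- r | Q i) sem M (x i) f L.
Proof.
by apply: (big_morph (fun x => sem M x f L)).
Qed.

Lemma sem_tkpow i z f L : sem M (tkpow i z) f L = m ^ ((kap L i - mc M) * z) * f L.
Proof.
have m0 := m0 M; case: z => k /=.
  elim: k => [|k IH] /=; first by rewrite mulr0 expr0z mul1r.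
  by rewrite IH mulrA -mD -addn1 PoszD mulrDr mulr1 addrC.
elim: k => [|k IH] /=; first by rewrite NegzE mulrN1.
move: IH => /= ->; rewrite mulrA -mD; congr (m ^ _ * _).
have -> : Negz k.+1 = Negz k - 1 by rewrite !NegzE -[k.+2]addn1 PoszD opprD.
by rewrite mulrBr mulr1 addrC.
Qed.

Lemma sem_tK j f L : sem M (tK j) f L = m ^ dot (kap L - kc) j * f L.
Proof.
rewrite /tK /dot; elim: (index_enum _) => [|i r IH].
  by rewrite !big_nil expr0z mul1r.
by rewrite !big_cons /= sem_tkpow IH mulrA -mD !ffunE.
Qed.

(** The weight of L differs from that of N by the root of their difference of dimension vectors;
    this gives both relations between K and the u_A. *)
Lemma dot_kap L N j :
  dot (kap L - kc) j = eul (zr L - zr N) j + dot (kap N - kc) j.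
Proof.
rewrite !dotBl addrA; congr (_ - _); apply/eqP; rewrite -subr_eq -dotBl; apply/eqP.
rewrite /dot /eul.
have -> : \sum_i (zr L - zr N) i * j (ordS i) = \sum_i (zr L - zr N) (ord_pred i) * j i.
  by rewrite -[RHS]sum_ordS; apply: eq_bigr => i _; rewrite ordSK.
by rewrite -sumrB; apply: eq_bigr => i _; rewrite !ffunE; ring.
Qed.

Lemma zr_typ A (L N : sub) : fle N L -> typ L N A -> zr L - zr N = dimvec A.
Proof.
move=> NL tA; apply/ffunP => v; rewrite dimvecE !ffunE.
have := tA 0%N v; rewrite (eqmx_rankE (addsmx_idPl (NL v))) => ->.
by rewrite PoszD addrC addrA addNr add0r.
Qed.

Lemma zr_up A L N : r_up A L N -> zr L - zr N = dimvec A.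
Proof. by move=> /andP[_ /asboolP[NL tA]]; apply: zr_typ. Qed.

Lemma zr_dn A L N : r_dn A L N -> zr N - zr L = dimvec A.
Proof. by move=> /andP[_ /asboolP[NL tA]]; apply: zr_typ. Qed.

Lemma w_up_mul L N P : w_up L N * w_up N P
  = m ^ eul (zr L - zr N) (zr N - zr P) * w_up L P.
Proof.
rewrite /w_up -!mD; congr (m ^ _).
by rewrite !eulDl !eulDr !eulNl !eulNr; ring.
Qed.

Lemma w_dn_mul L N P : w_dn L N * w_dn N P
  = m ^ eul (zr P - zr N) (zr N - zr L) * w_dn L P.
Proof.
rewrite /w_dn -!mD; congr (m ^ _).
by rewrite !dotDr !dotNr !eulDl !eulDr !eulNl !eulNr; ring.
Qed.

Lemma typ_Theta0_eq L N : is_subrep L -> is_subrep N -> fle N L ->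
  typ L N (Theta0 n) <-> N = L.
Proof.
move=> sL sN NL; split=> [tA|-> k v].
  apply: subrep_eq => // v; apply/eqmxP; rewrite -(geq_leqif (mxrank_leqif_eq (NL v))).
  have := tA 0%N v; rewrite (eqmx_rankE (addsmx_idPl (NL v))) rA_Theta0 addn0.
  by move=> ->.
rewrite rA_Theta0 addn0; apply/eqmx_rankE/addsmx_idPr.
by apply: pw_le; apply: is_subrep_stable.
Qed.

Lemma op_up0 f L : is_subrep L -> \sum_(N | r_up (Theta0 n) L N) w_up L N * f N = f L.
Proof.
move=> sL; rewrite (big_pred1 L) => [|N].
  by rewrite /w_up subrr eul0l expr0z mul1r.
apply/andP/eqP => [[sN /asboolP[NL]]|->]; first by move/(typ_Theta0_eq sL sN NL).
by split=> //; apply/asboolP; split; [exact: fle_refl|exact/typ_Theta0_eq].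
Qed.

Lemma op_dn0 f L : is_subrep L -> \sum_(N | r_dn (Theta0 n) L N) w_dn L N * f N = f L.
Proof.
move=> sL; rewrite (big_pred1 L) => [|N].
  by rewrite /w_dn subrr eul0r dot0r subrr expr0z mul1r.
apply/andP/eqP => [[sN /asboolP[NL]]|->].
  by move/(typ_Theta0_eq sN sL NL).
by split=> //; apply/asboolP; split; [exact: fle_refl|exact/typ_Theta0_eq].
Qed.

Lemma nilp_pair L N : exists K, fle (pw K L) N.
Proof.
exists (mH M).+1 => v; apply: submx_trans (sub0mx _ (N v)).
have L1 : fle L (full V) by move=> u; apply: submx1.
apply: submx_trans (pw_mono _ L1 v) (mV_nilp M v).
Qed.

Lemma op_up_up A B s f L : is_subrep L -> uniq s ->
    (forall C, (C \in s) = (phi A B C != 0)) ->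
  \sum_(N | r_up A L N) w_up L N * (\sum_(P | r_up B N P) w_up N P * f P)
  = \sum_(C <- s) (m ^ eul (dimvec A) (dimvec B) * (hall_count F A B C)%:R)
      * \sum_(P | r_up C L P) w_up L P * f P.
Proof.
move=> sL us sE; have sL' := is_subrep_stable sL.
apply: (sum_of_products (r := @r_up n M) (h := fun C => (hall_count F A B C)%:R)) => //.
- move=> C; rewrite sE negbK => /eqP z.
  by rewrite -hall_value z rmorph0 horner0.
- by move=> N P rN rP; rewrite w_up_mul (zr_up rN) (zr_up rP).
move=> P; have [[sP PL]|nP] := EM (is_subrep P /\ fle P L); last first.
  have nr C : r_up C L P = false.
    by apply/negP => /andP[sP /asboolP[PL _]]; apply: nP.
  exists A; split=> [C||]; rewrite ?nr // => _ N.
  apply/negP => /andP[/andP[_ /asboolP[NL _]] /andP[sP /asboolP[PN _]]].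
  by apply: nP; split=> //; apply: fle_trans PN NL.
have sP' := is_subrep_stable sP.
have [C0 tC0] := typ_exists sL' sP' PL (nilp_pair L P).
exists C0; split=> [C /andP[_ /asboolP[_ tC]]||_].
- exact: typ_uniq tC tC0.
- by rewrite /r_up sP /=; move/asboolP; case.
rewrite -(hall_count_subquotient A B sL' sP' PL tC0); congr _%:R.
apply: eq_card => N; rewrite !inE.
apply/andP/and4P => [[/andP[sN /asboolP[NL tA]] /andP[_ /asboolP[PN tB]]]|].
  by split=> //; apply/asboolP.
move=> [sN /asboolP[PN NL] /asboolP tB /asboolP tA].
by split; apply/andP; split=> //; apply/asboolP.
Qed.

Lemma op_dn_dn A B s f L : is_subrep L -> uniq s ->
    (forall C, (C \in s) = (phi B A C != 0)) ->
  \sum_(N | r_dn A L N) w_dn L N * (\sum_(P | r_dn B N P) w_dn N P * f P)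
  = \sum_(C <- s) (m ^ eul (dimvec B) (dimvec A) * (hall_count F B A C)%:R)
      * \sum_(P | r_dn C L P) w_dn L P * f P.
Proof.
move=> sL us sE; have sL' := is_subrep_stable sL.
apply: (sum_of_products (r := @r_dn n M) (h := fun C => (hall_count F B A C)%:R)) => //.
- move=> C; rewrite sE negbK => /eqP z.
  by rewrite -hall_value z rmorph0 horner0.
- by move=> N P rN rP; rewrite w_dn_mul (zr_dn rN) (zr_dn rP).
move=> P; have [[sP LP]|nP] := EM (is_subrep P /\ fle L P); last first.
  have nr C : r_dn C L P = false.
    by apply/negP => /andP[sP /asboolP[PL _]]; apply: nP.
  exists A; split=> [C||]; rewrite ?nr // => _ N.
  apply/negP => /andP[/andP[_ /asboolP[LN _]] /andP[sP /asboolP[NP _]]].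
  by apply: nP; split=> //; apply: fle_trans LN NP.
have sP' := is_subrep_stable sP.
have [C0 tC0] := typ_exists sP' sL' LP (nilp_pair P L).
exists C0; split=> [C /andP[_ /asboolP[_ tC]]||_].
- exact: typ_uniq tC tC0.
- by rewrite /r_dn sP /=; move/asboolP; case.
rewrite -(hall_count_subquotient B A sP' sL' LP tC0); congr _%:R.
apply: eq_card => N; rewrite !inE.
apply/andP/and4P => [[/andP[sN /asboolP[LN tA]] /andP[_ /asboolP[NP tB]]]|].
  by split=> //; apply/asboolP.
move=> [sN /asboolP[LN NP] /asboolP tA /asboolP tB].
by split; apply/andP; split=> //; apply/asboolP.
Qed.

End InModel.

Lemma isev_struct (e : int) A B C : isev (vv ^ e * hall_at_v2 phi A B C)
  (fun m => m%:R ^ e * (map_poly intr (phi A B C)).[m%:R ^+ 2]).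
Proof. by apply: isevM; [apply: isev_vvz|apply: isev_hall]. Qed.

Lemma drel_eqv (hcomm : forall lam mu : Nn n, eqv (comm_lhs lam mu) (comm_rhs lam mu)) x y :
  drel phi x y -> eqv x y.
Proof.
case=> {x y}.
- by move=> i k; apply: eqv_exact => M f L /=; rewrite mulrCA.
- by move=> i; apply: eqv_exact => M f L /=; rewrite mulrA -mD subrr expr0z mul1r.
- by move=> i; apply: eqv_exact => M f L /=; rewrite mulrA -mD addNr expr0z mul1r.
- by exists 0%N, 0%N => M _ f L [sL _ _ _]; apply: op_up0.
- by exists 0%N, 0%N => M _ f L [sL _ _ _]; apply: op_dn0.
- move=> A j; have [k Hk] := isev_vvz (eul (dimvec A) j); exists 0%N, k => M kM f L _.
  rewrite /= sem_tK Hk // !mulr_sumr; apply: eq_bigr => N rN.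
  by rewrite sem_tK (dot_kap L N) (zr_up rN) mD -!mulrA; congr (_ * _); apply: mulrCA.
- move=> A j; have [k Hk] := isev_vvz (eul (dimvec A) j); exists 0%N, k => M kM f L _.
  rewrite /= sem_tK Hk // !mulr_sumr; apply: eq_bigr => N rN.
  rewrite sem_tK (dot_kap N L) (zr_dn rN) mD mulrCA -!mulrA.
  by congr (_ * (_ * _)); apply: mulrC.
- move=> A B s us sE.
  have [k Hk] := isev_seq s (fun C => isev_struct (eul (dimvec A) (dimvec B)) A B C).
  exists 0%N, k => M kM f L [sL _ _ _]; rewrite sem_sum /= (op_up_up f sL us sE).
  rewrite big_seq [RHS]big_seq; apply: eq_bigr => C Cs /=.
  by rewrite (Hk _ kM C Cs) hall_value.
- move=> A B s us sE.
  have [k Hk] := isev_seq s (fun C => isev_struct (eul (dimvec B) (dimvec A)) B A C).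
  exists 0%N, k => M kM f L [sL _ _ _]; rewrite sem_sum /= (op_dn_dn f sL us sE).
  rewrite big_seq [RHS]big_seq; apply: eq_bigr => C Cs /=.
  by rewrite (Hk _ kM C Cs) hall_value.
- exact: hcomm.
Qed.

End ModelRelations.

(** * The commutation relation in the model *)

Section CommutationInModel.
Variables (n : nat) (M : model n).
Notation F := (mF M).
Notation V := (mV M).
Notation H := (mH M).
Notation m := ((mm M)%:R : rat).
Notation sub := {dffun forall v : 'I_n, 'M[F]_(rdim V v)}.
Implicit Types (L N P : sub) (f : sub -> rat) (a b : Nn n).

Lemma mq : m ^+ 2 = #|F|%:R.
Proof. by rewrite mF_card natrX. Qed.

Lemma m_inf k : (0 < k)%N -> (m ^+ 2) ^+ k != 1.
Proof. by move=> k0; rewrite mq; apply: qF_inf. Qed.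

Lemma dimvec_Adiag b : dimvec (Adiag b) = zv b.
Proof. by apply/ffunP => v; rewrite dimvecE rA_Adiag ffunE. Qed.

Lemma lin_kap L b :
  lin (kap L) b = dot (ell M) (zv b) + eul (zv b) (zr L) - eul (zr L) (zv b).
Proof.
have e1 : \sum_i zr L i * zv b (ordS i) = \sum_i zr L (ord_pred i) * zv b i.
  by rewrite -[RHS]sum_ordS; apply: eq_bigr => i _; rewrite ordSK.
rewrite /lin /dot /eul e1; do ![rewrite -sumrB | rewrite -big_split /=].
by apply: eq_bigr => i _; rewrite !ffunE ordSK; ring.
Qed.

Lemma weight_dn_up tau L N P a b : zr P = zr L - tau -> zr N = zr L + zv b ->
    zv a = zv b + tau ->
  w_dn L N * w_up N P = m ^ (rescale (kap L) a b + eul tau (zr L - tau)).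
Proof.
move=> zP zN za; rewrite /w_dn /w_up -mD; congr (m ^ _).
have -> : zr N - zr L = zv b by rewrite zN addrC addKr.
have -> : zr N - zr P = zv b + tau by rewrite zN zP; apply/ffunP => i; rewrite !ffunE; ring.
rewrite /rescale lin_kap zN zP za !(eulDl, eulDr, eulNl, eulNr); ring.
Qed.

Lemma weight_up_dn tau L N P a b : zr P = zr L - tau -> zr N = zr L - zv a ->
    zv a = zv b + tau ->
  w_up L N * w_dn N P = m ^ (rescale (kap L) a b + eul tau (zr L - tau)).
Proof.
move=> zP zN za; rewrite /w_dn /w_up -mD; congr (m ^ _).
have -> : zr L - zr N = zv b + tau by rewrite zN -za; apply/ffunP => i; rewrite !ffunE; ring.
have -> : zr P - zr N = zv b by rewrite zN zP za; apply/ffunP => i; rewrite !ffunE; ring.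
rewrite /rescale lin_kap zN zP za !(eulDl, eulDr, eulNl, eulNr); ring.
Qed.

Definition inter L P : fam V := fun v => (L v :&: P v)%MS.

Section FixedPair.
Variables (tau : Zn n) (L P : sub).
Hypotheses (iL : interior 1 L) (sP : is_subrep P).
Hypotheses (LP : fle (push L) P) (PL : fle (push P) L).
Hypothesis zP : zr P = zr L - tau.

Let sL : is_subrep L. Proof. by case: iL. Qed.
Let sL' : stable L := is_subrep_stable sL.
Let sP' : stable P := is_subrep_stable sP.
Let hiL : fle L (push (full V)). Proof. by case: iL. Qed.

Let kerL v : (kermx (rarr V v) <= L v)%MS.
Proof.
case: iL => _ _ lo _; apply: submx_trans (lo v); rewrite subn1 /=.
by apply: mV_preim => //; rewrite mulmx_ker sub0mx.
Qed.

(** The least dimension vector of N / L for N containing L and P; equally, that of P / N for the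
    largest N inside both. *)
Definition b0 : Nn n := [ffun v => (\rank (L v + P v)%MS - \rank (L v))%N].

Let rsum v : \rank (fadd L P v) = (\rank (L v) + b0 v)%N.
Proof. by rewrite ffunE subnKC // mxrankS // addsmxSl. Qed.

Let rP v : (\rank (P v))%:Z = (\rank (L v))%:Z - tau v.
Proof. by have /ffunP/(_ v) := zP; rewrite !ffunE. Qed.

Let rinter v : (\rank (inter L P v) + b0 v = \rank (P v))%N.
Proof.
have := mxrank_sum_cap (L v) (P v); rewrite -/(inter L P v) -/(fadd L P v).
by have := rsum v; rewrite /fadd /inter; lia.
Qed.

Let push_sum : fle (push (fadd L P)) (inter L P).
Proof.
move=> v; rewrite pushD addsmx_sub !sub_capmx sL' LP PL sP' //.
Qed.

Let Y : fam V := preim (inter L P).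

Let XY : fle (fadd L P) Y.
Proof. by move=> v; rewrite sub_preim -pushE; apply: push_sum. Qed.

Let pushY : fle (push Y) (inter L P).
Proof. by apply: ordS_all => v; rewrite pushE -sub_preim submx_refl. Qed.

Let YX : fle (push Y) (fadd L P).
Proof.
move=> v; apply: submx_trans (pushY v) _; apply: submx_trans (capmxSl _ _) _.
exact: addsmxSl.
Qed.

Let rY v : \rank (Y v) = (nullity V v + \rank (inter L P (ordS v)))%N.
Proof. by apply: rank_preim; apply: submx_trans (capmxSl _ _) (hiL _). Qed.

Let rpush v : (\rank (push (fadd L P) (ordS v)) + nullity V v = \rank (fadd L P v))%N.
Proof. by apply: rank_push; apply: submx_trans (kerL v) (addsmxSl _ _). Qed.

(** The margin 1 of L enters here and in [qexp_below]: L lies in the image of the arrows, which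
    gives the rank of the preimage Y, and contains their kernels, which gives the rank of the
    radical of L + P. *)
Lemma qexp_above v :
  qexp (m ^+ 2) (kap L - tau) b0 v = #|F|%:R ^+ (\rank (Y v) - \rank (fadd L P v)).
Proof.
rewrite /qexp mq exprnP; congr (_ ^ _).
have r1 := rsum v; have r2 := rY v; have r3 := rinter (ordS v).
have r4 := rP (ordS v); have r5 := mxrankS (XY v).
move: b0 r1 r3 => bb r1 r3; rewrite !ffunE ordSK.
move: r1 r2 r3 r4 r5; do 6!move: (\rank _) => ?; move: (tau _) (bb (ordS v)) (bb v) => *; lia.
Qed.

Lemma qexp_below v : qexp (m ^+ 2) (kap L - tau) b0 (ord_pred v)
  = #|F|%:R ^+ (\rank (inter L P v) - \rank (push (fadd L P) v)).
Proof.
move: v; apply: ordS_all => v; rewrite ordSK /qexp mq exprnP; congr (_ ^ _).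
have r1 := rsum v; have r2 := rpush v; have r3 := rinter (ordS v).
have r4 := rP (ordS v); have r5 := mxrankS (push_sum (ordS v)).
move: b0 r1 r3 => bb r1 r3; rewrite !ffunE ordSK.
move: r1 r2 r3 r4 r5; do 6!move: (\rank _) => ?; move: (tau _) (bb (ordS v)) (bb v) => *; lia.
Qed.

Let rank_of_gap a b v : zv a = zv b + tau -> (\rank (L v) + b v = \rank (P v) + a v)%N.
Proof.
move=> /ffunP/(_ v); rewrite !ffunE; have := rP v.
by move: (tau v) (a v) (b v) => *; lia.
Qed.

(** N / L and N / P are both semisimple exactly when the arrows map N into L :&: P, that is, when N
    lies in the preimage Y. *)
Lemma r_dn_upP a b N : zv a = zv b + tau -> is_subrep N ->
  r_dn (Adiag b) L N && r_up (Adiag a) N P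
  <-> (fle (fadd L P) N /\ fle N Y) /\ forall v, \rank (N v) = (\rank (L v) + b v)%N.
Proof.
move=> za sN; split.
  move=> /andP[/andP[_ /asboolP[LN tb]] /andP[_ /asboolP[PN ta]]].
  have [NL rN] := (typ_AdiagP b LN sL').1 tb; have [NP _] := (typ_AdiagP a PN sP').1 ta.
  split=> //; split=> v; first by rewrite addsmx_sub LN PN.
  by rewrite sub_preim sub_capmx -!pushE NL NP.
move=> [[XN NY] rN].
have LN : fle L N by move=> v; apply: submx_trans (XN v); apply: addsmxSl.
have PN : fle P N by move=> v; apply: submx_trans (XN v); apply: addsmxSr.
have NI : fle (push N) (inter L P) by apply: fle_trans (push_mono NY) pushY.
rewrite /r_dn /r_up sN sP /=; apply/andP; split; apply/asboolP; split=> //.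
  by apply/(typ_AdiagP b LN sL'); split=> // v; apply: submx_trans (NI v) (capmxSl _ _).
apply/(typ_AdiagP a PN sP'); split=> v; first exact: submx_trans (NI v) (capmxSr _ _).
by rewrite rN (rank_of_gap v za).
Qed.

Lemma r_up_dnP a b N : zv a = zv b + tau -> is_subrep N ->
  r_up (Adiag a) L N && r_dn (Adiag b) N P
  <-> (fle (push (fadd L P)) N /\ fle N (inter L P)) /\
      forall v, (\rank (N v) + b v = \rank (P v))%N.
Proof.
move=> za sN; have sN' := is_subrep_stable sN; split.
  move=> /andP[/andP[_ /asboolP[NL ta]] /andP[_ /asboolP[NP tb]]].
  have [LN _] := (typ_AdiagP a NL sN').1 ta; have [PN rN] := (typ_AdiagP b NP sN').1 tb.
  split=> //; split=> v; first by rewrite pushD addsmx_sub LN PN.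
  by rewrite sub_capmx NL NP.
move=> [[XN NI] rN].
have NL : fle N L by move=> v; apply: submx_trans (NI v) (capmxSl _ _).
have NP : fle N P by move=> v; apply: submx_trans (NI v) (capmxSr _ _).
have XN' v : (push L v <= N v)%MS /\ (push P v <= N v)%MS.
  by have := XN v; rewrite pushD addsmx_sub => /andP.
rewrite /r_dn /r_up sN sP /=; apply/andP; split; apply/asboolP; split=> //.
  apply/(typ_AdiagP a NL sN'); split=> v; first by case: (XN' v).
  by have := rank_of_gap v za; have := rN v; move: (a v) (b v) => *; lia.
by apply/(typ_AdiagP b NP sN'); split=> v; first by case: (XN' v).
Qed.

Lemma sum_dn_up a b : zv a = zv b + tau ->
  \sum_(N | r_dn (Adiag b) L N && r_up (Adiag a) N P) w_dn L N * w_up N P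
  = if vle b0 b then m ^ (rescale (kap L) a b + eul tau (zr L - tau))
      * \prod_v gauss (m ^+ 2) (qexp (m ^+ 2) (kap L - tau) b0 v) (b v - b0 v) else 0.
Proof.
move=> za; set E := m ^ _.
rewrite (eq_bigr (fun=> E)) => [|N rN]; last first.
  have sN : is_subrep N by case/andP: rN => /andP[].
  have [_ rk] := (r_dn_upP za sN).1 rN.
  by apply: weight_dn_up => //; apply/ffunP => v; rewrite !ffunE rk PoszD.
rewrite sumr_const; case: ifPn => [/forallP bb|nb]; last first.
  rewrite (eq_card0 _) ?mulr0n // => N; apply/negP => rN.
  have sN : is_subrep N by case/andP: rN => /andP[].
  have [[XN _] rk] := (r_dn_upP za sN).1 rN; case/negP: nb; apply/forallP => v.
  by have := mxrankS (XN v); rewrite rk rsum leq_add2l.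
rewrite -[E *+ _]mulr_natr; congr (_ * _).
under eq_bigr => v _ do rewrite qexp_above mq.
rewrite -(card_between (fun v => b v - b0 v)%N XY YX); congr _%:R.
apply: eq_card => N; rewrite [RHS]inE /= unfold_in.
apply/idP/and3P => [rN|[sN /asboolP XNY /forallP rk]].
  have sN : is_subrep N by case/andP: rN => /andP[].
  have [XNY rk] := (r_dn_upP za sN).1 rN; split=> //; first exact/asboolP.
  by apply/forallP => v; rewrite rk rsum -addnA subnKC.
apply/(r_dn_upP za sN); split=> // v.
by rewrite (eqP (rk v)) rsum -addnA subnKC.
Qed.

(** Here N lies between the radical of L + P and L :&: P, in which it has codimension b - b0;
    [gauss_codim] turns the count by dimension into one by codimension. *)
Lemma sum_up_dn a b : zv a = zv b + tau ->
  \sum_(N | r_up (Adiag a) L N && r_dn (Adiag b) N P) w_up L N * w_dn N P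
  = if vle b0 b then m ^ (rescale (kap L) a b + eul tau (zr L - tau))
      * \prod_v gauss (m ^+ 2) (qexp (m ^+ 2) (kap L - tau) b0 (ord_pred v)) (b v - b0 v)
    else 0.
Proof.
move=> za; set E := m ^ _.
rewrite (eq_bigr (fun=> E)) => [|N rN]; last first.
  have sN : is_subrep N by case/andP: rN => /andP[].
  have [_ rk] := (r_up_dnP za sN).1 rN.
  apply: weight_up_dn => //; apply/ffunP => v.
  have /ffunP/(_ v) := za; have := rk v; have := rP v; rewrite !ffunE.
  by move: (tau v) (a v) (b v) => *; lia.
pose Mx v := (\rank (inter L P v) - \rank (push (fadd L P) v))%N.
rewrite sumr_const; case: ifPn => [/forallP bb|nb]; last first.
  rewrite (eq_card0 _) ?mulr0n // => N; apply/negP => rN.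
  have sN : is_subrep N by case/andP: rN => /andP[].
  have [[_ NI] rk] := (r_up_dnP za sN).1 rN; case/negP: nb; apply/forallP => v.
  by have := mxrankS (NI v); have := rk v; have := rinter v; move: (b0 v) (b v) => *; lia.
rewrite -[E *+ _]mulr_natr; congr (_ * _).
under eq_bigr => v _ do rewrite qexp_below mq -/(Mx v).
(* If the codimension exceeds the length of the interval at some vertex, there is no N, and a
   Gaussian factor vanishes as well. *)
have [/forallP kM|/forallPn[v]] := boolP [forall v, (b v - b0 v <= Mx v)%N]; last first.
  rewrite -ltnNge => big; rewrite (bigD1 v) //= gauss_eq0 // mul0r.
  rewrite (eq_card0 _) // => N; apply/negP => rN.
  have sN : is_subrep N by case/andP: rN => /andP[].
  have [[XN _] rk] := (r_up_dnP za sN).1 rN.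
  move: big (mxrankS (XN v)) (rk v) (rinter v); rewrite /Mx.
  by move: (b0 v) (b v) => *; lia.
under eq_bigr => v _ do rewrite -gauss_codim //.
rewrite -(card_between (fun v => Mx v - (b v - b0 v))%N push_sum); last first.
  apply: push_mono => v; apply: submx_trans (capmxSl _ _) (addsmxSl _ _).
congr _%:R; apply: eq_card => N; rewrite [RHS]inE /= unfold_in.
have arith v : (\rank (N v) + b v = \rank (P v))%N <->
    \rank (N v) = (\rank (push (fadd L P) v) + (Mx v - (b v - b0 v)))%N.
  have := kM v; have := bb v; have := rinter v; have := mxrankS (push_sum v).
  by rewrite /Mx; move: (b0 v) (b v) => *; lia.
apply/idP/and3P => [rN|[sN /asboolP XNY /forallP rk]].
  have sN : is_subrep N by case/andP: rN => /andP[].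
  have [XNY rk] := (r_up_dnP za sN).1 rN; split=> //; first exact/asboolP.
  by apply/forallP => v; apply/eqP/arith.
by apply/(r_up_dnP za sN); split=> // v; apply/arith/eqP.
Qed.

End FixedPair.

Lemma rel5_pair tau mu L P : interior 1 L -> gap_nonneg tau mu ->
  rel5 (K := rat) (M := rat^o) m tau mu (kap L)
    (fun b => \sum_(N | r_dn (Adiag b) L N && r_up (Adiag (gapv tau b)) N P)
       w_dn L N * w_up N P)
    (fun b => \sum_(N | r_up (Adiag (gapv tau b)) L N && r_dn (Adiag b) N P)
       w_up L N * w_dn N P).
Proof.
move=> iL nm; have sL : is_subrep L by case: iL.
have zg b : gap_nonneg tau b -> zv (gapv tau b) = zv b + tau.
  by move=> nb; apply/ffunP => v; rewrite !ffunE -(gapvE v nb) ffunE.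
have vanish (X Y : Nn n -> rat^o) : (forall b, vle b mu -> gap_nonneg tau b -> X b = 0) ->
    (forall b, vle b mu -> gap_nonneg tau b -> Y b = 0) -> rel5 m tau mu (kap L) X Y.
  move=> X0 Y0; rewrite /rel5 [LHS]big_seq_cond [RHS]big_seq_cond !big1 // => b /andP[];
    by rewrite mem_box => bm nb; rewrite ?X0 ?Y0 // scaler0.
(* Any intermediate N, above or below, forces these conditions on P; without them both sides are
   zero. *)
have [[sP [LP [PL zP]]]|nc] := EM (is_subrep P /\ fle (push L) P /\ fle (push P) L
    /\ zr P = zr L - tau); last first.
  apply: vanish => b _ nb; apply: big1 => N /andP[].
    move=> rN rP; case: nc; move: (zr_dn rN) (zr_up rP); rewrite !dimvec_Adiag (zg b nb).
    move: rN rP => /andP[sN /asboolP[LN tb]] /andP[sP /asboolP[PN ta]] zN zP.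
    have NL := typ_Adiag tb; have NP := typ_Adiag ta.
    split=> //; split; first exact: fle_trans (push_mono LN) NP.
    split; first exact: fle_trans (push_mono PN) NL.
    apply/ffunP => v; move/ffunP/(_ v): zN; move/ffunP/(_ v): zP; rewrite !ffunE.
  by move: (tau v) (b v) => *; lia.
  move=> rN rP; case: nc; move: (zr_up rN) (zr_dn rP); rewrite !dimvec_Adiag (zg b nb).
  move: rN rP => /andP[sN /asboolP[NL ta]] /andP[sP /asboolP[NP tb]] zN zP.
  have LN := typ_Adiag ta; have PN := typ_Adiag tb.
  split=> //; split; first exact: fle_trans LN NP.
  split; first exact: fle_trans PN NL.
  apply/ffunP => v; move/ffunP/(_ v): zN; move/ffunP/(_ v): zP; rewrite !ffunE.
  by move: (tau v) (b v) => *; lia.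
have rP v : (\rank (P v))%:Z = (\rank (L v))%:Z - tau v.
  by have /ffunP/(_ v) := zP; rewrite !ffunE.
have nb0 : gap_nonneg tau (b0 L P).
  apply/forallP => v; have := mxrankS (addsmxSr (L v) (P v)).
  by have := rP v; rewrite ffunE; move: (tau v) => *; lia.
have E1 b (nb : gap_nonneg tau b) := sum_dn_up iL sP LP PL zP (zg b nb).
have E2 b (nb : gap_nonneg tau b) := sum_up_dn iL sP LP PL zP (zg b nb).
have [bm|nbm] := boolP (vle (b0 L P) mu); last first.
  have nv b : vle b mu -> vle (b0 L P) b = false.
    by move=> bm; apply: contraNF nbm => /vle_trans; apply.
  by apply: vanish => b bm nb; rewrite ?E1 ?E2 // nv.
have := rel5_gauss (m0 M) m_inf (kap L) (eul tau (zr L - tau)) nm bm nb0.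
rewrite /rel5 => e; etransitivity; last (etransitivity; first exact: e).
  by apply: eq_bigr => b nb; rewrite E1.
by apply: eq_bigr => b nb; rewrite E2.
Qed.

End CommutationInModel.

Section CommutationRelation.
Variable n : nat.
Implicit Types (a b lam mu : Nn n).

Lemma isev_kappa lam a b : isev (kappa lam a b) (fun m => kappaK m%:R lam a b).
Proof.
apply: isevM; first exact: isev_vvz.
apply: isev_prod => i; apply: isev_prod => s; apply: isevV.
by apply: isevD; [apply: isevX isev_vv|apply/isevN/isevX/isev_vv].
Qed.

Lemma sum_sum_factor (T : finType) (r r' : T -> T -> bool) (w w' : T -> T -> rat) f L :
  \sum_(N | r L N) w L N * (\sum_(P | r' N P) w' N P * f P)
  = \sum_P (\sum_(N | r L N && r' N P) w L N * w' N P) * f P.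
Proof.
under eq_bigr => N _ do rewrite mulr_sumr.
rewrite (exchange_big_dep predT) //=; apply: eq_bigr => P _.
by rewrite mulr_suml; apply: eq_bigr => N _; rewrite mulrA.
Qed.

(** Constant vectors are orthogonal to all roots, so the shift [mc] does not affect the commutation
    relation and stays free to adjust weights. *)
Lemma eul_kc (M : model n) nu : eul nu (kc M) = 0.
Proof. by rewrite /eul -sumrB big1 // => i _; rewrite !ffunE subrr. Qed.

Lemma sem_rootv (M : model n) nu f L :
  sem M (tKt nu) f L = (mm M)%:R ^ eul nu (kap L) * f L.
Proof.
rewrite /tKt sem_tK dotC dot_rootv eulDr eulNr.
by rewrite eul_kc oppr0 addr0.
Qed.

Lemma comm_eqv lam mu : eqv (comm_lhs lam mu) (comm_rhs lam mu).
Proof.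
pose tau := zv lam - zv mu : Zn n.
have nm : gap_nonneg tau mu by apply/forallP => i; rewrite !ffunE; lia.
have lamE : gapv tau mu = lam.
  by apply/ffunP => i; apply/eqP; rewrite -eqz_nat gapvE // !ffunE addrC subrK; apply: eqxx.
pose I := ({dffun forall i : 'I_n, 'I_(lam i).+1} * {dffun forall i : 'I_n, 'I_(mu i).+1})%type.
pose av (ab : I) : Nn n := below_vec ab.1; pose bv (ab : I) : Nn n := below_vec ab.2.
have [k1 H1] := isev_vvz (eul (zv mu) (zv mu)).
have [k2 H2] := isev_vvz (eul (zv mu) (zv lam)).
have [k3 H3] := isev_seq (index_enum I) (fun ab : I => isevM (isev_kappa lam (av ab) (bv ab))
  (isev_vvz (eul (zv (bv ab)) (zv lam + zv mu - zv (bv ab))))).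
have [k4 H4] := isev_seq (index_enum I) (fun ab : I => isevM (isev_kappa lam (av ab) (bv ab))
  (isev_vvz (eul (zv mu - zv (bv ab)) (zv (av ab)) + eul (zv mu) (zv (bv ab))))).
(* Margin 1 suffices because all quotients involved are semisimple, so that only one step along each
   string matters. *)
exists 1%N, (maxn (maxn k1 k2) (maxn k3 k4)) => M.
rewrite !geq_max => /andP[/andP[h1 h2] /andP[h3 h4]] f L iL.
pose DU a b := \sum_P (\sum_(N | r_dn (Adiag b) L N && r_up (Adiag a) N P)
  w_dn L N * w_up N P) * f P.
pose UD a b := \sum_P (\sum_(N | r_up (Adiag a) L N && r_dn (Adiag b) N P)
  w_up L N * w_dn N P) * f P.
have e1 : sem M (comm_lhs lam mu) f L = \sum_(b <- box mu | gap_nonneg tau b)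
    coefL (mm M)%:R lam mu (kap L) (gapv tau b) b * DU (gapv tau b) b.
  pose g a b := coefL (mm M)%:R lam mu (kap L) a b * DU a b.
  rewrite -(sum_gap g nm) lamE -(sum_same_gap _ _ g) /= H1 // sem_sum mulr_sumr.
  rewrite big_mkcond [RHS]big_mkcond; apply: eq_bigr => ab _.
  case: ifP => // _; rewrite [sem _ _ _ _]/= (H3 _ h3 ab (mem_index_enum _)) sem_rootv.
  by rewrite sum_sum_factor /g /coefL !mulrA.
have e2 : sem M (comm_rhs lam mu) f L = \sum_(b <- box mu | gap_nonneg tau b)
    coefR (mm M)%:R lam mu (kap L) (gapv tau b) b * UD (gapv tau b) b.
  pose g a b := coefR (mm M)%:R lam mu (kap L) a b * UD a b.
  rewrite -(sum_gap g nm) lamE -(sum_same_gap _ _ g) /= H2 // sem_sum mulr_sumr.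
  rewrite big_mkcond [RHS]big_mkcond; apply: eq_bigr => ab _.
  case: ifP => // _; rewrite [sem _ _ _ _]/= (H4 _ h4 ab (mem_index_enum _)) sem_rootv.
  by rewrite sum_sum_factor /g /coefR -eulNl opprB !mulrA.
rewrite e1 e2 /DU /UD.
under eq_bigr => b _ do rewrite mulr_sumr.
under [RHS]eq_bigr => b _ do rewrite mulr_sumr.
rewrite exchange_big [RHS]exchange_big; apply: eq_bigr => P _ /=.
have := rel5_pair P iL nm; rewrite /rel5 lamE => e.
under eq_bigr => b _ do rewrite mulrA.
under [RHS]eq_bigr => b _ do rewrite mulrA.
rewrite -!mulr_suml; congr (_ * _); exact: e.
Qed.

End CommutationRelation.

Theorem presented_eqv n (phi : Theta n -> Theta n -> Theta n -> {poly int})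
    (hphi : is_hall_polynomials phi) x y :
  dclass phi x = dclass phi y -> eqv x y.
Proof.
by move=> /pclassP; apply: pcong_eqv; apply: drel_eqv => // lam mu; apply: comm_eqv.
Qed.

(** * Linear independence *)

Section CountingCells.
Variable n : nat.
Implicit Types (A C : Theta n) (v : 'I_n).

Lemma count_cells C (P : pred (cell n)) v : count P (cells_at C v) =
  (\sum_(p <- finsupp C) \sum_(0 <= c < C p) \sum_(0 <= j < p.2.+1)
     ((iter j (@ordS n) p.1 == v) && P (p, c, j)))%N.
Proof.
rewrite /cells_at -sum1_count big_filter_cond big_mkcond /cells big_allpairs_dep.
rewrite big_allpairs_dep; apply: eq_bigr => p _.
rewrite -[index_iota 0 (C p)]/(iota 0 (C p - 0)) subn0; apply: eq_bigr => c _.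
rewrite [(p, c).1]/= -[iota 0 _]/(index_iota 0 p.2.+1); apply: eq_bigr => j _.
by rewrite /cell_vertex /=; case: (_ && _).
Qed.

Lemma sum_finsupp A D (G : 'I_n * nat -> nat) : (forall p, A p = 0%N -> G p = 0%N) ->
  (forall i l, (D <= l)%N -> A (i, l) = 0%N) ->
  (\sum_(p <- finsupp A) G p = \sum_i \sum_(0 <= l < D) G (i, l))%N.
Proof.
move=> G0 AD; rewrite -big_enum /=.
have -> : (\sum_(i <- enum 'I_n) \sum_(0 <= l < D) G (i, l)
   = \sum_(p <- [seq (i, l) | i <- enum 'I_n, l <- iota 0 D]) G p)%N.
  by rewrite big_allpairs -[iota 0 D]/(iota 0 D) /index_iota subn0.
rewrite [RHS](bigID (fun p => A p == 0%N)) /= [X in (X + _)%N]big1 ?add0n => [|p /eqP /G0 //].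
rewrite -[RHS]big_filter; apply: perm_big; apply: uniq_perm; first exact: fset_uniq.
  apply/filter_uniq/allpairs_uniq; rewrite ?enum_uniq ?iota_uniq //.
  by move=> [i l] [i' l'] _ _.
move=> [i l]; rewrite mem_filter mem_finsupp; case: eqP => //= /eqP Al.
apply/esym/allpairsP; exists (i, l); rewrite mem_enum mem_iota /= add0n; split=> //.
by rewrite ltnNge; apply: contra Al => /(AD i) ->.
Qed.

Lemma sum_nat_ge k N (G : nat -> bool) :
  (\sum_(0 <= j < N) (G j && (k <= j)) = \sum_(k <= j < N) G j)%N.
Proof.
have [kN|Nk] := leqP k N; last first.
  rewrite [RHS]big_geq ?(ltnW Nk) // big_nat big1 // => j /andP[_ jN].
  by rewrite leqNgt (ltn_trans jN Nk) andbF.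
rewrite (big_cat_nat _ kN) //= big_nat big1 ?add0n => [|j /andP[_ jk]]; last first.
  by rewrite leqNgt jk andbF.
by apply: eq_big_nat => j /andP[kj _]; rewrite kj andbT.
Qed.

End CountingCells.

Section UniformStrings.
Variables (n : nat) (H : nat) (rh : 'I_n -> nat).
Implicit Types (A B : Theta n) (v i : 'I_n).

(* the sum of rh i strings of length H + 1 with top S_i, for each i *)
Definition rect : Theta n :=
  [fsfun p in [fset (i, H) | i in 'I_n]%fset => rh p.1 | 0%N].

Lemma rectE i k : rect (i, k) = if k == H then rh i else 0%N.
Proof.
rewrite fsfun_fun; case: imfsetP => [[j _ [-> ->]]|N] /=; first by rewrite eqxx.
by case: eqP => // kH; case: N; exists i; rewrite ?kH.
Qed.

Lemma mem_rect (b : cell n) : (b \in cells rect) ->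
  [/\ b.1.1.2 = H, (b.1.2 < rh b.1.1.1)%N & (b.2 <= H)%N].
Proof.
rewrite mem_cells; case: b => [[[i l] c] j] /=; rewrite rectE.
by case: eqP => //= -> /andP[].
Qed.

Lemma count_rect (P : pred (cell n)) v : count P (cells_at rect v) =
  (\sum_i \sum_(0 <= c < rh i) \sum_(0 <= j < H.+1)
     ((iter j (@ordS n) i == v) && P ((i, H), c, j)))%N.
Proof.
rewrite count_cells (sum_finsupp (D := H.+1)) => [|p ->|i l Hl].
- apply: eq_bigr => i _; rewrite big_nat_recr //= big_nat big1 ?add0n => [|l /andP[_ lH]].
    by rewrite rectE eqxx.
  by rewrite rectE ltn_eqF // big_geq.
- by rewrite big_geq.
- by rewrite rectE gtn_eqF.
Qed.

Section StringHeights.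
Variables (k0 : nat) (hs : 'I_n -> seq nat).
Hypotheses (k0H : (k0 <= H)%N) (hsr : forall i, (size (hs i) <= rh i)%N).
Hypothesis hsk : forall i x, x \in hs i -> (x <= k0)%N.

Definition height i c : nat := nth 0%N (hs i) c.

(** In the c-th string with top S_i this starts [height i c] steps above rad^k0; the default 0
    leaves strings without a listed height at rad^k0. *)
Definition stairs (b : cell n) : bool := (k0 <= b.2 + height b.1.1.1 b.1.2)%N.

Lemma height_le i c : (height i c <= k0)%N.
Proof.
rewrite /height; have [cs|sc] := ltnP c (size (hs i)); last by rewrite nth_default.
by apply: hsk; apply: mem_nth.
Qed.

(** The double sum lists, string by string, the cells of the k-th radical of the stairs that lie
    above rad^k0. *)
Lemma count_stairs k v :
  (count (fun b => (k0 <= b.2) || ((k <= b.2) && (k0 <= b.2 - k + height b.1.1.1 b.1.2)))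
     (cells_at rect v)
   = count (fun b => k0 <= b.2) (cells_at rect v)
     + \sum_i \sum_(x <- hs i) \sum_(0 <= j < k0)
         ((iter j (@ordS n) i == v) && (k0 + k <= j + x)))%N.
Proof.
pose Q (b : cell n) := (b.2 < k0)%N && (k0 + k <= b.2 + height b.1.1.1 b.1.2)%N.
have -> : count (fun b : cell n => (k0 <= b.2)%N || ((k <= b.2)%N
     && (k0 <= b.2 - k + height b.1.1.1 b.1.2)%N)) (cells_at rect v)
   = count (predU (fun b : cell n => (k0 <= b.2)%N) Q) (cells_at rect v).
  apply: eq_count => -[[[i l] c] j] /=; rewrite /Q /=; have := height_le i c; lia.
have -> (s : seq (cell n)) : count (predU (fun b : cell n => (k0 <= b.2)%N) Q) s
   = (count (fun b => k0 <= b.2) s + count Q s)%N.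
  elim: s => //= b s ->; rewrite addnACA; congr (_ + _)%N.
  by rewrite /Q leqNgt; case: (b.2 < k0)%N.
congr (_ + _)%N; rewrite count_rect; apply: eq_bigr => i _.
have inner c : (\sum_(0 <= j < H.+1) ((iter j (@ordS n) i == v) && Q ((i, H), c, j))
    = \sum_(0 <= j < k0) ((iter j (@ordS n) i == v) && (k0 + k <= j + height i c)))%N.
  rewrite (@big_cat_nat _ _ _ k0) //=; last exact: leqW.
  rewrite [X in (_ + X)%N]big_nat [X in (_ + X)%N]big1 ?addn0 => [|j /andP[kj _]].
    by apply: eq_big_nat => j /andP[_ jk]; rewrite /Q /= jk.
  by rewrite /Q /= ltnNge kj andbF.
under eq_bigr => c _ do rewrite inner.
rewrite [RHS](big_nth 0%N) [LHS](@big_cat_nat _ _ _ (size (hs i))) //=.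
rewrite [X in (_ + X)%N]big_nat [X in (_ + X)%N]big1 ?addn0 // => c /andP[sc _].
rewrite big_nat big1 // => j /andP[_ jk].
by rewrite /height nth_default // addn0 leqNgt (leq_trans jk) ?leq_addr ?andbF.
Qed.

End StringHeights.

(** A segment of l + 1 cells directly above rad^k0, in a string with top i, has its top at position
    k0 - 1 - l; that vertex tells which entry of A it contributes to. *)
Definition heights_of k0 D A i : seq nat :=
  flatten [seq nseq (A (iter (k0.-1 - l) (@ordS n) i, l)) l.+1 | l <- iota 0 D].

Lemma mem_heights k0 D A i x : (D <= k0)%N -> x \in heights_of k0 D A i -> (x <= D)%N.
Proof.
move=> Dk /flattenP[s /mapP[l]]; rewrite mem_iota add0n => /andP[_ lD] ->.
by move=> /nseqP[-> _].
Qed.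

Lemma sum_heights k0 D A k v : (D <= k0)%N -> (forall i l, (D <= l)%N -> A (i, l) = 0%N) ->
  (\sum_i \sum_(x <- heights_of k0 D A i) \sum_(0 <= j < k0)
     ((iter j (@ordS n) i == v) && (k0 + k <= j + x)) = rA A k v)%N.
Proof.
move=> Dk AD; rewrite rA_sum (sum_finsupp (D := D)) //; last by move=> p ->.
rewrite [RHS]exchange_big /=.
under eq_bigr => i _.
  rewrite /heights_of big_flatten /= big_map.
  under eq_bigr => l _ do rewrite big_nseq iter_addn_0.
  over.
have iotaE (f : nat -> nat) : (\sum_(l <- iota 0 D) f l = \sum_(0 <= l < D) f l)%N.
  by rewrite /index_iota subn0.
rewrite exchange_big iotaE; apply: eq_big_nat => l /andP[_ lD].
have lk := leq_trans lD Dk.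
rewrite (reindex_inj (can_inj (iterS_cancel (n := n) (k0.-1 - l)))) /=.
apply: eq_bigr => i _; rewrite iterS_cancel mulnC; congr (_ * _)%N.
rewrite (@big_cat_nat _ _ _ (k0.-1 - l)) //=; last by lia.
rewrite big_nat big1 ?add0n => [|j /andP[_ jk]]; last first.
  by apply/eqP; rewrite eqb0 negb_and -ltnNge orbC; apply/orP; left; lia.
rewrite -{1}[(k0.-1 - l)%N]add0n big_addn.
have -> : (k0 - (k0.-1 - l) = l.+1)%N by lia.
rewrite -[RHS]sum_nat_ge; apply: eq_big_nat => j _.
by rewrite iterD iterS_cancel; congr (nat_of_bool (_ && _)); lia.
Qed.

End UniformStrings.

Section UniformModel.
Variables (F : finFieldType) (n H : nat) (rh : 'I_n -> nat).
Notation C := (rect H rh).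
Notation V := (Mrep F C).

Lemma rect_nilp : fle (pw H.+1 (full V)) (fzero V).
Proof.
move=> v; rewrite pw_full submx0 -mxrank_eq0 rank_coord -leqn0 leqNgt -has_count.
by apply/hasPn => b; rewrite mem_cells_at => /andP[_ /mem_rect[_ _ bH]]; rewrite -ltnNge.
Qed.

Lemma rect_preim v d p (X : 'M_(p, rdim V v)) : (d <= H)%N ->
  (X *m rarr V v <= pw d.+1 (full V) (ordS v))%MS -> (X <= pw d (full V) v)%MS.
Proof.
move=> dH; rewrite !pw_full => /sub_coordP HX; apply/sub_coordP => i j.
rewrite -ltnNge => jd; have := mem_cellat j.
rewrite mem_cells_at => /andP[/eqP jv jC]; have [jH jc _] := mem_rect jC.
have [k kE] : exists k, @cellat n C (ordS v) k = cell_next (cellat j).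
  apply: cellat_onto; rewrite mem_cells_at cell_vertex_next jv eqxx.
  move: jC; rewrite !mem_cells /= => /andP[-> _].
  by rewrite jH (leq_trans jd dH).
have := HX i k; rewrite kE -ltnNge /= ltnS => /(_ jd) <-.
rewrite mxE (bigD1 j) //= big1 ?addr0 => [|l lj]; last first.
  rewrite mxE -/(cellat l) -/(cellat k) kE.
  case: eqP => [e|_]; last by rewrite mulr0.
  case/eqP: lj; apply: (@cellat_inj n C v).
  by case: (cellat j) (cellat l) e => [p1 k1] [p2 k2] [-> ->].
by rewrite mxE -/(cellat j) -/(cellat k) kE eqxx mulr1.
Qed.

Lemma rA_rect k v : (k <= H)%N ->
  rA C k v = (rA C k.+1 v + rh (iter k (@ord_pred n) v))%N.
Proof.
move=> kH; rewrite /rA !count_rect.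
rewrite [X in (_ + X)%N](_ : _ = \sum_i rh i * (iter k (@ordS n) i == v))%N; last first.
  rewrite (bigD1 (iter k (@ord_pred n) v)) //= iterS_cancel eqxx muln1 big1 ?addn0 // => i.
  by case: (eqVneq (iter k (@ordS n) i) v) => [<-|_]; rewrite ?muln0 // iterS_cancel' eqxx.
rewrite -big_split; apply: eq_bigr => i _.
rewrite /= !sum_nat_const_nat !subn0 -mulnDr; congr (_ * _)%N.
by rewrite !sum_nat_ge big_ltn // addnC.
Qed.

Section Stairs.
Variables (k0 : nat) (hs : 'I_n -> seq nat).
Hypotheses (k0H : (k0 <= H)%N) (hsr : forall i, (size (hs i) <= rh i)%N).
Hypothesis hsk : forall i x, x \in hs i -> (x <= k0)%N.

Lemma stable_stairs : stable (coord F C (stairs k0 hs)).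
Proof.
move=> v; rewrite push_coord; apply: coord_mono => -[[[i l] c] j] _ /andP[/=].
by rewrite /stairs /= => j0; lia.
Qed.

Lemma typ_stairs A : (forall k v, \sum_i \sum_(x <- hs i) \sum_(0 <= j < k0)
     ((iter j (@ordS n) i == v) && (k0 + k <= j + x)) = rA A k v)%N ->
  typ (coord F C (stairs k0 hs)) (pw k0 (full V)) A.
Proof.
move=> hA k v; rewrite rank_pw_full -hA.
rewrite -(count_stairs k0H hsr hsk) -(rank_coord F).
apply: eqmx_rankE; rewrite addsmxC.
have e1 := @pw_full F n C k0 v; have e2 := @pw_coord F n C (stairs k0 hs) k v.
exact: eqmx_trans (adds_eqmx e1 e2) (@coord_add F n C _ _ v).
Qed.

End Stairs.

End UniformModel.

Lemma entry_bound n (A : Theta n) : exists D, forall i l, (D <= l)%N -> A (i, l) = 0%N.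
Proof.
have [D AD] := rA_large A; exists D => i l Dl.
by have := entry_rA A i l; rewrite AD // leqn0 => /eqP.
Qed.

Lemma kap_layer n (M : model n) k i : (k <= mH M)%N ->
  kap (canon (pw k (full (mV M)))) i
  = (\rank (pw k (full (mV M)) i))%:Z - (\rank (pw k.+1 (full (mV M)) i))%:Z.
Proof.
move=> kH; move: i; apply: ordS_all => v.
have zE u : zr (canon (pw k (full (mV M)))) u = (\rank (pw k (full (mV M)) u))%:Z.
  by rewrite ffunE (eqmx_rankE (canonE _ _)).
rewrite ffunE !zE ffunE ordSK.
have kerk : (kermx (rarr (mV M) v) <= pw k (full (mV M)) v)%MS.
  by apply: mV_preim => //; rewrite mulmx_ker sub0mx.
rewrite -(rank_push kerk) PoszD /= opprD addrACA [_ - Posz (nullity _ _)]addrC.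
by rewrite addrACA subrr add0r addrC.
Qed.

(* In each string L and L' extend L1 = rad^k0 upwards by a height prescribed by *)
(* A0 and by B0, but never both do so in the same string, so L :&: L' = L1.     *)
Lemma model_exists n (A0 B0 : Theta n) (lam : Zn n) d m0 :
  exists M : model n, (m0 <= mm M)%N /\
  exists L L' L1 : {dffun forall v : 'I_n, 'M[mF M]_(rdim (mV M) v)},
   [/\ interior d L, r_up A0 L L1, is_subrep L', r_dn B0 L1 L' &
     (forall v, (L v :&: L' v <= L1 v)%MS) /\ kap L1 - kc M = lam].
Proof.
have [D1 A0D] := entry_bound A0; have [D2 B0D] := entry_bound B0.
(* Heights are at most D, so L lies inside rad^d because k0 = d + D; and H + 1 - d = k0 + 1 gives
   the lower margin. *)
pose D := maxn D1 D2; pose k0 := (d + D)%N; pose H := (k0 + d)%N.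
have Dk0 : (D <= k0)%N by apply: leq_addl.
have k0H : (k0 <= H)%N by apply: leq_addr.
have {}A0D i l : (D <= l)%N -> A0 (i, l) = 0%N.
  by move=> Dl; apply: A0D; apply: leq_trans Dl; apply: leq_maxl.
have {}B0D i l : (D <= l)%N -> B0 (i, l) = 0%N.
  by move=> Dl; apply: B0D; apply: leq_trans Dl; apply: leq_maxr.
pose hA := heights_of k0 D A0.
(* The leading zeros reserve the first strings for A0, so that no string is raised by both. *)
pose hB i := nseq (size (hA i)) 0%N ++ heights_of k0 D B0 i.
(* Large enough for lam + c to be nonnegative and to provide all the strings required by [hB]. As
   [mc], it is subtracted again in the weight. *)
pose c : nat := (\sum_i `|lam i| + \sum_i size (hB i))%N.
have lamc i : 0 <= lam i + c%:Z.
  have : (`|lam i| <= c)%N.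
    by rewrite /c (bigD1 i) //= -addnA leq_addr.
  by move: (lam i) => z; lia.
(* A string with top j meets the top of rad^k0 at the vertex k0 steps further, so there the number
   of strings is lam + c. *)
pose rh j : nat := `|(lam (iter k0 (@ordS n) j) + c%:Z)%R|%N.
have hBr j : (size (hB j) <= rh j)%N.
  have : (`|lam (iter k0 (@ordS n) j)| + size (hB j) <= c)%N.
    rewrite /c (bigD1 (iter k0 (@ordS n) j)) //= [X in (_ <= _ + X)%N](bigD1 j) //=.
    by rewrite leq_add // leq_addr.
  by rewrite /rh; move: (lam _) (size _) => z s; lia.
have hAr j : (size (hA j) <= rh j)%N.
  by apply: leq_trans (hBr j); rewrite size_cat size_nseq leq_addr.
have hAk i x : x \in hA i -> (x <= D)%N by apply: mem_heights.
have hBk i x : x \in hB i -> (x <= D)%N.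
  by rewrite mem_cat => /orP[/nseqP[-> _]|/mem_heights ->].
have [p pm0 pp] := prime_above m0; have p0 := prime_gt0 pp.
have [F _ cF] := finfield.pPrimePowerField pp (isT : (0 < 2)%N).
pose M := @Model n F p p0 cF (Mrep F (rect H rh)) H c%:Z
  (@rect_nilp F n H rh) (@rect_preim F n H rh).
exists M; split; first exact: ltnW.
pose R := pw k0 (full (mV M)).
pose XA := coord F (rect H rh) (stairs k0 hA).
pose XB := coord F (rect H rh) (stairs k0 hB).
have sR : stable R by apply/stable_pw/stable_full.
have RX hs : fle R (coord F (rect H rh) (stairs k0 hs)).
  move=> v; rewrite /R pw_full; apply: coord_mono => b _ /= kb.
  by apply: leq_trans kb _; apply: leq_addr.
have cle (X Y : fam (mV M)) : fle X Y -> fle (canon X) (canon Y).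
  by move=> XY v; rewrite !canonE.
have sXA : stable XA by apply: stable_stairs.
have sXB : stable XB by apply: stable_stairs.
have sumA k v : (\sum_i \sum_(x <- hA i) \sum_(0 <= j < k0)
     ((iter j (@ordS n) i == v) && (k0 + k <= j + x)) = rA A0 k v)%N by apply: sum_heights.
have sumB k v : (\sum_i \sum_(x <- hB i) \sum_(0 <= j < k0)
     ((iter j (@ordS n) i == v) && (k0 + k <= j + x)) = rA B0 k v)%N.
  rewrite -(sum_heights k v Dk0 B0D); apply: eq_bigr => i _; rewrite big_cat /=.
  rewrite big_nseq [X in (X + _)%N](_ : _ = 0)%N ?add0n //.
  rewrite big_nat big1 ?iter_addn_0 ?mul0n // => j /andP[_ jk].
  by rewrite addn0 leqNgt (leq_trans jk) ?leq_addr ?andbF.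
have hk (hs : 'I_n -> seq nat) : (forall i x, x \in hs i -> (x <= D)%N) ->
    forall i x, x \in hs i -> (x <= k0)%N.
  by move=> h i x /h xD; apply: leq_trans Dk0.
have tA := typ_stairs F k0H hAr (hk hA hAk) sumA.
have tB := typ_stairs F k0H hBr (hk hB hBk) sumB.
exists (canon XA), (canon XB), (canon R); split.
- split; first exact: is_subrep_canon.
  + exact: leq_addl.
  + move=> v; rewrite canonE; apply: submx_trans (RX hA v).
    by apply: pw_anti; [apply: stable_full|rewrite /= /H; lia].
  + move=> v; rewrite canonE pw_full; apply: coord_mono => b _ kb.
    rewrite -(leq_add2r D); apply: leq_trans kb _; rewrite leq_add2l.
    exact: height_le hAk _ _.
- rewrite /r_up is_subrep_canon //=; apply/asboolP; split; first exact/cle/RX.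
  by apply: typ_eqmx tA => v; apply/eqmx_sym/canonE.
- exact: is_subrep_canon.
- rewrite /r_dn is_subrep_canon //=; apply/asboolP; split; first exact/cle/RX.
  by apply: typ_eqmx tB => v; apply/eqmx_sym/canonE.
split=> [v|].
  rewrite (cap_eqmx (canonE _ _) (canonE _ _)) canonE coord_cap /R pw_full.
  apply: coord_mono => -[[[i l] e] j] _ /=; rewrite /stairs /height /=.
  move=> /andP[kA kB]; have [es|se] := ltnP e (size (hA i)).
    by move: kB; rewrite nth_cat size_nseq es nth_nseq es addn0.
  by move: kA; rewrite nth_default // addn0.
apply/ffunP => i; rewrite [LHS]ffunE kap_layer // [X in _ + X]ffunE ffunE.
rewrite !rank_pw_full rA_rect // PoszD [X in X + _]addrAC subrr add0r.
by rewrite /rh iterS_cancel gez0_abs // addrK.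
Qed.

Section Independence.
Variables (n : nat) (phi : Theta n -> Theta n -> Theta n -> {poly int}).
Hypothesis hphi : is_hall_polynomials phi.
Implicit Types (A B : Theta n) (l m : Zn n).
Notation up := (up phi).
Notation um := (um phi).

Definition tkshift l j : term Qv (gen n) := TAdd (tK j) (TScale (- vv ^ dot l j) TOne).

Lemma dclass_tkshift l j : dclass phi (tkshift l j) = kshift phi l j.
Proof. by rewrite /dclass pclassD pclassZ scaleNr. Qed.

Lemma sem_tkshift (M : model n) l j f L :
  ev (mm M) (- vv ^ dot l j) = - (mm M)%:R ^ dot l j ->
  dot (kap L - kc M) j = dot l j -> sem M (tkshift l j) f L = 0.
Proof. by move=> e d; rewrite [LHS]/= sem_tK d e mulNr subrr. Qed.

Lemma sem_fun0 (M : model n) x f L : (forall N, f N = 0) -> sem M x f L = 0.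
Proof.
move=> f0; have := sem_lin x 0 0 f f L; rewrite !mul0r addr0 => <-.
congr (sem M x _ L); apply: functional_extensionality_dep => N.
by rewrite f0 mulr0 addr0.
Qed.

Lemma seq_max (T : eqType) (s : seq T) (P : pred T) (w : T -> nat) : has P s ->
  exists q0, [/\ q0 \in s, P q0 & forall q, q \in s -> P q -> (w q <= w q0)%N].
Proof.
elim: s => //= x s IH; have [/IH[q0 [qs Pq qm]] _|nh] := boolP (has P s); last first.
  rewrite orbF => Px; exists x; rewrite mem_head; split=> // q.
  by rewrite inE => /orP[/eqP ->|qs Pq] //; case/hasP: nh; exists q.
have [Px|nPx] := boolP (P x); last first.
  exists q0; rewrite inE qs orbT; split=> // q; rewrite inE => /orP[/eqP ->|]; last exact: qm.
  by move=> Px; rewrite Px in nPx.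
have [xq|qx] := leqP (w x) (w q0).
  exists q0; rewrite inE qs orbT; split=> // q; rewrite inE => /orP[/eqP -> //|]; exact: qm.
exists x; rewrite mem_head; split=> // q; rewrite inE => /orP[/eqP -> //|qs' Pq'].
exact: leq_trans (qm q qs' Pq') (ltnW qx).
Qed.

(* L1 is the only possible intermediate subrepresentation, since dim A0 is maximal *)
Lemma intermediate_unique (M : model n) A B A0 B0
    (L L' L1 N : {dffun forall v : 'I_n, 'M[mF M]_(rdim (mV M) v)}) :
  (forall v, (L v :&: L' v <= L1 v)%MS) -> r_up A0 L L1 -> r_dn B0 L1 L' ->
  (\sum_v rA A 0 v <= \sum_v rA A0 0 v)%N -> r_up A L N -> r_dn B N L' ->
  N = L1 /\ (A, B) = (A0, B0).
Proof.
move=> cap r0 s0 AA0 rN sN; have zA0 := zr_up r0; have zA := zr_up rN.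
case/andP: r0 => sL1 /asboolP[LL1 tA0]; case/andP: rN => sbN /asboolP[LN tA].
case/andP: s0 => _ /asboolP[_ tB0]; case/andP: sN => _ /asboolP[NL' tB].
have NL1 : fle N L1 by move=> v; apply: submx_trans (cap v); rewrite sub_capmx LN NL'.
have rk v : (\rank (N v) <= \rank (L1 v))%N by apply: mxrankS.
have rE v : (\rank (N v) + rA A 0 v = \rank (L1 v) + rA A0 0 v)%N.
  have := congr1 (fun z : Zn n => z v) zA; have := congr1 (fun z : Zn n => z v) zA0.
  rewrite !dimvecE !ffunE; lia.
have eN v : \rank (N v) = \rank (L1 v).
  have e : (\sum_v \rank (N v) + \sum_v rA A 0 v
      = \sum_v \rank (L1 v) + \sum_v rA A0 0 v)%N.
    by rewrite -!big_split; apply: eq_bigr.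
  have le : (\sum_v \rank (L1 v) <= \sum_v \rank (N v))%N.
    by rewrite -(leq_add2r (\sum_v rA A 0 v)) e leq_add2l.
  have := @leqif_sum _ xpredT (fun v => \rank (N v) == \rank (L1 v))
    (fun v => \rank (N v)) (fun v => \rank (L1 v)) (fun v _ => leqif_eq (rk v)).
  by case=> le' ; rewrite eqn_leq le' le => /esym/forallP/(_ v)/eqP.
have NE : N = L1.
  apply: subrep_eq => // v; apply/eqmxP.
  by rewrite -(geq_leqif (mxrank_leqif_eq (NL1 v))) eN.
by subst N; rewrite (typ_uniq tA tA0) (typ_uniq tB tB0).
Qed.

(** A vanishing combination is, in the algebra, a sum of elements with a left factor K^j - v^(l.j)
    or a right factor K^j - v^(m.j). In a model where L has weight l and L' has weight m, these
    contribute nothing at the pair L, L', and one nonzero coefficient would survive. *)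
Lemma wpi_independent l m (s : seq (Theta n * Theta n)) (c : Theta n * Theta n -> Qv) :
  uniq s -> (forall q, q \in s -> degv q.1 - degv q.2 = l - m) ->
  wpi l m (\sum_(q <- s) c q *: (up q.1 * um q.2)) = 0 ->
  forall q, q \in s -> c q = 0.
Proof.
move=> us ds H q qs; apply/eqP; apply: contraT => cq.
have [q0 [q0s c0 qmax]] := @seq_max _ s (fun q => c q != 0)
  (fun q => \sum_v rA q.1 0 v)%N (introT hasP (ex_intro2 _ _ q qs cq)).
move: H; rewrite -(@wpi0 n phi l m) => /wpiP/widealP[s1 [s2]]; rewrite subr0 => H.
pose X : term Qv (gen n) :=
  \big[@TAdd _ _/TZero]_(q <- s) TScale (c q) (TMul (tup q.1) (tum q.2)).
pose Y1 : term Qv (gen n) :=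
  \big[@TAdd _ _/TZero]_(p <- s1) TMul (tkshift l p.1) (prepr p.2).
pose Y2 : term Qv (gen n) :=
  \big[@TAdd _ _/TZero]_(p <- s2) TMul (prepr p.2) (tkshift m p.1).
have XY : dclass phi X = dclass phi (TAdd Y1 Y2).
  rewrite [RHS]pclassD -!/(dclass phi _) /X /Y1 /Y2 !dclass_sum.
  rewrite (eq_bigr (fun q => c q *: (up q.1 * um q.2))); last first.
    by move=> p _; rewrite dclass_Z dclass_M.
  rewrite H; congr (_ + _); apply: eq_bigr => p _;
    by rewrite dclass_M dclass_tkshift /dclass preprK.
have [d [k1 H1]] := presented_eqv hphi XY.
have [k2 H2] := isev_neq0 c0.
have [k3 H3] := isev0.
have [k4 H4] := @isev_seq _ (map fst s1) (fun j : Zn n => - vv ^ dot l j) _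
  (fun j => isevN (isev_vvz (dot l j))).
have [k5 H5] := @isev_seq _ (map fst s2) (fun j : Zn n => - vv ^ dot m j) _
  (fun j => isevN (isev_vvz (dot m j))).
(* The weight to be given to L1, so that L and L' acquire the weights l and m. *)
pose lam : Zn n := l - degv q0.1.
have lE : l = degv q0.1 + lam by rewrite addrC subrK.
have mE : m = degv q0.2 + lam.
  rewrite /lam addrCA -[degv q0.2 - _]opprB ds // opprB addrC subrK //.
have [M [kM [L [L' [L1 [iL r0 sL' s0 [cap kL1]]]]]]] :=
  model_exists q0.1 q0.2 lam d (maxn k1 (maxn k2 (maxn k3 (maxn k4 k5)))).
move: kM; rewrite !geq_max => /and5P[g1 g2 g3 g4 g5].
have wL j : dot (kap L - kc M) j = dot l j.
  by rewrite (dot_kap L L1) kL1 (zr_up r0) lE dotDl dot_rootv.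
have wL' j : dot (kap L' - kc M) j = dot m j.
  by rewrite (dot_kap L' L1) kL1 (zr_dn s0) mE dotDl dot_rootv.
(* The K act diagonally, so a right factor K^j - v^(m.j) annihilates this function altogether, and a
   left factor K^j - v^(l.j) gives zero upon evaluation at L. *)
pose f (N : {dffun forall v : 'I_n, 'M[mF M]_(rdim (mV M) v)}) : rat := (N == L')%:R.
have Y10 : sem M Y1 f L = 0.
  rewrite /Y1 sem_sum big_seq big1 // => p ps.
  by rewrite -[LHS]/(sem M (tkshift l p.1) _ L) sem_tkshift // H4 ?map_f.
have Y20 : sem M Y2 f L = 0.
  rewrite /Y2 sem_sum big_seq big1 // => p ps.
  rewrite -[LHS]/(sem M (prepr p.2) (sem M (tkshift m p.1) f) L) sem_fun0 // => N.
  have [->|NL'] := eqVneq N L'.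
    by rewrite sem_tkshift // H5 ?map_f.
  by rewrite [LHS]/= sem_tK /f (negbTE NL') !mulr0 addr0.
have : sem M X f L = 0.
  by rewrite (H1 M _ f L iL) ?[LHS]/= ?Y10 ?Y20 ?addr0.
rewrite /X sem_sum (bigD1_seq q0) //= [X in _ + X]big1_seq ?addr0; last first.
  move=> p /andP[pq0 ps]; have [cp|cp] := eqVneq (c p) 0.
    by rewrite cp H3 ?mul0r.
  rewrite big1 ?mulr0 // => N rN; rewrite big1 ?mulr0 // => P sP.
  have [PL|PL] := eqVneq P L'; last by rewrite /f (negbTE PL) mulr0.
  rewrite PL in sP.
  have [_ e] := intermediate_unique cap r0 s0 (qmax p ps cp) rN sP.
  by case/eqP: pq0; rewrite [p]surjective_pairing [q0]surjective_pairing.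
rewrite (bigD1 L1) //= [X in _ + X]big1 ?addr0; last first.
  move=> N /andP[rN NL1]; rewrite big1 ?mulr0 // => P sP.
  have [PL|PL] := eqVneq P L'; last by rewrite /f (negbTE PL) mulr0.
  rewrite PL in sP.
  have [e _] := intermediate_unique cap r0 s0 (leqnn _) rN sP.
  by rewrite e eqxx in NL1.
rewrite (bigD1 L') //= [X in _ + X]big1 ?addr0; last first.
  by move=> P /andP[_ /negbTE PL]; rewrite /f PL mulr0.
rewrite /f eqxx mulr1 => e.
suff : ev (mm M) (c q0) * (w_up L L1 * w_dn L1 L') != 0 by rewrite e eqxx.
apply: mulf_neq0; first exact: H2.
by apply: mulf_neq0; apply: expfz_neq0 (m0 M).
Qed.

Lemma dpi_id l m (t : DD phi) : dpi l m t (l, m) = wpi l m t.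
Proof. exact: (@dinj_id _ _ (fun p => wD phi p.1 p.2 : lmodType Qv) (l, m)). Qed.

Lemma dpi_neq l m (t : DD phi) k : (l, m) != k -> dpi l m t k = 0.
Proof. exact: (@dinj_neq _ _ (fun p => wD phi p.1 p.2 : lmodType Qv) (l, m)). Qed.

(** In the component (l, m) the middle weight is determined by A as l - deg u^+_A, so each component
    is a case of [wpi_independent]. *)
Lemma ustd_independent (s : seq (Theta n * Zn n * Theta n)) c : uniq s ->
  \sum_(i <- s) c i *: ustd phi i.1.1 i.1.2 i.2 = 0 -> forall i, i \in s -> c i = 0.
Proof.
move=> us H [[A0 lam] B0] is0.
pose l := lam + degv A0; pose m := lam + degv B0.
pose w (i : Theta n * Zn n * Theta n) := (i.1.2 + degv i.1.1, i.1.2 + degv i.2).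
pose nrm A B : Qv := vv ^ norm_exp A * vv ^ norm_exp B.
pose s2 := [seq (i.1.1, i.2) | i <- s & w i == (l, m)].
pose c2 (q : Theta n * Theta n) := c (q.1, l - degv q.1, q.2) * nrm q.1 q.2.
have wE i : w i == (l, m) -> (i.1.1, l - degv i.1.1, i.2) = i.
  by case: i => [[A k] B] /eqP[<- _] /=; rewrite addrK.
have nrm0 A B : nrm A B != 0.
  by rewrite /nrm -vvD expfz_neq0 // -unitfE vv_unit.
have in2 : (A0, B0) \in s2.
  by apply/mapP; exists (A0, lam, B0) => //; rewrite mem_filter eqxx.
have := @wpi_independent l m s2 c2 _ _ _ _ in2.
suff : c2 (A0, B0) = 0 -> c (A0, lam, B0) = 0.
  move=> c20 c2E; apply: c20; apply: c2E.
  - rewrite map_inj_in_uniq ?filter_uniq // => i j; rewrite !mem_filter.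
    by move=> /andP[/wE wi _] /andP[/wE wj _] [e1 e2]; rewrite -wi -wj e1 e2.
  - move=> q /mapP[i]; rewrite mem_filter => /andP[/eqP[<- <-] _] -> /=.
    by rewrite opprD addrACA subrr add0r.
  transitivity ((\sum_(i <- s) c i *: ustd phi i.1.1 i.1.2 i.2) (l, m)); last by rewrite H.
  rewrite dsum_sum /s2 big_map big_filter wpi_sum big_mkcond; apply: eq_bigr => i _.
  rewrite ustdE -[RHS]/(c i *: (nrm i.1.1 i.2 *: (dpi (w i).1 (w i).2 (up i.1.1 * um i.2) (l, m)))).
  case: eqP => [wi|/eqP wi].
    have -> : dpi (w i).1 (w i).2 (up i.1.1 * um i.2) (l, m) = wpi l m (up i.1.1 * um i.2).
      by rewrite wi; apply: dpi_id.
    by rewrite wpiZ scalerA /c2 /= wE // wi.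
  by rewrite dpi_neq -?surjective_pairing // !scaler0.
rewrite /c2 /= /l addrK => e; apply: (@mulIf Qv _ (nrm0 A0 B0)).
by rewrite e mul0r.
Qed.

Lemma intD_free : is_free (@intD n phi).
Proof.
exists (Theta n * Zn n * Theta n : choiceType)%type.
exists (fun i => ustd phi i.1.1 i.1.2 i.2); split.
- move=> i; exists [:: (1, i)]; rewrite big_seq1 scale1r; split=> // p.
  by rewrite inE => /eqP ->; apply/lauP; rewrite rpred1.
- move=> x [s [sL ->]]; pose J := (Theta n * Zn n * Theta n)%type.
  pose c (i : J) : Qv := \sum_(p <- s) if p.2 == i then p.1 else 0.
  exists (undup (map snd s)), c; split=> [i|].
    apply/lauP; rewrite /c big_seq; apply: rpred_sum => p ps.
    by case: ifP => _; [apply/lauP/sL|rewrite rpred0].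
  transitivity (\sum_(i <- undup (map snd s)) \sum_(p <- s)
      (if p.2 == i then p.1 else 0) *: ustd phi i.1.1 i.1.2 i.2); last first.
    by apply: eq_bigr => i _; rewrite /c scaler_suml.
  rewrite exchange_big big_seq [RHS]big_seq; apply: eq_bigr => p ps.
  rewrite (bigD1_seq p.2) ?mem_undup ?undup_uniq ?map_f //= eqxx big1 ?addr0 // => i.
  by rewrite eq_sym => /negbTE ->; rewrite scale0r.
- by move=> s c us _; apply: ustd_independent.
Qed.

End Independence.

Theorem theorem4p2 (n : nat) (hn : (2 <= n)%N)
    (phi : Theta n -> Theta n -> Theta n -> {poly int})
    (hphi : is_hall_polynomials phi) :
  is_subalgebra (@ddmul n phi) (@intD n phi)
  /\ is_integral_form (@ddmul n phi) (@intD n phi).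
Proof.
split; first exact: intD_subalgebra.
split; [exact: intD_subalgebra|exact: intD_free|].
by apply: scalar_extension_of_denominators (intD_denominator hphi); case: (intD_subalgebra hphi).
Qed.
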